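(* Let $\zeta_8=e^{2\pi i/8}$, $\zeta_{16}=e^{2\pi i/16}$. For $(\lambda,\mu)\in\mathbb{Q}^2\setminus\{(0,0)\}$, let $$\tau_{\lambda,\mu}:=\lambda(\zeta_8^2-\zeta_8^3)+\mu(1+\zeta_8)=\lambda\sqrt{2-\sqrt2}\,\zeta_{16}+\mu\sqrt{2+\sqrt2}\,\zeta_{16}.$$ The following hold (writing $\tau=\tau_{\lambda,\mu}$): (1) The space $\langle 1,\tau_{\lambda,\mu}\rangle_{\mathbb{Q}}$ only depends on $[\lambda:\mu]\in\mathbb{P}_1(\mathbb{Q})$. Denote it by $V_{[\lambda:\mu]}$. (2) Let $\tau'\in\mathbb{Q}(\zeta_8)$ generate a space $V=\langle 1,\tau'\rangle_{\mathbb{Q}}$ such that the squared angle between $1$ and $\tau'$ is $\zeta_8$. There exists $(\lambda,\mu)\in\mathbb{Q}^2\setminus\{(0,0)\}$ such that $\tau'=\tau_{\lambda,\mu}$. (3) Conversely, for every $(\lambda,\mu)\in\mathbb{Q}^2\setminus\{(0,0)\}$, the squared angle between $1$ and $\tau_{\lambda,\mu}$ is $\zeta_8$. (4) For every $[\lambda:\mu]\in\mathbb{P}_1(\mathbb{Q})$, the complex conjugate $\overline{V_{[\lambda:\mu]}}$ is homothetic to $V_{[\lambda:\mu]}$. (5) The map $f$ from $\mathbb{P}_1(\mathbb{Q})$ to the set of homothety classes of spaces sending $[\lambda:\mu]$ to the class of $V_{[\lambda:\mu]}$ is 2-to-1. The involution $\iota:[\lambda:\mu]\mapsto[\lambda+\mu:\lambda-\mu]$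 preserves the fibres of $f$. (6) Let $S=\{[0:1],[1:0],[1:1],[-1:1]\}$; one has $\iota([0:1])=[1:-1]$ and $\iota([1:0])=[1:1]$. If $[\lambda:\mu]=[0:1]$ or $[-1:1]$, the space is of type $[4]$; a rational quadruple of $V_{[0:1]}$ is $\{1,\tau_{0,1},\tau_{0,1}-1,\tau_{0,1}-2\}$, and the various angles in this quadruple realise all the squared amplitudes $\zeta_8,\zeta_8^2,\zeta_8^3,\zeta_8^4$ (this is the configuration formed by the sides and diagonals of a rhombus with angles $\pi/4$ and $3\pi/4$). If $[\lambda:\mu]=[1:0]$ or $[1:1]$, the space is of type $[3]+[3]$; the two rational triples of $V_{[1:0]}$ are $\{\tau_{1,0}+1,\tau_{1,0}-2,\tau_{1,0}-\frac12\}$ and $\{1,\tau_{1,0},\tau_{1,0}-1\}$; this space is homothetic to $\langle 1,\zeta_8^2+\zeta_8+1\rangle_{\mathbb{Q}}$. (7) If $[\lambda:\mu]\notin S$, the space $V_{[\lambda:\mu]}$ contains precisely two angles with squared amplitude $\zeta_8$ and precisely two angles with squared amplitude $\zeta_8^3$. Those with squared amplitude $\zeta_8$ are $(1,\tau)$ and $(\tau+a,\tau+b)$, where $$a=\frac{\lambda^2-2\lambda\mu-\mu^2}{\lambda+\mu},\qquad b=-\frac{2(\lambda^3+2\lambda^2\mu-\lambda\mu^2)}{\lambda^2-2\lambda\mu-\mu^2};$$ those with squared amplitude $\zeta_8^3$ are $(\tau+c,\tau+d)$ and $(\tau+c',\tau+d')$, where $$c=\frac{-\lambda^2-2\lambda\mu+\mu^2}{2\lambda},\quad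 d=-2(\lambda+\mu),\quad c'=-2\mu,\quad d'=\frac{\lambda^2+2\lambda\mu-\mu^2}{\mu-\lambda}.$$ (8) Let $[\lambda:\mu]\notin S$. The space $V_{[\lambda:\mu]}$ contains an angle with squared amplitude $\zeta_8^2$ if and only if $\lambda(\lambda^3+\lambda^2\mu+\lambda\mu^2+\mu^3)$ is the square of a rational number $u$. In this case, setting $$e_\pm=\frac{\lambda^2-\mu^2\mp u}{\mu},\qquad f_\pm=\frac{-2\lambda\mu\pm u}{\lambda},$$ the space $V_{[\lambda:\mu]}$ contains precisely two angles with squared amplitude $\zeta_8^2$, given by $(\tau+e_+,\tau+f_+)$ and $(\tau+e_-,\tau+f_-)$. The curve $u^2=\lambda(\lambda^3+\lambda^2\mu+\lambda\mu^2+\mu^3)$ in weighted projective space $\mathbb{P}_{\mathbb{Q}}(1,1,2)$ has genus 1 and a rational point, so it defines an elliptic curve; it is isomorphic over $\mathbb{Q}$ to the elliptic curve with Weierstrass equation $y^2=x^3+x^2+x+1$, whose Mordell-Weil group over $\mathbb{Q}$ is $\mathbb{Z}\oplus\mathbb{Z}/2\mathbb{Z}$, and a generator for the free part is $(0,1)$. The set of $[\lambda:\mu]$ such that $V_{[\lambda:\mu]}$ contains an angle of squared amplitude $\zeta_8^2$ is stable under $\iota$, and the map $[\lambda:\mu:u]\mapsto[\lambda+\mu:\lambda-\mu:-2u]$ is a lift of $\iota$ to an involution of the elliptic curve (with origin $[0:1:0]$); it corresponds to translation by the non-trivial 2-torsion point $[1:-1:0]$. (9) Let $[\lambda:\mu]\notin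 S$. The space $V_{[\lambda:\mu]}$ contains an angle with squared amplitude $\zeta_8^4$ if and only if $3\lambda^4+2\lambda^3\mu+4\lambda^2\mu^2+2\lambda\mu^3+\mu^4$ is the square of a rational number $v$. In this case, setting $$g_\pm=\frac{\lambda^2-2\lambda\mu-\mu^2\mp v}{\lambda+\mu},\qquad h_\pm=\frac{\lambda^2-2\lambda\mu-\mu^2\pm v}{\lambda+\mu},$$ the rational angles in $V_{[\lambda:\mu]}$ with squared amplitude $\zeta_8^4$ are precisely $(\tau+g_+,\tau+h_+)$ and $(\tau+g_-,\tau+h_-)$. The curve $v^2=3\lambda^4+2\lambda^3\mu+4\lambda^2\mu^2+2\lambda\mu^3+\mu^4$ in $\mathbb{P}_{\mathbb{Q}}(1,1,2)$ has genus 1 and a rational point, so it defines an elliptic curve; it is isomorphic over $\mathbb{Q}$ to the elliptic curve with Weierstrass equation $y^2+2xy-2y=x^3-6x^2-3x$, whose Mordell-Weil group over $\mathbb{Q}$ is $\mathbb{Z}\oplus\mathbb{Z}/2\mathbb{Z}$, and a generator for the free part is $(0,2)$. Moreover $g_+g_-=ab$, with $a,b$ as in (7). (10) Let $[\lambda:\mu]\notin S$. The space $V_{[\lambda:\mu]}$ does not have both an angle with squared amplitude $\zeta_8^2$ and an angle with squared amplitude $\zeta_8^4$.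
   Context: A space is the $\mathbb{Q}$-span of two $\mathbb{R}$-linearly independent elements of $\mathbb{C}$; $\langle\cdot\rangle_{\mathbb{Q}}$ denotes $\mathbb{Q}$-span. Two spaces $V_1,V_2$ are homothetic if $V_2=\kappa V_1$ for some $\kappa\in\mathbb{C}^*$. A rational angle in $V$ is a pair $(v_1,v_2)$ of $\mathbb{R}$-linearly independent elements of $V$ such that the argument of $v_1/v_2$ is a rational multiple of $\pi$; swapping $v_1,v_2$ or multiplying them by nonzero rational numbers defines the same angle. Its squared amplitude is $\nu^2$, where $\nu$ is a root of unity with $\nu v_1/v_2\in\mathbb{R}$; since the order of $v_1,v_2$ is immaterial, it is only defined up to inversion, so ''an angle with squared amplitude $\zeta$'' means squared amplitude $\zeta$ or $\zeta^{-1}$. ''The squared angle between $1$ and $\tau$ is $\zeta$'' means $\tau/\overline{\tau}=\zeta$. A rational $n$-tuple in $V$ is an $n$-tuple of elements of $V$ any two of which form a rational angle. A space is of type $[n_1]+\cdots+[n_k]$ if it contains rational $n_1$-, ..., $n_k$-tuples that are pairwise disjoint (up to rational multiples). $\mathbb{P}_{\mathbb{Q}}(1,1,2)$ is weighted projective space with coordinates of weights $1,1,2$, in the order $\lambda,\mu$ and then $u$ (or $v$). *)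

(* Defs.v *)
From HB Require Import structures.
From mathcomp Require Import all_boot all_order all_algebra all_field.
From mathcomp Require Import complex.
From mathcomp Require Import boolp classical_sets functions cardinality reals.
From mathcomp Require Import topology normedtype trigo.
(* The notations of mpoly clash with those of mathcomp-classical. *)
From mathcomp Require Import -(notations) mpoly.

Set Implicit Arguments.
Unset Strict Implicit.
Unset Printing Implicit Defensive.

Import Order.TTheory GRing.Theory Num.Theory.

Local Open Scope classical_set_scope.
Local Open Scope ring_scope.
Local Open Scope complex_scope.

Section Spaces.
Variable R : realType.
Local Notation C := R[i].
Implicit Types (V W : set C) (v w z : C).

Definition expi (t : R) : C := cos t +i* sin t.

Definition zeta (n : nat) : C := expi (2 * pi / n%:R).

Definition R_independent v1 v2 : Prop :=
  forall a b : R, a%:C * v1 + b%:C * v2 = 0 -> a = 0 /\ b = 0.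

Definition Qspan v1 v2 : set C :=
  [set z | exists p q : rat, z = ratr p * v1 + ratr q * v2].

Definition is_space V : Prop :=
  exists v1 v2, R_independent v1 v2 /\ V = Qspan v1 v2.

Definition homothetic V W : Prop :=
  exists2 k : C, k != 0 & W = (fun z => k * z) @` V.

Definition homothety_class V : set (set C) :=
  [set W | is_space W /\ homothetic V W].

Definition Qadjoin z : set C :=
  [set x | exists p q : {poly rat}, (map_poly ratr q).[z] != 0 /\
     x = (map_poly ratr p).[z] / (map_poly ratr q).[z]].

Definition rational_angle V v1 v2 : Prop :=
  [/\ V v1, V v2, R_independent v1 v2 &
   exists (r : R) (q : rat), 0 < r /\ v1 / v2 = r%:C * expi (ratr q * pi)].

Definition Qproportional v w : Prop := exists2 r : rat, r != 0 & w = ratr r * v.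

Definition same_angle (A B : C * C) : Prop :=
  (Qproportional A.1 B.1 /\ Qproportional A.2 B.2) \/
  (Qproportional A.1 B.2 /\ Qproportional A.2 B.1).

(* (v1, v2) is a rational angle of V whose squared amplitude, which is only
   defined up to inversion, is z. *)
Definition angle_sqamp V z v1 v2 : Prop :=
  rational_angle V v1 v2 /\
  exists nu : C, [/\ exists2 n : nat, (0 < n)%N & nu ^+ n = 1,
                     exists x : R, nu * v1 / v2 = x%:C
                   & nu ^+ 2 = z \/ nu ^+ 2 = z^-1].

Definition contains_sqamp V z : Prop := exists v1 v2, angle_sqamp V z v1 v2.

(* The list s may repeat an angle. *)
Definition angles_are V z (s : seq (C * C)) : Prop :=
  (forall A, A \in s -> angle_sqamp V z A.1 A.2) /\
  (forall v1 v2, angle_sqamp V z v1 v2 ->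
     exists2 A, A \in s & same_angle A (v1, v2)).

Definition two_angles V z (A B : C * C) : Prop :=
  angles_are V z [:: A; B] /\ ~ same_angle A B.

Definition rational_tuple V (s : seq C) : Prop :=
  (forall v, v \in s -> V v) /\
  (forall i j, (i < j < size s)%N -> rational_angle V s`_i s`_j).

Definition Qdisjoint (s t : seq C) : Prop :=
  forall v w, v \in s -> w \in t -> ~ Qproportional v w.

(* Equality as unordered tuples, up to nonzero rational multiples; adequate for
   rational tuples, whose entries are pairwise non-proportional. *)
Definition same_tuple (s t : seq C) : Prop :=
  (forall v, v \in s -> exists2 w, w \in t & Qproportional v w) /\
  (forall w, w \in t -> exists2 v, v \in s & Qproportional v w).

Definition of_type V (ns : seq nat) : Prop :=
  exists ts : seq (seq C),
    [/\ map size ts = ns,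
        forall s, s \in ts -> rational_tuple V s
      & forall i j, (i < j < size ts)%N ->
          Qdisjoint (nth [::] ts i) (nth [::] ts j)].

(* The vertices are, in cyclic order, A, B, D, E; alpha is the angle at A and
   beta the angle at B. *)
Definition rhombus (A B D E : C) (alpha beta : R) : Prop :=
  [/\ B - A = D - E, `|B - A| = `|E - A|,
      exists2 r : R, 0 < r & (E - A) / (B - A) = r%:C * expi alpha
    & exists2 r : R, 0 < r & (A - B) / (D - B) = r%:C * expi beta].

Definition tau (l m : rat) : C :=
  ratr l * (zeta 8 ^+ 2 - zeta 8 ^+ 3) + ratr m * (1 + zeta 8).

Definition Vpair (l m : rat) : set C := Qspan 1 (tau l m).

(* V_L for a point L of P_1(Q), viewed as a set of pairs: the union of the
   V_(l, m) over all homogeneous coordinates (l, m) of L. *)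
Definition Vproj (L : set (rat * rat)) : set C :=
  \bigcup_(p in L) Vpair p.1 p.2.

End Spaces.

Section ProjectiveLine.
Variable F : fieldType.

(* [l : m], as the set of all its homogeneous coordinates *)
Definition proj (l m : F) : set (F * F) :=
  [set p | exists2 t : F, t != 0 & p = (t * l, t * m)].

Definition projline : set (set (F * F)) :=
  [set L | exists l m, (l, m) != (0, 0) /\ L = proj l m].

Definition iotaP (L : set (F * F)) : set (F * F) :=
  (fun p => (p.1 + p.2, p.1 - p.2)) @` L.

End ProjectiveLine.

Definition Sexc : set (set (rat * rat)) :=
  [set proj 0 1; proj 1 0; proj 1 1; proj (-1) 1].

(* Only fibres over points of the image are considered. *)
Definition two_to_one (T U : Type) (A : set T) (f : T -> U) : Prop :=
  forall x, A x -> (A `&` [set y | f y = f x] #= `I_2)%card.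

(* Points of a weighted projective plane are given by homogeneous coordinates, i.e. functions on 'I_3, and
   geometric points have coordinates in algC. *)

Definition vec3 (T : Type) (a b c : T) : 'I_3 -> T := tnth [tuple a; b; c].

Definition i0 : 'I_3 := @Ordinal 3 0 isT.
Definition i1 : 'I_3 := @Ordinal 3 1 isT.
Definition i2 : 'I_3 := @Ordinal 3 2 isT.

Definition wdeg (w : 'I_3 -> nat) (m : multinom 3) : nat :=
  (\sum_(i < 3) w i * m i)%N.

Lemma wdeg0 w : wdeg w mnm0 = 0%N.
Proof. by apply: big1 => i _; rewrite mnm0E muln0. Qed.

Lemma wdegD w : {morph wdeg w : m1 m2 / mnm_add m1 m2 >-> (m1 + m2)%N}.
Proof.
by move=> m1 m2; rewrite /wdeg -big_split; apply: eq_bigr => i _;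
   rewrite mnmDE mulnDr.
Qed.

HB.instance Definition _ w := isMeasure.Build 3 (wdeg w) (wdeg0 w) (@wdegD w).

Definition whomog (w : 'I_3 -> nat) (d : nat) (p : mpoly 3 rat) : bool :=
  p \is ishomog1 d (wdeg w).

Definition peval (F : fieldType) (p : mpoly 3 rat) (P : 'I_3 -> F) : F :=
  mmap ratr P p.

Definition wequiv (F : fieldType) (w : 'I_3 -> nat) (P Q : 'I_3 -> F) : Prop :=
  exists2 t : F, t != 0 & forall i, Q i = t ^+ w i * P i.

Definition points (F : fieldType) (p : mpoly 3 rat) : set ('I_3 -> F) :=
  [set P | (exists i, P i != 0) /\ peval p P = 0].

(* Jacobian criterion at a geometric point having a nonzero coordinate of
   weight 1, hence at which the weighted projective plane is smooth *)
Definition smooth_curve (w : 'I_3 -> nat) (p : mpoly 3 rat) : Prop :=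
  forall P : 'I_3 -> algC, points p P ->
    (exists i, w i = 1%N /\ P i != 0) /\
    (exists j, peval (mderiv j p) P != 0).

(* The ring of regular functions over Q of the affine open subset of the curve
   where the coordinates in I do not vanish: the homogeneous fractions of
   degree 0 whose denominator is a monomial in these coordinates. *)
Definition regular_on (w : 'I_3 -> nat) (p : mpoly 3 rat) (I : {set 'I_3})
    (f : ('I_3 -> algC) -> algC) : Prop :=
  exists (k : 'I_3 -> nat) (G : mpoly 3 rat),
    whomog w (\sum_(i in I) k i * w i)%N G /\
    forall P, points p P -> (forall i, i \in I -> P i != 0) ->
      f P = peval G P / \prod_(i in I) P i ^+ k i.

(* The smooth curve X : p = 0 is geometrically connected (H^0(X, O_X) = Q) and
   its genus, the dimension of H^1(X, O_X), is g. Cohomology is computed with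
   a cover by two affine open subsets x_i != 0 and x_j != 0; the functions h
   form a basis of O(U_i `&` U_j) / (O(U_i) + O(U_j)). *)
Definition smooth_curve_of_genus (w : 'I_3 -> nat) (p : mpoly 3 rat) (g : nat) :
    Prop :=
  smooth_curve w p /\
  exists i j : 'I_3,
  [/\ forall P : 'I_3 -> algC, points p P -> P i != 0 \/ P j != 0,
      forall f, regular_on w p [set i]%SET f -> regular_on w p [set j]%SET f ->
        exists c : rat, forall P, points p P -> f P = ratr c
    & exists h : 'I_g -> ('I_3 -> algC) -> algC,
        (forall k, regular_on w p [set i; j]%SET (h k)) /\
        forall f, regular_on w p [set i; j]%SET f ->
          exists! c : {ffun 'I_g -> rat},
          exists f1 f2,
            [/\ regular_on w p [set i]%SET f1, regular_on w p [set j]%SET f2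
              & forall P, points p P -> P i != 0 -> P j != 0 ->
                  f P = \sum_(k < g) ratr (c k) * h k P + f1 P + f2 P]].

(* Morphisms over Q, given on geometric points: locally, the coordinates of the
   image are homogeneous polynomials with rational coefficients, of degrees
   proportional to the weights of the target. *)
Definition regular_map (w w' : 'I_3 -> nat) (p p' : mpoly 3 rat)
    (f : ('I_3 -> algC) -> ('I_3 -> algC)) : Prop :=
  forall P, points p P -> points p' (f P) /\
    exists (d : nat) (G : 'I_3 -> mpoly 3 rat),
      [/\ forall i, whomog w (w' i * d)%N (G i),
          exists i, peval (G i) P != 0
        & forall Q, points p Q -> (exists i, peval (G i) Q != 0) ->
            wequiv w' (fun i => peval (G i) Q) (f Q)].

Definition isomorphism (w w' : 'I_3 -> nat) (p p' : mpoly 3 rat)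
    (f g : ('I_3 -> algC) -> ('I_3 -> algC)) : Prop :=
  [/\ regular_map w w' p p' f, regular_map w' w p' p g,
      forall P, points p P -> wequiv w (g (f P)) P
    & forall Q, points p' Q -> wequiv w' (f (g Q)) Q].

Definition w111 : 'I_3 -> nat := vec3 1%N 1%N 1%N.
Definition w112 : 'I_3 -> nat := vec3 1%N 1%N 2%N.

Definition coordX (i : 'I_3) : mpoly 3 rat := mpolyX rat (mnm1 i).

Record weierstrass := Weierstrass
  { wa1 : rat; wa2 : rat; wa3 : rat; wa4 : rat; wa6 : rat }.

Definition wcubic (E : weierstrass) : mpoly 3 rat :=
  let X := coordX i0 in let Y := coordX i1 in let Z := coordX i2 in
  Y ^+ 2 * Z + wa1 E *: (X * Y * Z) + wa3 E *: (Y * Z ^+ 2)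
  - (X ^+ 3 + wa2 E *: (X ^+ 2 * Z) + wa4 E *: (X * Z ^+ 2)
     + wa6 E *: Z ^+ 3).

(* None is the point at infinity [0 : 1 : 0]. *)
Definition affine_point (F : fieldType) (P : 'I_3 -> F) : option (F * F) :=
  if P i2 == 0 then None else Some (P i0 / P i2, P i1 / P i2).

Definition on_weierstrass (F : fieldType) (E : weierstrass)
    (P : option (F * F)) : Prop :=
  if P is Some (x, y) then
    y ^+ 2 + ratr (wa1 E) * x * y + ratr (wa3 E) * y
    = x ^+ 3 + ratr (wa2 E) * x ^+ 2 + ratr (wa4 E) * x + ratr (wa6 E)
  else True.

Definition ec_add (F : fieldType) (E : weierstrass) (P Q : option (F * F)) :
    option (F * F) :=
  match P, Q with
  | None, _ => Q
  | _, None => P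
  | Some (x1, y1), Some (x2, y2) =>
    let a1 := ratr (wa1 E) in let a2 := ratr (wa2 E) in
    let a3 := ratr (wa3 E) in let a4 := ratr (wa4 E) in
    let sum s := (* s: slope of the chord or tangent *)
      let x3 := s ^+ 2 + a1 * s - a2 - x1 - x2 in
      Some (x3, - (y1 + s * (x3 - x1)) - a1 * x3 - a3) in
    if x1 != x2 then sum ((y2 - y1) / (x2 - x1))
    else if y1 + y2 + a1 * x2 + a3 == 0 then None
    else sum ((3 * x1 ^+ 2 + 2 * a2 * x1 + a4 - a1 * y1)
              / (2 * y1 + a1 * x1 + a3))
  end.

(* The group E(Q) is isomorphic to Z + Z/2Z, and the isomorphism can be chosen
   to send the generator (1, 0) of the free part to P0. *)
Definition MW_Z_Z2 (E : weierstrass) (P0 : option (rat * rat)) : Prop :=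
  exists phi : int * 'Z_2 -> option (rat * rat),
    [/\ injective phi,
        forall P, on_weierstrass E P <-> exists x, phi x = P,
        forall x y, phi (x + y) = ec_add E (phi x) (phi y)
      & phi (1, 0) = P0].

Definition curveU : mpoly 3 rat :=
  let l := coordX i0 in let m := coordX i1 in let u := coordX i2 in
  u ^+ 2 - l * (l ^+ 3 + l ^+ 2 * m + l * m ^+ 2 + m ^+ 3).

Definition EU : weierstrass := Weierstrass 0 1 0 1 1.

Definition curveV : mpoly 3 rat :=
  let l := coordX i0 in let m := coordX i1 in let v := coordX i2 in
  v ^+ 2 - (3%:R *: l ^+ 4 + 2%:R *: (l ^+ 3 * m) + 4%:R *: (l ^+ 2 * m ^+ 2)
            + 2%:R *: (l * m ^+ 3) + m ^+ 4).

Definition EV : weierstrass := Weierstrass 2 (-6) (-2) (-3) 0.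

Definition sigmaU (P : 'I_3 -> algC) : 'I_3 -> algC :=
  vec3 (P i0 + P i1) (P i0 - P i1) (- 2 * P i2).

(* Main.v *)
Require Import Defs.
From HB Require Import structures.
From mathcomp Require Import all_boot all_order all_algebra all_field.
From mathcomp Require Import complex.
From mathcomp Require Import boolp classical_sets functions cardinality reals.
From mathcomp Require Import topology normedtype trigo.
(* The notations of mpoly clash with those of mathcomp-classical. *)
From mathcomp Require Import -(notations) mpoly.
From mathcomp Require Import ring lra zify.

Set Implicit Arguments.
Unset Strict Implicit.
Unset Printing Implicit Defensive.

Import Order.TTheory GRing.Theory Num.Theory.

Local Open Scope ring_scope.

(* Conjugation turns the condition "(v1, v2) is a rational angle with squared
   amplitude z8^k" into F = z8^k * conj F for F = v1 * conj v2. In the basis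
   1, z8, z8^2, z8^3 this is a pair of rational bilinear equations in the
   coordinates of v1 and v2, which are solved by hand; (8) and (9) record when
   the resulting quadratic equation has a rational root. A homothety between
   two of the spaces carries angles of squared amplitude z8 to such angles,
   whence (5). In (6), roots of unity of Q(z8) are powers of z8 because the
   Euler function of a multiple of 8 exceeding 8 is greater than 4. For (10),
   the product of the two quartics gives a rational point on y^2 = n (n^2 + 2),
   and the only affine one is (0, 0).

   The Mordell-Weil groups come from descent by 2-isogeny. Since the curves
   have a single rational point of order 2, they are quartics
   v^2 = 1 - 2 a u^2 + e u^4 with e not a square, on which one addition formula
   holds without exception; modulo the torsion and one explicit point of
   infinite order every point is a double, and the height of u decreases. *)

(** * The group of a Jacobi quartic *)

(** With [u = X / Y] the curve [Y^2 = X (X^2 + a X + b)] becomes the quartic, where [e = a^2 - 4 b].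
    The denominator [1 - e u1^2 u2^2] of its addition law cannot vanish when [e] is not a square, so
    associativity and compatibility with isogenies are identities of rational functions. The
    isogenous quartic has parameters [-2 a] and [4 (a^2 - e) = 16 b]. The pairs [(a, e)] are
    [(-2, -4)] for [EU], [(-8, 32)] for [EV] and [(0, -8)] for the rank 0 curve; [a^2 - e] is 8, 32
    and 8, a power of 2, so the descents only meet the classes of 1, -1, 2 and -2 modulo squares.

    The involution [iota] comes from the second angle of squared amplitude [zeta8]: the quotient of
    its two vectors is, up to a rational factor, the [tau] of [iota [l : m]].

    The genus is read off from the functions regular where [l] and [m] are nonzero: they are
    [A + (u / l^2) B] with [A], [B] Laurent polynomials in [m / l], and [u / (l m)] is the only
    monomial extending neither to [l != 0] nor to [m != 0]. *)

Definition nonsquare (F : fieldType) (x : F) : Prop := forall y : F, y ^+ 2 != x.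

Section JacobiQuartic.
Variables (F : fieldType) (a e : F).

Definition on_jac (p : F * F) : bool :=
  p.2 ^+ 2 == 1 - 2 * a * p.1 ^+ 2 + e * p.1 ^+ 4.

Definition jac_add (p q : F * F) : F * F :=
  let d := 1 - e * p.1 ^+ 2 * q.1 ^+ 2 in
  ((p.1 * q.2 + q.1 * p.2) / d,
   ((1 + e * p.1 ^+ 2 * q.1 ^+ 2) * (p.2 * q.2 - 2 * a * p.1 * q.1)
    + 2 * e * p.1 * q.1 * (p.1 ^+ 2 + q.1 ^+ 2)) / d ^+ 2).

Record jac (he : nonsquare e) := Jac { jval :> F * F; jvalP : on_jac jval }.

Variable he : nonsquare e.
Local Notation J := (jac he).

HB.instance Definition _ := [isSub for @jval he].
HB.instance Definition _ := [Choice of J by <:].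

Lemma jac_eq (P : J) :
  P.2 ^+ 2 = 1 - 2 * a * P.1 ^+ 2 + e * P.1 ^+ 4.
Proof. exact/eqP/jvalP. Qed.

Lemma jac_den x y : 1 - e * x ^+ 2 * y ^+ 2 != 0.
Proof.
apply/eqP => h.
have xy0 : x * y != 0.
  by apply: contra_eq_neq h => xy; rewrite -mulrA -exprMn xy expr0n mulr0 subr0 oner_neq0.
have /eqP[] := he (x * y)^-1.
apply: (mulfI (expf_neq0 2 xy0)); rewrite -exprMn divff // expr1n.
by rewrite exprMn; apply/eqP; rewrite -subr_eq0 -h; apply/eqP; ring.
Qed.

Lemma on_jac_add (P Q : J) : on_jac (jac_add P Q).
Proof.
have := jac_eq P; have := jac_eq Q; have := jac_den P.1 Q.1.
case: (jval P) (jval Q) => [u1 v1] [u2 v2]; rewrite /on_jac /= => d h1 h2.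
by apply/eqP; field: h1 h2.
Qed.

Lemma on_jac_opp (P : J) : on_jac (- P.1, P.2).
Proof. by rewrite /on_jac /=; apply/eqP; rewrite jac_eq; ring. Qed.

Lemma on_jac0 : on_jac (0, 1).
Proof. by rewrite /on_jac /=; apply/eqP; ring. Qed.

Definition jadd (P Q : J) : J := Jac he (on_jac_add P Q).
Definition jopp (P : J) : J := Jac he (on_jac_opp P).
Definition jzero : J := Jac he on_jac0.

Lemma jaddC : commutative jadd.
Proof.
move=> P Q; apply: val_inj => /=; rewrite /jac_add.
have /= d := jac_den P.1 Q.1.
have /= d' := jac_den Q.1 P.1.
congr (_, _); field; exact: d'.
Qed.

Lemma jaddA : associative jadd.
Proof.
move=> P Q R; apply: val_inj => /=; rewrite /jac_add.
have := jac_den (jadd P Q).1 R.1.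
have := jac_den P.1 (jadd Q R).1.
have := jac_den P.1 Q.1.
have := jac_den Q.1 R.1.
have := jac_eq P; have := jac_eq Q; have := jac_eq R.
rewrite /=; case: (jval P) (jval Q) (jval R) => [u1 v1] [u2 v2] [u3 v3] /=.
move=> h1 h2 h3 d23 d12 d1 d3.
(* The denominators of the two outer sums, multiplied by the square of the inner denominator: the
   form in which [field] meets them. *)
have d1' : (1 - e * u2 ^+ 2 * u3 ^+ 2) ^+ 2
           - e * u1 ^+ 2 * (u2 * v3 + u3 * v2) ^+ 2 != 0.
  apply: contraNneq d1 => d1; rewrite -(mulrI_eq0 _ (mulfI (expf_neq0 2 d23))).
  by rewrite -[X in _ == X]d1; apply/eqP; field.
have d3' : (1 - e * u1 ^+ 2 * u2 ^+ 2) ^+ 2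
           - e * (u1 * v2 + u2 * v1) ^+ 2 * u3 ^+ 2 != 0.
  apply: contraNneq d3 => d3; rewrite -(mulrI_eq0 _ (mulfI (expf_neq0 2 d12))).
  by rewrite -[X in _ == X]d3; apply/eqP; field.
by congr (_, _); field: h1 h2 h3; rewrite d12 d23 d1' d3'.
Qed.

Lemma jadd0 : left_id jzero jadd.
Proof.
move=> P; apply: val_inj => /=; rewrite /jac_add /=.
have := jac_eq P; case: (jval P) => [u v] /= h.
by congr (_, _); field; rewrite ?oner_neq0.
Qed.

Lemma jaddN : left_inverse jzero jopp jadd.
Proof.
move=> P; apply: val_inj => /=; rewrite /jac_add /=.
have := jac_eq P; have := jac_den (- P.1) P.1.
by case: (jval P) => [u v] /= d h; congr (_, _); field: h.
Qed.

HB.instance Definition _ := GRing.isZmodule.Build J jaddA jaddC jadd0 jaddN.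

Lemma jvalD (P Q : J) : jval (P + Q) = jac_add P Q. Proof. by []. Qed.

Lemma jval2 (P : J) :
  (jval (P *+ 2)).1 = 2 * P.1 * P.2 / (1 - e * P.1 ^+ 4).
Proof.
rewrite mulr2n jvalD /jac_add /=; have := jac_den P.1 P.1.
case: (jval P) => [u v] /= d; have d' : 1 - e * u ^+ 4 != 0.
  by apply: contraNneq d => <-; apply/eqP; ring.
by field; rewrite d'.
Qed.

Lemma on_jacT : on_jac (0, -1).
Proof. by rewrite /on_jac /=; apply/eqP; ring. Qed.

Definition jtor : J := Jac he on_jacT.

Lemma jvalDT (P : J) : jval (P + jtor) = (- P.1, - P.2).
Proof.
rewrite jvalD /jac_add /=; case: (jval P) => [u v] /=.
by congr (_, _); field; rewrite ?oner_neq0.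
Qed.

Lemma jtor2 : jtor *+ 2 = 0.
Proof.
by apply: val_inj; rewrite mulr2n [LHS]jvalDT /= opprK oppr0.
Qed.

(* The function [X] of the Weierstrass model [Y^2 = X (X^2 + a X + b)], up to
   squares; its class modulo squares is the connecting map of the descent. *)
Definition jclass (P : J) : F := 2 * (1 - a * P.1 ^+ 2 + P.2).

(* With [u = sn], [v = cn dn] one has [jclass = (cn + dn)^2]; the square root
   below is the addition formula for [cn + dn]. *)
Lemma jclassD (P Q : J) :
  exists L, jclass (P + Q) * jclass P * jclass Q = L ^+ 2.
Proof.
rewrite /jclass jvalD /=; have := jac_eq P; have := jac_eq Q.
have := jac_den P.1 Q.1.
case: (jval P) (jval Q) => [u1 v1] [u2 v2] /= d h2 h1.
exists ((2 - 2 * a * (u1 ^+ 2 + u2 ^+ 2) + (4 * a ^+ 2 - 2 * e) * u1 ^+ 2 * u2 ^+ 2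
   + 2 * v1 * v2 + v2 * (2 - 2 * a * u1 ^+ 2) + v1 * (2 - 2 * a * u2 ^+ 2)
   - u1 * u2 * (2 * a - 2 * e * (u1 ^+ 2 + u2 ^+ 2) + 2 * a * e * u1 ^+ 2 * u2 ^+ 2
        + 2 * a * v1 * v2 + v2 * (2 * a - 2 * e * u1 ^+ 2)
        + v1 * (2 * a - 2 * e * u2 ^+ 2))) / (1 - e * u1 ^+ 2 * u2 ^+ 2)).
by field: h1 h2.
Qed.

End JacobiQuartic.

(** * The 2-isogenies between two Jacobi quartics *)

Section Isogeny.
Variables (F : numFieldType) (a e : F).
Variables (he : nonsquare e) (he' : nonsquare (4 * (a ^+ 2 - e))).
Local Notation J := (@jac F a e he).
Local Notation J' := (@jac F (- 2 * a) (4 * (a ^+ 2 - e)) he').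

(** A zero of [v] would make [u^-2] a root of [s^2 - 2 a s + e], whose discriminant is
    [4 (a^2 - e)]. Hence the denominators of [jiso] never vanish. *)
Lemma jac_v_neq0 (P : J) : P.2 != 0.
Proof.
apply/eqP => v0; have := jac_eq P; rewrite v0 expr0n /= => h.
have u0 : P.1 != 0.
  apply/eqP => u0; move: h; rewrite u0 !expr0n /= !mulr0 subr0 addr0.
  by move/esym/eqP; rewrite oner_eq0.
have /eqP[] := he' (2 * (P.1 ^- 2 - a)).
move: h u0; case: (jval P) => u v /= h u0; apply/eqP; rewrite -subr_eq0; apply/eqP.
transitivity (4 / u ^+ 4 * (1 - 2 * a * u ^+ 2 + e * u ^+ 4)); first by field.
by rewrite -h mulr0.
Qed.

Lemma jac_v_neq0' (P : J') : P.2 != 0.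
Proof.
apply/eqP => v0; have := jac_eq P; rewrite v0 expr0n /= => h.
have u0 : P.1 != 0.
  apply/eqP => u0; move: h; rewrite u0 !expr0n /= !mulr0 subr0 addr0.
  by move/esym/eqP; rewrite oner_eq0.
have /eqP[] := he ((P.1 ^- 2 + 2 * a) / 4 * 2).
move: h u0; case: (jval P) => u v /= h u0; apply/eqP; rewrite -subr_eq0; apply/eqP.
transitivity (4^-1 / u ^+ 4 * (1 - 2 * (- 2 * a) * u ^+ 2 + 4 * (a ^+ 2 - e) * u ^+ 4)).
  by field.
by rewrite -h mulr0.
Qed.

Lemma on_jiso (P : J) :
  on_jac (- 2 * a) (4 * (a ^+ 2 - e)) (P.1 / P.2, (1 - e * P.1 ^+ 4) / P.2 ^+ 2).
Proof.
have := jac_v_neq0 P; have := jac_eq P; case: (jval P) => u v /= h v0.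
by apply/eqP => /=; field: h.
Qed.
(** The 2-isogeny with kernel [0] and [jtor], the only points with [u = 0]. *)
Definition jiso (P : J) : J' := Jac he' (on_jiso P).


Lemma on_jdual (P : J') :
  on_jac a e (2 * P.1 / P.2, (1 - 4 * (a ^+ 2 - e) * P.1 ^+ 4) / P.2 ^+ 2).
Proof.
have := jac_v_neq0' P; have := jac_eq P; case: (jval P) => u v /= h v0.
by apply/eqP => /=; field: h.
Qed.
(** The same isogeny followed by [(u, v) |-> (2 u, v)]: changing the parameters twice gives
    [(4 a, 16 e)], and this scaling leads back to [(a, e)]. *)
Definition jdual (P : J') : J := Jac he (on_jdual P).

Lemma jdualD : {morph jdual : P Q / P + Q}.
Proof.
move=> P Q; apply: val_inj => /=; rewrite /jac_add /=.
have := jac_v_neq0' (P + Q); have := jac_v_neq0' P; have := jac_v_neq0' Q.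
have := jac_den he (jdual P).1 (jdual Q).1; rewrite jvalD /jac_add /=.
have := jac_den he' P.1 Q.1.
have := jac_eq P; have := jac_eq Q.
case: (jval P) (jval Q) => [u1 v1] [u2 v2] /= h2 h1 d d' v20 v10 v0.
have d'' : (v1 * v2) ^+ 2 - e * (4 * u1 ^+ 2) * (4 * u2 ^+ 2) != 0.
  apply: contraNneq d' => d''; apply/eqP; transitivity
    (((v1 * v2) ^+ 2 - e * (4 * u1 ^+ 2) * (4 * u2 ^+ 2)) / (v1 * v2) ^+ 2).
    by field; rewrite v10 v20.
  by rewrite d'' mul0r.
move: v0; rewrite mulf_eq0 negb_or => /andP[v0 _].
by congr (_, _); field: h1 h2; rewrite ?v10 ?v20 ?d'' ?d ?v0.
Qed.

Lemma jdual_jiso P : jdual (jiso P) = P *+ 2.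
Proof.
apply: val_inj; rewrite mulr2n [RHS]jvalD /= /jac_add.
have := jac_v_neq0 P; have := jac_eq P; have := jac_den he P.1 P.1.
case: (jval P) => u v /= d h v0.
have d' : 1 - e * u ^+ 4 != 0 by apply: contraNneq d => <-; apply/eqP; ring.
by congr (_, _); field: h; rewrite v0 d andbT.
Qed.

Lemma jdual_tor : jdual (jtor _ he') = 0.
Proof.
by apply: val_inj => /=; congr (_, _); field; rewrite ?oner_neq0.
Qed.

(** At a zero [v = a u^2 - 1], and the equation of the curve leaves [(a^2 - e) u^4 = 0]. *)
Lemma jclass_eq0 P : (jclass P == 0 :> F) = (P == jtor a he).
Proof.
apply/eqP/eqP => [|->]; last by rewrite /jclass /=; ring.
rewrite /jclass => /eqP; rewrite mulf_eq0 pnatr_eq0 /= => /eqP c0.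
have := jac_eq P => h; apply: val_inj => /=; move: c0 h.
case: (jval P) => u v /= c0 h.
have u0 : u = 0.
  apply/eqP; rewrite -[u == 0](expf_eq0 _ 4); apply/eqP.
  have /mulfI : 4 * (a ^+ 2 - e) != 0.
    by apply/eqP => z; have := he' 0; rewrite expr0n /= z eqxx.
  apply; have hv : v = (1 - a * u ^+ 2 + v) - 1 + a * u ^+ 2 by ring.
  rewrite c0 sub0r in hv; move: h; rewrite hv => h.
  have {}h : e * u ^+ 4 = (- 1 + a * u ^+ 2) ^+ 2 - 1 + 2 * a * u ^+ 2 by rewrite h; ring.
  by ring: h.
by move: c0; rewrite u0 expr0n /= mulr0 subr0 => /eqP; rewrite addrC addr_eq0 => /eqP ->.
Qed.

(** Exactness of the descent sequence. The class of [jdual Q] is the square of [2 / v], with [v] the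
    second coordinate of [Q]; equating [k] with [2 / v] suggests [Q = (u / k, 2 / k)]. *)
Lemma jdual_surj P k : k != 0 -> jclass P = k ^+ 2 -> exists Q, jdual Q = P.
Proof.
move=> k0 /esym; rewrite /jclass => hk; have h := jac_eq P.
have hQ : on_jac (- 2 * a) (4 * (a ^+ 2 - e)) (P.1 / k, 2 / k).
  by move: hk h; case: (jval P) => u v /= hk h; apply/eqP => /=; field: hk h.
exists (Jac he' hQ); apply: val_inj => /=; move: hk h.
case: (jval P) => u v /= hk h; congr (_, _); first by field; rewrite ?k0 ?pnatr_eq0.
by field: hk h; rewrite ?k0 ?pnatr_eq0.
Qed.

Lemma jiso_surj (Q : J') k : k != 0 -> jclass Q = k ^+ 2 -> exists P, jiso P = Q.
Proof.
move=> k0 /esym; rewrite /jclass => hk; have h := jac_eq Q.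
have hP : on_jac a e (2 * Q.1 / k, 2 / k).
  by move: hk h; case: (jval Q) => u v /= hk h; apply/eqP => /=; field: hk h.
exists (Jac he hP); apply: val_inj => /=; move: hk h.
case: (jval Q) => u v /= hk h; congr (_, _); first by field; rewrite ?k0 ?pnatr_eq0.
by field: hk h; rewrite ?k0 ?pnatr_eq0.
Qed.

End Isogeny.

(** * Comparison with the chord-tangent law *)

Section Collinear.
Variables (F : numFieldType) (a b e : F).
Hypotheses (eE : e = a ^+ 2 - 4 * b) (he : nonsquare e) (b0 : b != 0).

Definition short_on (p : F * F) : Prop :=
  p.2 ^+ 2 = p.1 * (p.1 ^+ 2 + a * p.1 + b).

(** At [(0, 0)], where [X / Y] makes no sense, the value is the 2-torsion point of the quartic. *)
Definition short_jac (p : F * F) : F * F :=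
  if p.1 == 0 then (0, -1)
  else (p.1 / p.2, (p.1 ^+ 2 - b) * p.1 / p.2 ^+ 2).

Lemma short_y_eq0 p : short_on p -> p.2 = 0 -> p.1 = 0.
Proof.
case: p => X Y /= h Y0; apply/eqP; apply/negPn/negP => X0; move: h.
rewrite /short_on /= Y0 expr0n /= => /esym/eqP; rewrite mulf_eq0 (negPf X0) /= => /eqP h.
have /eqP[] := he (2 * X + a).
by rewrite eE; apply/eqP; rewrite -subr_eq0 -(mulr0 4) -h; apply/eqP; ring.
Qed.

Lemma short_jac_on p : short_on p -> on_jac a e (short_jac p).
Proof.
move=> h; have := short_y_eq0 h; move: h; case: p => X Y; rewrite /short_on /= => h Y0.
rewrite /short_jac /=; case: eqP => [X0|/eqP X0].
  by apply/eqP => /=; ring.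
have {}Y0 : Y != 0 by apply/eqP => /Y0 /eqP; apply/negP.
by apply/eqP => /=; rewrite eE; field: h.
Qed.

(** The three hypotheses are Vieta's formulas for the line [Y = s X + n] and the cubic, so chords
    and tangents are treated together. The cases only separate out the point [(0, 0)]; if it
    occurred twice on the line, [b] would vanish. *)
Lemma short_jac_collinear X1 X2 X3 s n :
    a = s ^+ 2 - X1 - X2 - X3 -> b = X1 * X2 + X1 * X3 + X2 * X3 + 2 * s * n ->
    n ^+ 2 = X1 * X2 * X3 ->
  jac_add a e (short_jac (X1, s * X1 + n)) (short_jac (X2, s * X2 + n))
  = short_jac (X3, - (s * X3 + n)).
Proof.
move=> ha hb hn.
have n0 : [|| X1 == 0, X2 == 0 | X3 == 0] -> n = 0.
  by rewrite -!mulf_eq0 mulrA -hn expf_eq0 /= => /eqP.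
have on1 : short_on (X1, s * X1 + n) by rewrite /short_on /= ha hb; ring: hn.
have on2 : short_on (X2, s * X2 + n) by rewrite /short_on /= ha hb; ring: hn.
have on3 : short_on (X3, - (s * X3 + n)) by rewrite /short_on /= ha hb; ring: hn.
have D := jac_den he (Jac he (short_jac_on on1)).1 (Jac he (short_jac_on on2)).1.
move: D; rewrite /= /jac_add.
have := short_y_eq0 on1; have := short_y_eq0 on2; have := short_y_eq0 on3.
rewrite /short_jac /=.
case: (altP (X1 =P 0)) => [X10|X10]; case: (altP (X2 =P 0)) => [X20|X20];
  case: (altP (X3 =P 0)) => [X30|X30] Y3 Y2 Y1 /=.
- by case/eqP: b0; rewrite hb n0 ?X10 ?X20 ?eqxx //; ring.
- by case/eqP: b0; rewrite hb n0 ?X10 ?X20 ?eqxx //; ring.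
- by case/eqP: b0; rewrite hb n0 ?X10 ?X30 ?eqxx //; ring.
- have {}n0 : n = 0 by apply: n0; rewrite X10 eqxx.
  have {}Y2 : s * X2 + n != 0 by apply/eqP => /Y2 /eqP; apply/negP.
  have {}Y3 : s * X3 + n != 0 by rewrite -oppr_eq0; apply/eqP => /Y3 /eqP; apply/negP.
  move: Y2 Y3; rewrite n0 !addr0 !mulf_eq0 !negb_or => /andP[s0 _] _ _.
  have -> : b = X2 * X3 by rewrite hb X10 n0; ring.
  by congr (_, _); field; rewrite ?s0 ?X20 ?X30 ?oner_neq0.
- by case/eqP: b0; rewrite hb n0 ?X20 ?X30 ?eqxx ?orbT //; ring.
- have {}n0 : n = 0 by apply: n0; rewrite X20 eqxx orbT.
  have {}Y1 : s * X1 + n != 0 by apply/eqP => /Y1 /eqP; apply/negP.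
  move: Y1; rewrite n0 !addr0 !mulf_eq0 !negb_or => /andP[s0 _] _.
  have -> : b = X1 * X3 by rewrite hb X20 n0; ring.
  by congr (_, _); field; rewrite ?s0 ?X10 ?X30 ?oner_neq0.
- have {}n0 : n = 0 by apply: n0; rewrite X30 eqxx !orbT.
  have {}Y1 : s * X1 + n != 0 by apply/eqP => /Y1 /eqP; apply/negP.
  move: Y1; rewrite eE ha hb X30 n0 !addr0 !mulf_eq0 !negb_or => /andP[s0 _] D.
  have {}D : (s * s) ^+ 2 - ((s ^+ 2 - X1 - X2) ^+ 2 - 4 * (X1 * X2)) != 0.
    apply: contraNneq D => D; apply/eqP; transitivity
      (((s * s) ^+ 2 - ((s ^+ 2 - X1 - X2) ^+ 2 - 4 * (X1 * X2))) / s ^+ 4).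
      by field; rewrite s0 X10 X20.
    by rewrite D mul0r.
  by congr (_, _); field; rewrite ?s0 ?X10 ?X20 ?D.
have {}Y1 : s * X1 + n != 0 by apply/eqP => /Y1 /eqP; apply/negP.
have {}Y2 : s * X2 + n != 0 by apply/eqP => /Y2 /eqP; apply/negP.
have {}Y3 : s * X3 + n != 0 by rewrite -oppr_eq0; apply/eqP => /Y3 /eqP; apply/negP.
rewrite eE => D.
have {}D : ((s * X1 + n) * (s * X2 + n)) ^+ 2
           - (a ^+ 2 - 4 * b) * X1 ^+ 2 * X2 ^+ 2 != 0.
  apply: contraNneq D => D; apply/eqP; transitivity
    ((((s * X1 + n) * (s * X2 + n)) ^+ 2 - (a ^+ 2 - 4 * b) * X1 ^+ 2 * X2 ^+ 2)
      / ((s * X1 + n) * (s * X2 + n)) ^+ 2).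
    by field; rewrite Y1 Y2.
  by rewrite D mul0r.
rewrite ha hb; move: D; rewrite ha hb => D.
by congr (_, _); field: hn; rewrite Y1 Y2 Y3 D.
Qed.

(** Inverse of [short_jac] where [u] is nonzero; its first component is [jclass / (4 u^2)]. *)
Definition jac_short (p : F * F) : F * F :=
  let X := (1 - a * p.1 ^+ 2 + p.2) / (2 * p.1 ^+ 2) in (X, X / p.1).

(** The product of [1 - a u^2 + v] and [1 - a u^2 - v] is [(a^2 - e) u^4 = 4 b u^4] on the curve. *)
Lemma jac_short_neq0 p : on_jac a e p -> p.1 != 0 -> (jac_short p).1 != 0.
Proof.
move=> /eqP; case: p => u v /= h u0.
rewrite mulf_neq0 ?invr_eq0 ?mulf_neq0 ?pnatr_eq0 ?expf_neq0 //.
apply: contraNneq b0 => z; rewrite -(mulrI_eq0 _ (mulfI (expf_neq0 4 u0))).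
apply/eqP; transitivity (((1 - a * u ^+ 2 + v) * (1 - a * u ^+ 2 - v)) / 4).
  by rewrite eE in h; field: h.
by rewrite z !mul0r.
Qed.

Lemma jac_shortK p : on_jac a e p -> p.1 != 0 -> short_jac (jac_short p) = p.
Proof.
move=> h u0; have := jac_short_neq0 h u0; move: (h) u0 => /eqP.
case: p h => u v _ /=; rewrite /short_jac /jac_short /= eE => h u0 X0.
rewrite (negPf X0); move: X0; rewrite mulf_eq0 negb_or => /andP[X0 _].
by congr (_, _); field: h; rewrite ?u0 ?X0.
Qed.

Lemma jac_short_on p : on_jac a e p -> p.1 != 0 -> short_on (jac_short p).
Proof.
case: p => u v /= /eqP /=; rewrite eE /short_on /jac_short /= => h u0.
by field: h.
Qed.

Lemma short_jacK p : short_on p -> p.1 != 0 -> jac_short (short_jac p) = p.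
Proof.
move=> h X0; have Y0 : p.2 != 0.
  by apply: contra_neq X0 => /(short_y_eq0 h).
move: h X0 Y0; case: p => X Y /=; rewrite /short_on /short_jac /jac_short /= => h X0 Y0.
by rewrite (negPf X0) /=; congr (_, _); field: h; rewrite ?X0 ?Y0.
Qed.

End Collinear.

Lemma ratr_rat (x : rat) : ratr x = x.
Proof. exact: divq_num_den. Qed.

(** * Transport of the group law to shifted Weierstrass equations *)

Section Weierstrass.
Variables (a b c e : rat).
Hypotheses (eE : e = a ^+ 2 - 4 * b) (he : nonsquare e) (b0 : b != 0).

(* [Y^2 = X (X^2 + a X + b)] in the coordinates [x = X - 1] and
   [y = Y - c (X - 2)]. *)
Definition shifted_weierstrass : weierstrass :=
  Weierstrass (2 * c) (3 + a - c ^+ 2) (- 2 * c) (3 + 2 * a + b + 2 * c ^+ 2)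
    (1 + a + b - c ^+ 2).
Local Notation E := shifted_weierstrass.

Definition weier_jac (P : option (rat * rat)) : rat * rat :=
  if P is Some (x, y) then short_jac b (x + 1, y + c * (x - 1)) else (0, 1).

Definition jac_weier (p : rat * rat) : option (rat * rat) :=
  if p.1 == 0 then if p.2 == 1 then None else Some (-1, 2 * c)
  else let q := jac_short a p in Some (q.1 - 1, q.2 - c * (q.1 - 2)).

Lemma on_shiftedE x y :
  on_weierstrass E (Some (x, y)) <-> short_on a b (x + 1, y + c * (x - 1)).
Proof.
rewrite /on_weierstrass /= !ratr_rat /short_on /=.
by split=> h; apply/eqP; rewrite -subr_eq0; [rewrite -(subrr (y ^+ 2 + 2 * c * x * y + -2 * c * y)) {2}h|
 rewrite -(subrr ((y + c * (x - 1)) ^+ 2)) {2}h]; apply/eqP; ring.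
Qed.

Lemma weier_jac_on P : on_weierstrass E P -> on_jac a e (weier_jac P).
Proof.
case: P => [[x y]|_]; last by rewrite /on_jac /=; apply/eqP; ring.
by move=> /on_shiftedE /(short_jac_on eE he).
Qed.

Lemma jac_weier_on p : on_jac a e p -> on_weierstrass E (jac_weier p).
Proof.
move=> h; rewrite /jac_weier; case: eqP => [_|/eqP u0].
  by case: eqP => // _; apply/on_shiftedE; rewrite /short_on /=; ring.
apply/on_shiftedE; have := jac_short_on eE h u0.
by case: (jac_short a p) => X Y /=; rewrite /short_on /= subrK => <-; ring.
Qed.

Lemma jac_weierK p : on_jac a e p -> weier_jac (jac_weier p) = p.
Proof.
move=> h; rewrite /jac_weier; case: eqP => [u0|/eqP u0].
  move: h => /eqP; case: p u0 => u v /= ->.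
  rewrite !expr0n /= !mulr0 subr0 addr0 => /eqP; rewrite sqrf_eq1.
  case: eqP => [-> //|_ /= /eqP ->].
  by rewrite /short_jac.
rewrite -[RHS](jac_shortK eE b0 h u0); case: (jac_short a p) => X Y /=.
by rewrite subrK; congr (short_jac b (_, _)); ring.
Qed.

Lemma weier_jacK P : on_weierstrass E P -> jac_weier (weier_jac P) = P.
Proof.
case: P => [[x y]|_]; last by [].
move=> /on_shiftedE h; rewrite /weier_jac /jac_weier.
have [X0|X0] := eqVneq (x + 1) 0.
  rewrite /short_jac /= X0 eqxx /=.
  move: h; rewrite /short_on /= X0 mul0r => /eqP; rewrite expf_eq0 /= => /eqP h.
  have -> : x = -1 by apply/eqP; rewrite -addr_eq0 X0.
  suff -> : y = 2 * c by [].
  have -> : y = (y + c * (x - 1)) - c * (x + 1) + 2 * c by ring.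
  by rewrite h X0; ring.
have Y0 : y + c * (x - 1) != 0 by apply: contra_neq X0 => /(short_y_eq0 eE he h).
rewrite (short_jacK eE he h X0) /short_jac /= (negPf X0) /=.
by rewrite mulf_eq0 invr_eq0 (negPf X0) (negPf Y0) /=; congr (Some (_, _)); ring.
Qed.

Lemma ec_add_weier_jac P Q : on_weierstrass E P -> on_weierstrass E Q ->
  on_weierstrass E (ec_add E P Q) /\
  weier_jac (ec_add E P Q) = jac_add a e (weier_jac P) (weier_jac Q).
Proof.
case: P => [[x1 y1]|] hP; last first.
  rewrite /= => hQ; split=> //; rewrite /jac_add /=.
  by case: (weier_jac Q) => u v /=; congr (_, _); field; rewrite ?oner_neq0.
case: Q => [[x2 y2]|] hQ; last first.
  split=> //=; rewrite /jac_add /=.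
  by case: (short_jac b _) => u v /=; congr (_, _); field; rewrite ?oner_neq0.
move: hP hQ => /on_shiftedE hP /on_shiftedE hQ.
pose Y1 := y1 + c * (x1 - 1); pose Y2 := y2 + c * (x2 - 1).
(* Here [s] is the slope in the Weierstrass coordinates and [S] the slope in the coordinates
   [X = x + 1], [Y = y + c (x - 1)]. The remaining hypotheses are Vieta's formulas, to be checked
   separately for chords and tangents. *)
have key s S n X3 : S = s + c -> Y1 = S * (x1 + 1) + n -> Y2 = S * (x2 + 1) + n ->
    X3 = S ^+ 2 - a - (x1 + 1) - (x2 + 1) ->
    b = (x1 + 1) * (x2 + 1) + (x1 + 1) * X3 + (x2 + 1) * X3 + 2 * S * n ->
    n ^+ 2 = (x1 + 1) * (x2 + 1) * X3 ->
    let x3 := s ^+ 2 + 2 * c * s - (3 + a - c ^+ 2) - x1 - x2 in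
    let P := Some (x3, - (y1 + s * (x3 - x1)) - 2 * c * x3 - -2 * c) in
    on_weierstrass E P /\
    weier_jac P = jac_add a e (short_jac b (x1 + 1, Y1)) (short_jac b (x2 + 1, Y2)).
  move=> hS h1 h2 h3 hb hn x3 P.
  have hx3 : x3 = X3 - 1 by rewrite h3 hS /x3; ring.
  have hy3 : - (y1 + s * (x3 - x1)) - 2 * c * x3 - -2 * c
             = - (S * X3 + n) - c * (x3 - 1).
    have -> : y1 = Y1 - c * (x1 - 1) by rewrite /Y1; ring.
    by rewrite h1 hx3 hS; ring.
  have ha : a = S ^+ 2 - (x1 + 1) - (x2 + 1) - X3 by rewrite h3; ring.
  rewrite /P hy3; clearbody x3; rewrite hx3; split.
    by apply/on_shiftedE; rewrite /short_on /= ha hb; ring: hn.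
  rewrite h1 h2 (short_jac_collinear eE he b0 ha hb hn) [LHS]/= subrK.
  by congr (short_jac b (_, _)); ring.
rewrite [weier_jac (Some _)]/weier_jac [weier_jac (Some (x2, _))]/weier_jac.
rewrite [on_weierstrass]lock [weier_jac]lock /= !ratr_rat -!lock -/Y1 -/Y2.
move: hP hQ; rewrite /short_on /= -/Y1 -/Y2 => hP hQ.
case: eqVneq => [x12|x12]; last first.
  have x12' : x2 - x1 != 0 by rewrite subr_eq0 eq_sym.
  have hy1 : y1 = Y1 - c * (x1 - 1) by rewrite /Y1; ring.
  have hy2 : y2 = Y2 - c * (x2 - 1) by rewrite /Y2; ring.
  apply: (@key _ ((Y2 - Y1) / (x2 - x1)) (Y1 - (Y2 - Y1) / (x2 - x1) * (x1 + 1)) _ _ _ _ erefl).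
  - by rewrite hy1 hy2; field.
  - by ring.
  - by field.
  - by clearbody Y1 Y2; field: hP hQ.
  - by clearbody Y1 Y2; field: hP hQ.
have hY : Y1 = - Y2 \/ Y1 = Y2 /\ Y1 + Y2 != 0.
  have [h|h] := eqVneq (Y1 + Y2) 0; first by left; apply/eqP; rewrite -addr_eq0 h.
  right; split=> //; apply/eqP; rewrite -subr_eq0 -(mulrI_eq0 _ (mulfI h)).
  by apply/eqP; rewrite -(subrr (Y1 ^+ 2)) {2}hP x12 -hQ; ring.
have -> : y1 + y2 + 2 * c * x2 + -2 * c = Y1 + Y2 by rewrite /Y1 /Y2 x12; ring.
case: hY => [hY|[hY Y0]].
  rewrite {1 2}hY addNr eqxx; split=> //; rewrite x12 hY /short_jac /=.
  have on2 : short_on a b (x2 + 1, Y2) by [].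
  case: eqP => [_|/eqP X0]; first by rewrite /jac_add /=; congr (_, _); field; rewrite ?oner_neq0.
  have Y20 : Y2 != 0 by apply: contra_neq X0 => /(short_y_eq0 eE he on2).
  have := congr1 val (addNr (Jac he (short_jac_on eE he on2))).
  rewrite /= /short_jac /= (negPf X0) /= => <-.
  by congr jac_add; congr (_, _); field.
rewrite (negPf Y0).
have hy1 : y1 = Y1 - c * (x1 - 1) by rewrite /Y1; ring.
have Y10 : Y1 != 0 by apply: contraNneq Y0 => h; rewrite -hY h addr0.
have hy0 : 2 * y1 + 2 * c * x1 + -2 * c != 0.
  by apply: contraNneq Y0 => h; rewrite -hY -h hy1; apply/eqP; ring.
have [S hS] : exists S, S = (3 * (x1 + 1) ^+ 2 + 2 * a * (x1 + 1) + b) / (2 * Y1).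
  by eexists.
apply: (@key _ S (Y1 - S * (x1 + 1)) _ _ _ _ erefl).
- by rewrite hS; move: hy0; rewrite hy1; clearbody Y1 => hy0; field; rewrite hy0 Y10.
- by ring.
- by rewrite -x12 -hY; ring.
- by rewrite -x12 hS; clearbody Y1; field: hP.
- by rewrite -x12 hS; clearbody Y1; field: hP.
Qed.

End Weierstrass.

(** * Descent and heights *)

Section NatSquares.
Local Open Scope nat_scope.

(** Write [g] for the gcd, [m = m' g] and [k = k' g], so that [m' n = g k'^2]. Then [m'] divides [g]
    because it is coprime to [k'], and [g] divides [m'] because it is coprime to [n]. *)
Lemma coprime_mul_sqr m n k : (0 < m)%N -> coprime m n -> (m * n = k ^ 2)%N ->
  (m = gcdn m k ^ 2)%N.
Proof.
move=> m0 cmn mnk; have g0 : (0 < gcdn m k)%N by rewrite gcdn_gt0 m0.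
have [gm gk] := (dvdn_gcdl m k, dvdn_gcdr m k).
set g := gcdn m k in g0 gm gk *.
have cop : coprime (m %/ g)%N (k %/ g)%N.
  by rewrite /coprime -(eqn_pmul2r g0) muln_gcdl !divnK ?mul1n.
move: (m %/ g)%N (k %/ g)%N cop (divnK gm) (divnK gk) => m' k' cop em ek.
have eq1 : (m' * n = g * k' ^ 2)%N.
  apply/eqP; rewrite -(eqn_pmul2r g0); apply/eqP.
  by rewrite mulnAC em mnk -ek -!mulnn; lia.
have m'g : (m' %| g)%N.
  by rewrite -(@Gauss_dvdl m' g (k' ^ 2)) ?coprimeXr // -eq1 dvdn_mulr.
have gm' : (g %| m')%N.
  rewrite -(@Gauss_dvdl g m' n) ?eq1 ?dvdn_mulr //.
  exact: coprime_dvdl gm cmn.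
have e : m' = g by apply/eqP; rewrite eqn_dvd m'g gm'.
by rewrite -[LHS]em e mulnn.
Qed.

(** The odd parts of [m] and [n] are coprime and their product is a square, so the odd part of [m]
    is a square; [j] is the parity of the exponent of 2 in [m]. *)
Lemma mul_pow2_sqr m n i k : (0 < m)%N -> (0 < n)%N ->
    (forall p, prime p -> odd p -> (p %| m)%N -> (p %| n)%N -> False) ->
    (m * n = 2 ^ i * k ^ 2)%N ->
  exists j l, (m = 2 ^ (j : bool) * l ^ 2)%N.
Proof.
move=> m0 n0 cop mnk; have k0 : (0 < k)%N.
  have : (0 < m * n)%N by rewrite muln_gt0 m0.
  by rewrite mnk; case: k mnk => //; rewrite muln0.
rewrite -(partnC 2 m0) p_part; set l := logn 2 m.
have e : m`_2^' * n`_2^' = k`_2^' ^ 2.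
  rewrite -partnM // mnk partnM ?expn_gt0 ?k0 // [X in (_ * X)%N]partnX.
  by rewrite part_p'nat ?mul1n // pnatNK pnatX pnat_id.
have c : coprime m`_2^' n`_2^'.
  rewrite /coprime eqn_leq gcdn_gt0 part_gt0 andbT leqNgt; apply/negP => /pdivP[p pp pg].
  have pm := dvdn_trans pg (dvdn_gcdl _ _); have pn := dvdn_trans pg (dvdn_gcdr _ _).
  apply: (cop p) => //; [|exact: dvdn_trans pm (dvdn_part _ _)|exact: dvdn_trans pn (dvdn_part _ _)].
  case: (even_prime pp) => // p2; have := part_pnat 2^' m.
  by move/pnatP => /(_ (part_gt0 _ _) p pp pm); rewrite p2.
rewrite (coprime_mul_sqr (part_gt0 _ _) c e).
exists (odd l), (2 ^ l./2 * gcdn m`_2^' k`_2^')%N.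
by rewrite expnMn -expnM muln2 mulnA -expnD odd_double_half.
Qed.

End NatSquares.

Definition height (x : rat) : nat := maxn `|numq x| `|denq x|.

Lemma height_coprime (r s : int) : s != 0 -> coprimez r s ->
  height (r%:~R / s%:~R) = maxn `|r| `|s|.
Proof.
move=> s0 rs; rewrite /height coprimeq_num // coprimeq_den // (negPf s0).
by rewrite abszM absz_sg s0 mul1n.
Qed.

Lemma height_le (n d : int) : d != 0 -> (height (n%:~R / d%:~R) <= maxn `|n| `|d|)%N.
Proof.
move=> d0; case: divqP => [|k x k0]; first by move: d0 => /[swap] ->.
have k1 : (0 < `|k|)%N by rewrite absz_gt0.
by rewrite /height !abszM geq_max !leq_max !leq_pmull ?orbT.
Qed.

Lemma rat_sqrt_int (x : rat) (k : int) : x ^+ 2 = k%:~R -> exists n : int, x = n%:~R.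
Proof.
move=> h; apply/ratArchimedean.intrP.
have d0 := denq_neq0 x; have e : (numq x) ^+ 2 = k * (denq x) ^+ 2.
  by apply: (@intr_inj rat); rewrite rmorphXn rmorphM rmorphXn /= -h numqE exprMn.
have : coprimez (denq x) (numq x ^+ 2).
  by rewrite coprimezXr // coprimezE coprime_sym coprime_num_den.
rewrite e coprimezMr => /andP[_]; rewrite coprimezE abszX coprime_pexpr //.
by rewrite /coprime gcdnn -absz_denq.
Qed.

Section IntegralJacobi.
Variables (A E : int) (he : nonsquare (E%:~R : rat)).
Local Notation J := (@jac rat A%:~R E%:~R he).

(** For [u = r / s] in lowest terms, [v s^2] is a rational number with an integral square, hence an
    integer. *)
Lemma jac_int (P : J) : exists r s w : int,
  [/\ 0 < s, coprimez r s, P.1 = r%:~R / s%:~R, P.2 = w%:~R / s%:~R ^+ 2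
    & w ^+ 2 = s ^+ 4 - 2 * A * r ^+ 2 * s ^+ 2 + E * r ^+ 4].
Proof.
have h := jac_eq P; have d0 : (denq P.1)%:~R != 0 :> rat by rewrite intr_eq0 denq_neq0.
have hw : (P.2 * (denq P.1)%:~R ^+ 2) ^+ 2 = (denq P.1 ^+ 4
    - 2 * A * numq P.1 ^+ 2 * denq P.1 ^+ 2 + E * numq P.1 ^+ 4)%:~R :> rat.
  rewrite exprMn h; move: d0 (divq_num_den P.1).
  by move: (numq P.1) (denq P.1) => n d d0 <-; field.
have [w ew] := rat_sqrt_int hw.
exists (numq P.1), (denq P.1), w; split.
- exact: denq_gt0.
- by rewrite coprimezE coprime_num_den.
- by rewrite divq_num_den.
- by rewrite -ew mulfK // expf_neq0.
- by apply: (@intr_inj rat); rewrite rmorphXn /= -ew hw.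
Qed.

(** Let [M = s^2 - A r^2 + w] and [N = s^2 - A r^2 - w]. Then [jclass P = 2 M / s^2] and
    [M N = (A^2 - E) r^4]. An odd prime dividing both divides [r], then [M + N = 2 (s^2 - A r^2)]
    shows that it divides [s], which is impossible. So [M] is a square up to sign and a factor 2. *)
Lemma jclass_pow2 i (P : J) : `|A ^+ 2 - E|%N = (2 ^ i)%N -> P != jtor _ he ->
  exists (s : bool) (j : bool) (k : rat),
    k != 0 /\ jclass P = (-1) ^+ s * 2 ^+ j * k ^+ 2.
Proof.
move=> hi PT; have [r [s [w [s0 rs hr hw hws]]]] := jac_int P.
have sq0 : s%:~R != 0 :> rat by rewrite intr_eq0 gt_eqF.
have [r0|r0] := eqVneq r 0.
  have u0 : P.1 = 0 by rewrite hr r0 mul0r.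
  have v1 : P.2 = 1.
    have := jac_eq P; rewrite u0 !expr0n /= !mulr0 subr0 addr0 => /eqP.
    rewrite sqrf_eq1 => /orP[/eqP //|/eqP v1]; case/eqP: PT; apply: val_inj => /=.
    by rewrite -u0 -v1; case: (jval P).
  exists false, false, 2; split=> //.
  by rewrite /jclass u0 v1 expr0n /=; ring.
have eMN : (s ^+ 2 - A * r ^+ 2 + w) * (s ^+ 2 - A * r ^+ 2 - w)
              = (A ^+ 2 - E) * (r ^+ 2) ^+ 2.
  by transitivity ((s ^+ 2 - A * r ^+ 2) ^+ 2 - w ^+ 2); [ring|rewrite hws; ring].
have eSum : (s ^+ 2 - A * r ^+ 2 + w) + (s ^+ 2 - A * r ^+ 2 - w)
              = 2 * (s ^+ 2 - A * r ^+ 2) by ring.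
have -> : jclass P = 2 * (s ^+ 2 - A * r ^+ 2 + w)%:~R / s%:~R ^+ 2.
  rewrite /jclass hr hw !(rmorphD, rmorphB, rmorphM, rmorphXn) /=; field.
  by rewrite sq0.
have MN0 : (A ^+ 2 - E) * (r ^+ 2) ^+ 2 != 0.
  by rewrite mulf_neq0 ?expf_neq0 // -absz_gt0 hi expn_gt0.
move: MN0 eSum eMN; set M := _ + w; set N := _ - w => MN0 eSum eMN.
move: MN0; rewrite -eMN mulf_eq0 negb_or => /andP[M0 N0].
have [||p pp po pM pN||j [l hl]] := @mul_pow2_sqr `|M|%N `|N|%N i (`|r| ^ 2)%N.
- by rewrite absz_gt0.
- by rewrite absz_gt0.
- have pi2 : ~~ (p %| 2 ^ i)%N.
    by rewrite Euclid_dvdX // negb_and (dvdn_prime2 pp) // ; case: eqP po => // ->.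
  have pr : (p %| `|r|)%N.
    have : (p %| `|(M * N)%R|)%N by rewrite abszM dvdn_mulr.
    by rewrite eMN abszM hi !abszX Euclid_dvdM // (negPf pi2) !Euclid_dvdX // !andbT.
  have : (p%:Z %| (2 * s ^+ 2)%R)%Z.
    have -> : 2 * s ^+ 2 = (M + N) + 2 * A * r ^+ 2 by rewrite eSum; ring.
    apply: rpredD; first by apply: rpredD; rewrite dvdzE.
    by apply: dvdz_mull; rewrite dvdzE abszX dvdn_exp.
  rewrite dvdzE abszM Euclid_dvdM // abszX Euclid_dvdX // andbT => /orP[|ps].
    by rewrite /= dvdn_prime2 // => /eqP p2; rewrite p2 in po.
  move: rs; rewrite coprimezE => /(coprime_dvdl pr) /(coprime_dvdr ps).
  by rewrite /coprime gcdnn => /eqP p1; rewrite p1 in pp.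
- by rewrite -abszM eMN abszM hi !abszX.
(* The factor 2 in front of [M] flips the parity of the exponent of 2. *)
exists (M < 0), (~~ j), ((2 ^ j * l)%N%:R / s%:~R).
have l0 : l != 0%N by move: M0; rewrite -absz_eq0 hl; case: l {hl} => //; rewrite muln0.
split.
  by rewrite mulf_neq0 ?invr_eq0 // pnatr_eq0 muln_eq0 (negPf l0) orbF expn_eq0.
rewrite {1}(intEsign M) rmorphM /= rmorph_sign hl.
by case: (M < 0); case: (j) => /=; rewrite ?expr0 ?expr1 !natrM !natrX; field; exact: sq0.
Qed.

End IntegralJacobi.

(** * Torsion, independence and the double descent *)

Section Torsion.
Variables (F : numFieldType) (a e : F) (he : nonsquare e).
Local Notation J := (@jac F a e he).
Local Notation T := (jtor a he).

Lemma jac_u_eq0 (P : J) : P.1 = 0 -> P = 0 \/ P = T.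
Proof.
move=> u0; have := jac_eq P; rewrite u0 !expr0n /= !mulr0 subr0 addr0 => /eqP.
rewrite sqrf_eq1 => /orP[]/eqP v; [left|right]; apply: val_inj => /=;
  by rewrite -u0 -v; case: (jval P).
Qed.

Lemma jtor_neq0 : T != 0.
Proof. by apply/eqP => /(congr1 (fun P : J => P.2)) /= /eqP; rewrite eq_sym -subr_eq0 opprK -(natrD _ 1 1) pnatr_eq0. Qed.

End Torsion.

Section TwoTorsion.
Variables (F : numFieldType) (a e : F).
Variables (he : nonsquare e) (he' : nonsquare (4 * (a ^+ 2 - e))).
Local Notation J := (@jac F a e he).
Local Notation J' := (@jac F (- 2 * a) (4 * (a ^+ 2 - e)) he').
Local Notation T := (jtor a he).

Lemma jac_double_u_eq0 (P : J) : (jval (P *+ 2)).1 = 0 -> P = 0 \/ P = T.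
Proof.
have d : 1 - e * P.1 ^+ 4 != 0.
  by apply: contraNneq (jac_den he P.1 P.1) => <-; apply/eqP; rewrite -mulrA -exprD.
move=> /eqP; rewrite jval2 !mulf_eq0 invr_eq0 (negPf d) orbF pnatr_eq0 /=.
by rewrite (negPf (jac_v_neq0 he' P)) orbF => /eqP /jac_u_eq0.
Qed.

Lemma jac_double_eq0 (P : J) : P *+ 2 = 0 -> P = 0 \/ P = T.
Proof. by move=> h; apply: jac_double_u_eq0; rewrite h. Qed.

Lemma jtor_not_double (P : J) : P *+ 2 <> T.
Proof.
move=> h; have [h0|h0] : P = 0 \/ P = T by apply: jac_double_u_eq0; rewrite h.
  by move: h (jtor_neq0 a he); rewrite h0 mul0rn => <-; rewrite eqxx.
by move: h (jtor_neq0 a he); rewrite h0 jtor2 => <-; rewrite eqxx.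
Qed.

Lemma jclass_jdual (Q : J') : exists k, jclass (jdual he Q) = k ^+ 2.
Proof.
have := jac_v_neq0' he Q; have := jac_eq Q; rewrite /jclass /=.
by case: (jval Q) => u v /= h v0; exists (2 / v); field: h.
Qed.

Lemma jclass_jiso (P : J) : exists k, jclass (jiso he' P) = k ^+ 2.
Proof.
have := jac_v_neq0 he' P; have := jac_eq P; rewrite /jclass /=.
by case: (jval P) => u v /= h v0; exists (2 / v); field: h.
Qed.

Lemma jdual_eq0 (Q : J') : jdual he Q = 0 -> Q.1 = 0.
Proof.
move=> /(congr1 (fun P : J => P.1)) /= /eqP; rewrite !mulf_eq0 invr_eq0 pnatr_eq0.
by rewrite (negPf (jac_v_neq0' he Q)) orbF => /eqP.
Qed.

Lemma jclass_double (R : J) : exists k, jclass (R *+ 2) = k ^+ 2.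
Proof. by rewrite -(jdual_jiso he'); exact: jclass_jdual. Qed.

(** If [R *+ 2 = jdual (jiso R)] equals [jdual Q0], then [jiso R] differs from [Q0] by a point of
    the kernel of [jdual], and the class of [jiso R] is a square. This applies to points whose own
    class is a square, for which [jclass] alone decides nothing. *)
Lemma jdual_not_double (Q0 : J') : nonsquare (jclass Q0) ->
  nonsquare (jclass (Q0 + jtor _ he')) -> forall R, R *+ 2 <> jdual he Q0.
Proof.
move=> h0 hT R; rewrite -(jdual_jiso he') => h.
have : jdual he (jiso he' R - Q0) = 0.
  apply: (addIr (jdual he Q0)); rewrite -jdualD subrK add0r; exact: h.
move/jdual_eq0/jac_u_eq0; have [k hk] := jclass_jiso R.
case=> /(canRL (subrK _)) eR.
  by have /negP[] := h0 k; rewrite -hk eR [0 + Q0]add0r eqxx.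
by have /negP[] := hT k; rewrite -hk eR [_ + Q0]addrC eqxx.
Qed.

Section Independence.
Variable P0 : J.
Hypotheses (P0_odd : forall R, R *+ 2 <> P0) (P0T_odd : forall R, R *+ 2 <> P0 + T).

Lemma jtor_muln k : T *+ k = T *+ odd k.
Proof. by rewrite -{1}(odd_double_half k) mulrnDr -mul2n mulrnA jtor2 mul0rn addr0. Qed.

(** Infinite descent on [n]. For odd [n] the relation makes [P0] or [P0 + T] a double. For even [n],
    since [T] is not a double, [P0 *+ n./2] is killed by doubling; it is therefore [0] or [T], a
    relation with a smaller [n]. *)
Lemma indep_nat n k : P0 *+ n = T *+ k -> n = 0%N.
Proof.
elim/ltn_ind: n k => n IHn k; rewrite (jtor_muln k).
have [n0|n0] := posnP n; first by [].
rewrite -{1}(odd_double_half n) -muln2 mulrnDr mulrnA => h; exfalso; move: h.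
case on: (odd n); case: (odd k); rewrite ?mulr1n ?mulr0n ?add0r => h.
- apply: (@P0T_odd (- (P0 *+ n./2) + T)); rewrite mulrnDl jtor2 addr0 mulNrn.
  by apply/eqP; rewrite eq_sym -addr_eq0 addrAC h -mulr2n jtor2.
- by apply: (@P0_odd (- (P0 *+ n./2))); rewrite mulNrn; apply/eqP; rewrite eq_sym -addr_eq0 h.
- exact: (@jtor_not_double _ h).
have lt : (n./2 < n)%N by lia.
have [h'|h'] := jac_double_eq0 h.
  by have := IHn _ lt 0%N h'; lia.
by have := IHn _ lt 1%N h'; lia.
Qed.

Lemma indep (n : int) k : P0 *~ n = T *+ k -> n = 0.
Proof.
case: n => n; first by move=> h; rewrite (@indep_nat n k).
rewrite NegzE mulrNz => /eqP; rewrite eqr_oppLR => /eqP h.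
have : P0 *+ n.+1 = T *+ k; last by move/indep_nat.
by rewrite -[LHS]/(P0 *~ n.+1) h; apply/eqP; rewrite eq_sym -addr_eq0 -mulr2n -mulrnAC jtor2 mul0rn.
Qed.

End Independence.

(* [D] picks the class, modulo the image of the dual isogeny and up to the
   2-torsion, that the points of [J] outside the image are shifted by. *)
Lemma double_descent (Q0 : J') :
    (forall P : J, exists g k, k != 0 /\ jclass (P + T *+ g) = k ^+ 2) ->
    (forall Q : J', exists g d k,
       k != 0 /\ jclass (Q + jtor _ he' *+ g + Q0 *+ (d : bool)) = k ^+ 2) ->
  forall P : J, exists g (d : bool) R, P + T *+ g + jdual he Q0 *+ d = R *+ 2.
Proof.
move=> hJ hJ' P; have [g [k [k0 hk]]] := hJ P.
have [Q hQ] := jdual_surj he' k0 hk.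
have [g' [d [k' [k'0 hk']]]] := hJ' Q.
have [R hR] := jiso_surj he k'0 hk'.
exists g, d, R; rewrite -jdual_jiso hR -hQ.
have dn n (Q1 : J') : jdual he (Q1 *+ n) = jdual he Q1 *+ n.
  elim: n => [|n IHn]; last by rewrite mulrS jdualD IHn -mulrS.
  have := jdualD he (0 : J') 0; rewrite addr0 !mulr0n.
  by rewrite -{1}[jdual he 0]addr0 => /addrI <-.
by rewrite !jdualD !dn jdual_tor mul0rn addr0.
Qed.

End TwoTorsion.

Lemma MW_of_jac (a b c e : rat) (eE : e = a ^+ 2 - 4 * b) (he : nonsquare e)
    (he' : nonsquare (4 * (a ^+ 2 - e))) (b0 : b != 0) (P0 : jac a he) :
    (forall R, R *+ 2 <> P0) -> (forall R, R *+ 2 <> P0 + jtor a he) ->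
    (forall P, exists (n : int) k, P = P0 *~ n + jtor a he *+ k) ->
  MW_Z_Z2 (shifted_weierstrass a b c) (jac_weier a c (jval P0)).
Proof.
move=> od odT gen; set T := jtor a he.
pose pt (x : int * 'Z_2) : jac a he := P0 *~ x.1 + T *+ x.2.
have mulT k : T *+ (k %% 2) = T *+ k by rewrite modn2 [RHS]jtor_muln.
have ptD : {morph pt : x y / x + y}.
  move=> x y; rewrite /pt /= mulrzDr mulT mulrnDr.
  by rewrite !addrA; congr (_ + _); rewrite -!addrA; congr (_ + _); rewrite addrC.
exists (fun x => jac_weier a c (jval (pt x))); split.
- have T2 : - T = T by apply/eqP; rewrite eq_sym -addr_eq0 -mulr2n jtor2.
  have ptN x : pt (- x) = - pt x.
    have pt0 : pt 0 = 0 by rewrite /pt /= mulr0z mulr0n addr0.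
    by have := ptD x (- x); rewrite subrr pt0 => /esym/eqP; rewrite addrC addr_eq0 => /eqP.
  have inj0 x : pt x = 0 -> x = 0.
    case: x => n k /= h; have n0 : n = 0.
      apply: (indep he' od odT (k := k)); apply/eqP.
      by rewrite -subr_eq0 -mulNrn T2; apply/eqP.
    move: h; rewrite n0 /pt /= mulr0z add0r; case: k => -[|[|//]] hk /= h.
      by congr (_, _); apply: val_inj.
    by case/eqP: (jtor_neq0 a he).
  move=> x y h; apply/eqP; rewrite -subr_eq0; apply/eqP/inj0.
  rewrite ptD ptN; apply/eqP; rewrite subr_eq0; apply/eqP; apply: val_inj.
  rewrite -[LHS](jac_weierK c eE b0 (jvalP (pt x))) h.
  exact: (jac_weierK c eE b0 (jvalP (pt y))).
- move=> P; split=> [onP|[x <-]]; last exact: (jac_weier_on c eE (jvalP _)).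
  have [n [k hP]] := gen (Jac he (weier_jac_on eE he onP)).
  exists (n, inZp k); have -> : pt (n, inZp k) = Jac he (weier_jac_on eE he onP).
    by rewrite hP; congr (_ + _); exact: mulT.
  exact: weier_jacK eE he _ onP.
- move=> x y; rewrite [pt (x + y)]ptD.
  have [on1 e1] := ec_add_weier_jac eE he b0 (jac_weier_on c eE (jvalP (pt x)))
                                        (jac_weier_on c eE (jvalP (pt y))).
  rewrite -(weier_jacK eE he on1) e1; congr (jac_weier _ _ _).
  by rewrite !(jac_weierK c eE b0 (jvalP _)).
- congr (jac_weier a c (jval _)); rewrite /pt mulr1z; exact: addr0.
Qed.

(** * Classes modulo squares and their shifts *)

Section SquareClasses.
Variables (a e : rat) (he : nonsquare e).
Local Notation J := (@jac rat a e he).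
Local Notation T := (jtor a he).

Definition sq_class (x : rat) (s j : bool) : Prop :=
  exists k, k != 0 /\ x = (-1) ^+ s * 2 ^+ j * k ^+ 2.

Lemma sq_class_neq0 x s j : sq_class x s j -> x != 0.
Proof.
move=> [k [k0 ->]]; by rewrite !mulf_neq0 ?expf_neq0 //.
Qed.

(* Up to squares, the class of [x] is the product of those of [y] and [z]. *)
Lemma sq_classM x y z L s j s' j' : x * y * z = L ^+ 2 -> x != 0 ->
  sq_class y s j -> sq_class z s' j' -> sq_class x (s (+) s') (j (+) j').
Proof.
move=> e0 x0 hy hz; have [y0 z0] := (sq_class_neq0 hy, sq_class_neq0 hz).
move: hy hz => [k [k0 hy]] [l [l0 hz]].
have : L ^+ 2 != 0 by rewrite -e0 !mulf_neq0.
rewrite expf_eq0 /= => L0.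
exists (L / (2 ^+ (j || j') * k * l)); split.
  by rewrite mulf_neq0 // invr_eq0 !mulf_neq0 // expf_neq0.
have -> : x = L ^+ 2 / (y * z) by rewrite -e0; field; rewrite y0 z0.
by rewrite hy hz; case: s {hy}; case: s' {hz}; case: j; case: j' => /=; rewrite ?expr0 ?expr1;
  field; rewrite ?k0 ?l0.
Qed.

Lemma jclass_neq0 (he' : nonsquare (4 * (a ^+ 2 - e))) (P : J) :
  (jclass P != 0) = (P != T).
Proof. by rewrite (jclass_eq0 he'). Qed.

(** Away from [u = 0], translation by [T] multiplies the class by [a^2 - e] modulo squares. *)
Lemma jclassDT (P : J) :
  jclass (P + T) * jclass P = 4 * (a ^+ 2 - e) * P.1 ^+ 4.
Proof.
rewrite /jclass jvalDT /=; have := jac_eq P.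
by case: (jval P) => u v /= h; ring: h.
Qed.

Lemma sq_class_jclassDT (P : J) c (s j s' j' : bool) : P.1 != 0 -> c != 0 ->
    a ^+ 2 - e = (-1) ^+ s' * 2 ^+ j' * c ^+ 2 ->
  sq_class (jclass P) s j -> sq_class (jclass (P + T)) (s (+) s') (j (+) j').
Proof.
move=> u0 c0 hc hP; have hz : sq_class (a ^+ 2 - e) s' j' by exists c.
apply: (sq_classM (L := 2 * (a ^+ 2 - e) * P.1 ^+ 2) _ _ hP hz).
  by rewrite jclassDT; ring.
have : jclass (P + T) * jclass P != 0.
  by rewrite jclassDT !mulf_neq0 ?expf_neq0 // (sq_class_neq0 hz).
by rewrite mulf_eq0 negb_or => /andP[].
Qed.

(** Linear algebra over the field with two elements: in the basis -1, 2 of square classes,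
    [(s0, j0)] is the class of [Q0] and [(s1, j1)] that of [a^2 - e], by which [T] acts. The last
    hypothesis says that their determinant is 1, so every class can be cancelled; [d] and [g] below
    are given by Cramer's rule. *)
Lemma jclass_square_or_shifts (he' : nonsquare (4 * (a ^+ 2 - e))) (Q0 : J) c
    (s0 j0 s1 j1 : bool) :
    (forall Q : J, Q != T -> exists s j, sq_class (jclass Q) s j) ->
    sq_class (jclass Q0) s0 j0 -> c != 0 -> a ^+ 2 - e = (-1) ^+ s1 * 2 ^+ j1 * c ^+ 2 ->
    (s0 && j1) (+) (s1 && j0) ->
  forall Q : J, exists g (d : bool) k, k != 0 /\ jclass (Q + T *+ g + Q0 *+ d) = k ^+ 2.
Proof.
move=> hJ h0 c0 hc det Q.
(* If some shift of [Q] is [0], its class is 4. Otherwise none of the points met below is [T], where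
   [jclass] degenerates to 0, or has [u = 0] before a shift by [T]. *)
have [[g [d h]]|nex] := pselect (exists g (d : bool), Q + T *+ g + Q0 *+ d = 0).
  by exists g, d, 2; split=> //; rewrite h /jclass /= expr0n /=; ring.
have [s [j hQ]] : exists s j, sq_class (jclass Q) s j.
  by apply: hJ; apply/eqP => QT; apply: nex; exists 1%N, false; rewrite addr0 QT -mulr2n jtor2.
pose d := (s && j1) (+) (j && s1); pose g := (s0 && j) (+) (j0 && s).
have nz (g' d' : bool) : Q + T *+ g' + Q0 *+ d' != 0.
  by apply/eqP => h; apply: nex; exists g', d'.
have nT (d' : bool) : Q + Q0 *+ d' != T.
  by apply: contraNneq (nz true d') => h; rewrite addrAC h -mulr2n jtor2.
have n0 (d' : bool) : Q + Q0 *+ d' != 0 by have := nz false d'; rewrite addr0.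
have hd : sq_class (jclass (Q + Q0 *+ d)) (s (+) (d && s0)) (j (+) (d && j0)).
  case: (d) (nT d) => /= nTd; last by rewrite addr0 !addbF.
  have [L hL] := jclassD Q Q0.
  by apply: (sq_classM hL _ hQ h0); rewrite (jclass_neq0 he').
have hg : sq_class (jclass (Q + Q0 *+ d + T *+ g))
    (s (+) (d && s0) (+) (g && s1)) (j (+) (d && j0) (+) (g && j1)).
  case: (g) => /=; last by rewrite addr0 !addbF.
  apply: (sq_class_jclassDT _ c0 hc hd); apply/eqP => /jac_u_eq0[] h.
    by have := n0 d; rewrite h eqxx.
  by have := nT d; rewrite h eqxx.
have [k [k0 hk]] : sq_class (jclass (Q + Q0 *+ d + T *+ g)) false false.
  have [es ej] : s (+) (d && s0) (+) (g && s1) = false /\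
                 j (+) (d && j0) (+) (g && j1) = false.
    by rewrite /d /g; move: s j s0 j0 s1 j1 {h0 hc hQ hd hg d g} det; do 6 case.
  by move: hg; rewrite es ej.
by exists (nat_of_bool g), d, k; rewrite addrAC hk !expr0 !mul1r.
Qed.

End SquareClasses.

Lemma nonsquare_int (n k : int) : 0 <= k -> k ^+ 2 < n < (k + 1) ^+ 2 ->
  nonsquare (n%:~R : rat).
Proof.
move=> k0 kn y; apply/eqP => h; have [m hm] := rat_sqrt_int h.
have {h} : m ^+ 2 = n by apply: (@intr_inj rat); rewrite rmorphXn /= -hm h.
move=> h; move: kn; rewrite -h !expr2 => kn.
by have [?|?] := leP (k + 1) m; [nia|have [?|?] := leP (- k) m; nia].
Qed.

Lemma nonsquare_lt0 (x : rat) : x < 0 -> nonsquare x.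
Proof. by move=> x0 y; apply: contraTneq x0 => <-; rewrite -leNgt sqr_ge0. Qed.

Lemma nonsquare2 : nonsquare (2 : rat).
Proof. exact: (@nonsquare_int 2 1). Qed.

Section ClassesOfIntegralPoints.
Variables (A E : int) (he : nonsquare (E%:~R : rat)).
Local Notation a := (A%:~R : rat).
Local Notation J := (@jac rat a E%:~R he).
Local Notation T := (jtor a he).

(* When [a <= 0] the real locus forces [jclass > 0], so that only the classes
   of 1 and 2 occur. *)
Lemma jclass_square_or_shift i c (P : J) : `|A ^+ 2 - E|%N = (2 ^ i)%N -> A <= 0 ->
    A ^+ 2 - E = 2 * c ^+ 2 ->
  exists g k, k != 0 /\ jclass (P + T *+ g) = k ^+ 2.
Proof.
move=> hi A0 hc; have [->|PT] := eqVneq P T.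
  exists 1%N, 2; split=> //; rewrite mulr1n -mulr2n jtor2 /jclass /=.
  by rewrite expr0n /=; ring.
have c0 : c != 0 by apply: contra_eq_neq hi => c0; rewrite hc c0; lia.
have [s [j [k [k0 hk]]]] := jclass_pow2 hi PT.
have s0 : s = false.
  case: s hk => // hk; have hc' : a ^+ 2 - E%:~R = 2 * c%:~R ^+ 2.
    by rewrite -rmorphXn -rmorphB /= hc rmorphM rmorphXn.
  have a0 : a <= 0 by rewrite lerz0.
  have u2 : 0 <= P.1 ^+ 2 by exact: sqr_ge0.
  have jneg : jclass P < 0.
    have k2 : 0 < k ^+ 2 by rewrite exprn_even_gt0.
    rewrite hk expr1 -mulrA mulN1r oppr_lt0; apply: mulr_gt0 => //; exact: exprn_gt0.
  (* As [1 - a u^2] is positive, a negative class makes both factors on the left negative, while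
     their product is at most 0. *)
  have hv : (P.2 - (1 - a * P.1 ^+ 2)) * (P.2 + (1 - a * P.1 ^+ 2))
            = - (2 * (c%:~R * P.1 ^+ 2) ^+ 2).
    transitivity (P.2 ^+ 2 - (1 - a * P.1 ^+ 2) ^+ 2); first by ring.
    rewrite jac_eq; transitivity (- ((a ^+ 2 - E%:~R) * P.1 ^+ 4)); first by ring.
    by rewrite hc'; ring.
  have c2 : 0 <= (c%:~R * P.1 ^+ 2) ^+ 2 by exact: sqr_ge0.
  have t0 : 0 <= - (a * P.1 ^+ 2) by rewrite oppr_ge0 mulr_le0_ge0.
  move: jneg hv; rewrite /jclass => jneg hv.
  have : 0 < (P.2 - (1 - a * P.1 ^+ 2)) * (P.2 + (1 - a * P.1 ^+ 2)).
    by rewrite nmulr_rgt0; lra.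
  by rewrite hv; lra.
move: hk; rewrite s0; case: j => hk; last first.
  by exists 0%N, k; rewrite mulr0n addr0 hk !expr0 !mul1r.
have u0 : P.1 != 0.
  apply/eqP => /jac_u_eq0[P0|P0]; last by rewrite P0 eqxx in PT.
  have /eqP[] := nonsquare2 k.
  by move: hk; rewrite P0 /jclass /= !expr0n /= expr0 expr1 => hk; lra.
have : sq_class (jclass P) false true by exists k.
move/(sq_class_jclassDT (c := c%:~R) (s' := false) (j' := true) u0).
case=> [||l [l0 hl]]; first by rewrite intr_eq0.
  by rewrite expr0 expr1 mul1r -rmorphXn -rmorphB /= hc rmorphM rmorphXn.
by exists 1%N, l; rewrite mulr1n hl /= !expr0 !mul1r.
Qed.

End ClassesOfIntegralPoints.

(** * Heights under doubling and translation *)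

Section Heights.
Variables (A E : int) (he : nonsquare (E%:~R : rat)).
Local Notation a := (A%:~R : rat).
Local Notation J := (@jac rat a E%:~R he).

Lemma heightN x : height (- x) = height x.
Proof. by rewrite /height numqN denqN abszN. Qed.

(** The fraction [2 r s w / D] with [D = s^4 - E r^4] is in lowest terms, so the height is exact. As
    [s] is odd and [E] is up to sign a nontrivial power of 2, [D] is coprime to 2, [r] and [s]. For
    [w], modulo [D] one has [w^2 = 2 r^2 (E r^2 - A s^2)], and [E r^2 - A s^2] divides
    [-(A^2 - E) s^4] modulo [D]. *)
Lemma jac_double_height (P : J) i j r s w : `|A ^+ 2 - E|%N = (2 ^ i)%N ->
    `|E|%N = (2 ^ j.+1)%N -> coprimez r s -> odd `|s| ->
    P.1 = r%:~R / s%:~R -> P.2 = w%:~R / s%:~R ^+ 2 ->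
    w ^+ 2 = s ^+ 4 - 2 * A * r ^+ 2 * s ^+ 2 + E * r ^+ 4 ->
  height (jval (P *+ 2)).1 = maxn (absz (2 * r * s * w)%R) (absz (s ^+ 4 - E * r ^+ 4)%R).
Proof.
move=> hi hj rs os hr hw hws; have s0 : s != 0 by case: eqP os => // ->.
have sq0 : s%:~R != 0 :> rat by rewrite intr_eq0.
pose D := s ^+ 4 - E * r ^+ 4.
have d0 : 1 - E%:~R * P.1 ^+ 4 != 0.
  by apply: contraNneq (jac_den he P.1 P.1) => <-; apply/eqP; ring.
have D0 : D != 0.
  rewrite -(intr_eq0 rat); apply: contraNneq d0 => D0; apply/eqP.
  transitivity (D%:~R / s%:~R ^+ 4 : rat); last by rewrite D0 mul0r.
  by rewrite hr /D !(rmorphB, rmorphM, rmorphXn) /=; field.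
have -> : (jval (P *+ 2)).1 = (2 * r * s * w)%:~R / D%:~R.
  rewrite jval2 hr hw; move: D0 d0; rewrite -(intr_eq0 rat) hr.
  rewrite /D !(rmorphB, rmorphM, rmorphXn) /= => D0 d0; field.
  by rewrite D0 sq0.
apply: height_coprime => //; rewrite coprimez_sym.
have cD x y k : D = k * x + y -> coprimez D x = coprimez x y.
  by move=> ->; rewrite coprimez_sym /coprimez gcdzMDl.
have cs2 : coprimez s 2 by rewrite coprimezE coprimen2.
have csE : coprimez s E by rewrite coprimezE hj coprimeXr // coprimen2.
have D2 : coprimez D 2.
  have : coprimez D E.
    rewrite (cD _ (s ^+ 4) (- r ^+ 4)); last by rewrite /D; ring.
    by rewrite coprimezXr // coprimez_sym.
  by rewrite !coprimezE hj coprime_pexpr.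
have Dr : coprimez D r.
  rewrite (cD _ (s ^+ 4) (- E * r ^+ 3)); last by rewrite /D; ring.
  by rewrite coprimezXr.
have Ds : coprimez D s.
  rewrite (cD _ (- E * r ^+ 4) (s ^+ 3)); last by rewrite /D; ring.
  by rewrite coprimezMr coprimezN csE coprimezXr // coprimez_sym.
rewrite !coprimezMr D2 Dr Ds /=.
have DAE : coprimez D (A ^+ 2 - E).
  by rewrite coprimezE hi coprimeXr // coprimen2 -coprimen2; move: D2; rewrite coprimezE.
have : coprimez D ((E * r ^+ 2 - A * s ^+ 2) * (E * r ^+ 2 + A * s ^+ 2)).
  rewrite (_ : _ * _ = (- E) * D + - ((A ^+ 2 - E) * s ^+ 4)); last by rewrite /D; ring.
  by rewrite /coprimez gcdzMDl -/(coprimez _ _) coprimezN coprimezMr DAE coprimezXr.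
rewrite coprimezMr => /andP[Dx _].
have : coprimez D (w ^+ 2).
  have -> : w ^+ 2 = 1 * D + 2 * r ^+ 2 * (E * r ^+ 2 - A * s ^+ 2) by rewrite hws /D; ring.
  by rewrite /coprimez gcdzMDl -/(coprimez _ _) !coprimezMr D2 Dr Dx.
by rewrite expr2 coprimezMr => /andP[].
Qed.

End Heights.

(** * The Mordell-Weil groups of EU and EV *)

Lemma nonsquare_intN (n : int) : n < 0 -> nonsquare (n%:~R : rat).
Proof. by move=> n0; apply: nonsquare_lt0; rewrite ltrz0. Qed.

Section Descent.
Variables (A E : int) (he : nonsquare (E%:~R : rat)).
Local Notation a := (A%:~R : rat).
Local Notation J := (@jac rat a E%:~R he).
Local Notation T := (jtor a he).

Lemma height_shift (P : J) g : height (jval (P + T *+ g)).1 = height P.1.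
Proof.
rewrite jtor_muln; case: (odd g); last by rewrite addr0.
by rewrite mulr1n jvalDT /= heightN.
Qed.

(** The fraction expressing [u] of [P + P0] may cancel, so this is an upper bound, quadratic in the
    height of [P]. *)
Lemma height_shift_unit (P P0 : J) V0 r s w : s != 0 ->
    jval P0 = (1, V0%:~R) ->
    P.1 = r%:~R / s%:~R -> P.2 = w%:~R / s%:~R ^+ 2 ->
  (height (jval (P + P0)%R).1 <= maxn (absz (V0 * r * s + w)%R) (absz (s ^+ 2 - E * r ^+ 2)%R))%N.
Proof.
move=> s0 hP0 hr hw; have sq0 : s%:~R != 0 :> rat by rewrite intr_eq0.
have d0 : 1 - E%:~R * (r%:~R / s%:~R) ^+ 2 != 0 :> rat.
  have := jac_den he P.1 P0.1; rewrite hP0 hr /=.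
  by apply: contraNneq => <-; apply/eqP; ring.
have D0 : s ^+ 2 - E * r ^+ 2 != 0.
  rewrite -(intr_eq0 rat); apply: contraNneq d0 => D0; apply/eqP.
  transitivity ((s ^+ 2 - E * r ^+ 2)%:~R / s%:~R ^+ 2 : rat); last by rewrite D0 mul0r.
  by rewrite !(rmorphB, rmorphM, rmorphXn) /=; field.
rewrite (_ : (jval _).1 = (V0 * r * s + w)%:~R / (s ^+ 2 - E * r ^+ 2)%:~R) ?height_le //.
rewrite jvalD /jac_add hP0 hr hw /=; move: D0 d0; rewrite -(intr_eq0 rat).
rewrite !(rmorphB, rmorphD, rmorphM, rmorphXn) /= => D0 d0; field.
by rewrite D0 sq0.
Qed.

Definition in_span (P0 P : J) : Prop := exists (n : int) k, P = P0 *~ n + T *+ k.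

Lemma in_span_double P0 (P R : J) g (d : bool) : P + T *+ g + P0 *+ d = R *+ 2 ->
  in_span P0 R -> in_span P0 P.
Proof.
move=> h [n [k hR]]; exists (n * 2 - d%:Z), g.
have -> : P = R *+ 2 - P0 *+ d - T *+ g by rewrite -h !addrK.
rewrite hR mulrnDl [T *+ k *+ 2]mulrnAC jtor2 mul0rn addr0 mulrzBr mulrzA -!pmulrn.
congr (_ + _); apply/eqP; rewrite eq_sym -addr_eq0 -mulrnDr addnn -mul2n mulrnA jtor2.
by rewrite mul0rn.
Qed.

Lemma in_span_u0 (P0 P : J) : P.1 = 0 -> in_span P0 P.
Proof.
move=> /jac_u_eq0[->|->]; first by exists 0, 0%N; rewrite mulr0z addr0.
by exists 0, 1%N; rewrite mulr0z add0r.
Qed.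

(** The square of [u] determines that of [v], and the four choices of signs are [P0], [- P0],
    [- P0 + T] and [P0 + T]. *)
Lemma in_span_sqr_u (P0 P : J) : P.1 ^+ 2 = P0.1 ^+ 2 -> in_span P0 P.
Proof.
move=> hu; have hv : P.2 ^+ 2 = P0.2 ^+ 2.
  by rewrite !jac_eq (exprM P.1 2 2) (exprM P0.1 2 2) hu.
have inj (Q : J) : P.1 = Q.1 -> P.2 = Q.2 -> P = Q.
  move=> e1 e2; apply: val_inj => /=; move: e1 e2.
  by case: (jval P) (jval Q) => [x1 y1] [x2 y2] /= -> ->.
move/eqP: hu; move/eqP: hv; rewrite !eqf_sqr.
move=> /orP[]/eqP hv /orP[]/eqP hu.
- by exists 1, 0%N; rewrite mulr1z addr0; apply: inj.
- by exists (- 1), 0%N; rewrite mulrNz mulr1z addr0; apply: inj.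
- by exists (- 1), 1%N; rewrite mulrNz mulr1z; apply: inj; rewrite mulr1n jvalDT /= ?opprK.
- by exists 1, 1%N; rewrite mulr1z; apply: inj; rewrite mulr1n jvalDT.
Qed.

Lemma descent (P0 : J) :
    (forall P : J, exists g (d : bool) R, P + T *+ g + P0 *+ d = R *+ 2) ->
    (forall (P R : J) g (d : bool), P + T *+ g + P0 *+ d = R *+ 2 ->
        (height R.1 < height P.1)%N \/ in_span P0 P) ->
  forall P : J, in_span P0 P.
Proof.
move=> hd hh P; have [n le_n] := ubnP (height P.1).
elim: n => // n IHn in P le_n *; have [g [d [R hR]]] := hd P.
have [lt|//] := hh P R g d hR.
by apply: (in_span_double hR); apply: IHn; apply: leq_trans lt _.
Qed.

End Descent.

Lemma jclass_pow2_rat (a e : rat) (he : nonsquare e) (A E : int) i :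
    a = A%:~R -> e = E%:~R -> `|A ^+ 2 - E|%N = (2 ^ i)%N ->
  forall P : jac a he, P != jtor a he -> exists s j, sq_class (jclass P) s j.
Proof.
move=> ea ee; subst a e => hi P PT.
by have [s [j [k hk]]] := jclass_pow2 hi PT; exists s, j, k.
Qed.

Section SmallArithmetic.

Lemma sqr_mod (w : int) : exists k, w ^+ 2 = 4 * k \/ w ^+ 2 = 8 * k + 1.
Proof.
have [q [->|->]] : exists q, w = 2 * q \/ w = 2 * q + 1 by exists (w %/ 2)%Z; lia.
  by exists (q ^+ 2); left; ring.
have [t ht] : exists t, q * (q + 1) = 2 * t.
  have [t [->|->]] : exists t, q = 2 * t \/ q = 2 * t + 1 by exists (q %/ 2)%Z; lia.
    by exists (t * (2 * t + 1)); ring.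
  by exists ((2 * t + 1) * (t + 1)); ring.
by exists t; right; transitivity (4 * (q * (q + 1)) + 1); [ring|rewrite ht; ring].
Qed.

Lemma even_of_sqr (w k : int) : w ^+ 2 = 2 * k -> exists y, w = 2 * y.
Proof.
have [q [->|->]] : exists q, w = 2 * q \/ w = 2 * q + 1 by exists (w %/ 2)%Z; lia.
  by exists q.
have -> : (2 * q + 1) ^+ 2 = 4 * (q ^+ 2 + q) + 1 by ring.
by lia.
Qed.

Lemma odd_sqr_mod (w : int) : odd `|w| -> exists k, w ^+ 2 = 8 * k + 1.
Proof.
move=> ow; have [k [h|h]] := sqr_mod w; exists k => //; exfalso.
have [y hy] : exists y, w = 2 * y by apply: (@even_of_sqr _ (2 * k)); rewrite h; ring.
by lia.
Qed.

Lemma even_absz (s : int) : ~~ odd `|s| -> exists x, s = 2 * x.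
Proof. by move=> es; exists (s %/ 2)%Z; lia. Qed.

Lemma coprime_odd (r s : int) : coprimez r s -> ~~ odd `|s| -> odd `|r|.
Proof.
rewrite coprimezE -dvdn2 => rs s2.
by have := coprime_dvdr s2 rs; rewrite coprimen2.
Qed.

Lemma norm_le_sqr (w z : int) : 0 <= z -> w ^+ 2 <= z ^+ 2 -> `|w| <= z.
Proof. by move=> z0 le; rewrite -ler_sqr ?nnegrE // real_normK ?num_real. Qed.

Lemma sqr_le_max (r s : int) : let z : int := maxn `|r| `|s| in
  [/\ r ^+ 2 <= z ^+ 2, s ^+ 2 <= z ^+ 2 & `|r * s| <= z ^+ 2].
Proof.
move=> z; have hr : `|r| <= z by rewrite -abszE lez_nat leq_maxl.
have hs : `|s| <= z by rewrite -abszE lez_nat leq_maxr.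
split; last by rewrite normrM expr2 ler_pM.
- by rewrite -(real_normK (num_real r)) lerXn2r ?nnegrE.
- by rewrite -(real_normK (num_real s)) lerXn2r ?nnegrE.
Qed.

Lemma leq_sqr (n : nat) : (n <= n ^ 2)%N.
Proof. by case: n => // n; rewrite -mulnn leq_pmull. Qed.

Lemma leq_max_pow4 (m n c : nat) : (0 < c)%N -> (maxn m n ^ 4 <= n ^ 4 + c * m ^ 4)%N.
Proof.
move=> c0; case: (leqP m n) => _; first exact: leq_addr.
by apply: leq_trans (leq_addl _ _); rewrite leq_pmull.
Qed.

Lemma absz_pow4D (r s : int) (c : nat) :
  absz (s ^+ 4 - (- c%:Z) * r ^+ 4)%R = (`|s| ^ 4 + c * `|r| ^ 4)%N.
Proof.
have e x : x ^+ 4 = (`|x| ^ 4)%N :> int.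
  by rewrite -abszX gez0_abs // (exprM x 2 2) sqr_ge0.
by rewrite mulNr opprK !e -PoszM -PoszD absz_nat.
Qed.

End SmallArithmetic.

Section CurveEU.

Lemma nonsqN4 : nonsquare ((- 4)%:~R : rat). Proof. exact: nonsquare_intN. Qed.
Lemma nonsq32 : nonsquare (4 * ((- 2)%:~R ^+ 2 - (- 4)%:~R) : rat).
Proof. by rewrite (_ : _ * _ = 32%:~R); [exact: (@nonsquare_int 32 5)|ring]. Qed.

Local Notation J := (jac (- 2)%:~R nonsqN4).
Local Notation J' := (jac (- 2 * (- 2)%:~R) nonsq32).
Local Notation T := (jtor (- 2)%:~R nonsqN4).

Lemma on_jacU : on_jac (- 2)%:~R (- 4)%:~R (1 : rat, (-1)%:~R). Proof. by []. Qed.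
Definition genU : J := Jac nonsqN4 on_jacU.
Lemma on_jacU' : on_jac (- 2 * (- 2)%:~R) (4 * ((- 2)%:~R ^+ 2 - (- 4)%:~R)) (2^-1 : rat, 1).
Proof. by []. Qed.
Definition genU' : J' := Jac nonsq32 on_jacU'.

Lemma jdual_genU' : jdual nonsqN4 genU' = genU.
Proof. exact: val_inj. Qed.

Lemma descentU (P : J) : exists g (d : bool) R, P + T *+ g + genU *+ d = R *+ 2.
Proof.
rewrite -jdual_genU'; apply: (@double_descent _ _ _ nonsqN4 nonsq32) => {}P.
  exact: (@jclass_square_or_shift _ _ _ 3 2).
(* On the isogenous quartic, with parameters 4 and 32, the class of [genU'] is 2 and
   [4^2 - 32 = - 4^2]. *)
move: P; apply: (@jclass_square_or_shifts _ _ _ _ _ 4 false true true false) => //.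
- rewrite (_ : 4 * _ = (- 64)%:~R). exact: nonsquare_intN. ring.
- exact: (@jclass_pow2_rat _ _ _ 4 32 4).
- by exists 1; split.
Qed.

(** If [s = 2 x], then [r] is odd, [w = 2 y], and [y^2 = 4 x^4 + 4 r^2 x^2 - r^4] is -1 modulo 4. *)
Lemma odd_denU (r s w : int) : coprimez r s ->
  w ^+ 2 = s ^+ 4 - 2 * (- 2) * r ^+ 2 * s ^+ 2 + (- 4) * r ^+ 4 -> odd `|s|.
Proof.
move=> rs h; apply/negPn/negP => es.
have or := coprime_odd rs es.
have [x hx] := even_absz es.
have [k hk] := odd_sqr_mod or; have [l hl] := sqr_mod w.
have [y hy] : exists y, w = 2 * y.
  apply: (@even_of_sqr _ (8 * x ^+ 4 + 8 * r ^+ 2 * x ^+ 2 - 2 * r ^+ 4)).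
  by rewrite h hx; ring.
have [m hm] := sqr_mod y.
have : 4 * y ^+ 2 = 16 * x ^+ 4 + 16 * (r ^+ 2 * x ^+ 2) - 4 * (64 * k ^+ 2 + 16 * k + 1).
  have -> : 64 * k ^+ 2 + 16 * k + 1 = (r ^+ 2) ^+ 2 by rewrite hk; ring.
  by move: h; rewrite hx hy => h; transitivity ((2 * y) ^+ 2); [ring|rewrite h; ring].
move: hm; move: (x ^+ 4) (r ^+ 2 * x ^+ 2) (k ^+ 2) (y ^+ 2) => X Y K Z [->|->]; lia.
Qed.

Lemma height_descentU (P R : J) g (d : bool) : P + T *+ g + genU *+ d = R *+ 2 ->
  (height R.1 < height P.1)%N \/ in_span genU P.
Proof.
move=> h.
(* The denominator [s^4 + 4 r^4] of the double bounds its height from below. The factor 5 comes from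
   the denominator [s^2 + 4 r^2] of the translate by [genU]. *)
have hP : (height R.1 ^ 4 <= 5 * height P.1 ^ 2)%N.
  have [r [s [w [s0 rs hr hw hws]]]] := jac_int R.
  have os := odd_denU rs hws; have sn0 : s != 0 by rewrite gt_eqF.
  have : (height R.1 ^ 4 <= height (jval (R *+ 2)).1)%N.
    rewrite (@jac_double_height (- 2) (- 4) _ _ 3 1 r s w) // hr height_coprime //.
    by rewrite leq_max (absz_pow4D r s 4) leq_max_pow4 ?orbT.
  rewrite -h; move/leq_trans; apply.
  move: (P + T *+ g) (height_shift P g) => {h hr hw hws os rs s0 sn0} Q <-.
  case: d; last by rewrite addr0 (leq_trans (leq_sqr _)) ?leq_pmull.
  have {r s w} [r [s [w [s0 rs hr hw hws]]]] := jac_int Q.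
  have sn0 : s != 0 by rewrite gt_eqF.
  rewrite mulr1n; have b := height_shift_unit (P0 := genU) (V0 := - 1) sn0 erefl hr hw.
  apply: (leq_trans b); rewrite hr height_coprime //.
  have := sqr_le_max r s; set m := maxn `|r| `|s| => -[hr2 hs2 hrs].
  have m0 : 0 <= m%:Z ^+ 2 by exact: sqr_ge0.
  have hw3 : `|w| <= 3 * m%:Z ^+ 2.
    apply: norm_le_sqr; first by rewrite mulr_ge0.
    have [r0 s0'] := (sqr_ge0 r, sqr_ge0 s).
    have ss := ler_pM s0' s0' hs2 hs2; have rs' := ler_pM r0 s0' hr2 hs2.
    have rr := mulr_ge0 r0 r0; have s4 := mulr_ge0 s0' s0'.
    have -> : w ^+ 2 = s ^+ 2 * s ^+ 2 + 4 * (r ^+ 2 * s ^+ 2) - 4 * (r ^+ 2 * r ^+ 2).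
      by rewrite hws; ring.
    have -> : (3 * m%:Z ^+ 2) ^+ 2 = 9 * (m%:Z ^+ 2 * m%:Z ^+ 2) by ring.
    move: ss rs' rr s4 {hr2 hs2 hrs m0 r0 s0' hws hw hr b}.
    move: (s ^+ 2 * s ^+ 2) (r ^+ 2 * s ^+ 2) (r ^+ 2 * r ^+ 2) (m%:Z ^+ 2 * m%:Z ^+ 2).
    by move=> X Y Z W; lia.
  rewrite geq_max -!lez_nat !abszE PoszM (_ : (m ^ 2)%N = m%:Z ^+ 2 :> int) //.
  have := sqr_ge0 r; have := sqr_ge0 s; move: hr2 hs2 hrs m0 hw3.
  rewrite -mulrA mulN1r; clear.
  by move: (r ^+ 2) (s ^+ 2) (m%:Z ^+ 2) (r * s) => X Y Z W *; lia.
(* Heights from 3 on decrease because [5 < 3^2]. Below that, [s] is odd, hence 1, and [r^2 = 4]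
   would give [w^2 = -47]. *)
have [lt|ge] := ltnP 2 (height P.1); [left|right].
  rewrite ltnNge; apply/negP => le.
  have : (height P.1 ^ 4 <= 5 * height P.1 ^ 2)%N by apply: leq_trans hP; rewrite leq_exp2r.
  have h9 : (3 ^ 2 <= height P.1 ^ 2)%N by rewrite leq_exp2r.
  rewrite (expnM _ 2 2) -[X in (X <= _)%N]mulnn leq_pmul2r; lia.
have [r [s [w [s0 rs hr hw hws]]]] := jac_int P.
have os := odd_denU rs hws; move: ge; rewrite hr height_coprime ?gt_eqF // geq_max => /andP[r2 s2].
have s1 : s = 1 by lia.
rewrite s1 divr1 in hr.
have [r0|[r1|r1]] : r = 0 \/ r ^+ 2 = 1 \/ r ^+ 2 = 4.
  have : (r == 0) || (r == 1) || (r == -1) || (r == 2) || (r == -2) by lia.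
  by do ![case/orP] => /eqP ->; tauto.
- by apply: in_span_u0; rewrite hr r0.
- by apply: in_span_sqr_u; rewrite hr -rmorphXn /= r1.
have := sqr_ge0 w; rewrite hws s1; have -> : r ^+ 4 = (r ^+ 2) ^+ 2 by ring.
by rewrite r1.
Qed.

Lemma MW_EU : MW_Z_Z2 EU (Some (0, 1)).
Proof.
have -> : EU = shifted_weierstrass (- 2)%:~R 2 0 by [].
have -> : Some (0, 1) = jac_weier (- 2)%:~R 0 genU by [].
apply: (MW_of_jac _ _ nonsq32); [by ring|by []| | | ].
(* The class of [genU] is 4, a square; what decides are the classes 2 and -2 of [genU'] and its
   translate by the 2-torsion point. *)
- rewrite -jdual_genU'; apply: jdual_not_double.
    by rewrite (_ : jclass _ = 2); [exact: nonsquare2|rewrite /jclass /=; field].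
  rewrite (_ : jclass _ = (- 2)%:~R); first exact: nonsquare_intN.
  by rewrite /jclass jvalDT /=; field.
- move=> R hR; have [k] := jclass_double nonsq32 R; rewrite hR.
  rewrite (_ : jclass _ = 8%:~R); last by rewrite /jclass jvalDT /=; field.
  by move/esym/eqP; apply/negP; apply: (@nonsquare_int 8 2).
exact: descent descentU height_descentU.
Qed.

End CurveEU.

Section CurveEV.

Lemma nonsq_eV : nonsquare (32%:~R : rat). Proof. exact: (@nonsquare_int 32 5). Qed.
Lemma nonsq_eV' : nonsquare (4 * ((- 8)%:~R ^+ 2 - 32%:~R) : rat).
Proof. by rewrite (_ : _ * _ = 128%:~R); [exact: (@nonsquare_int 128 11)|ring]. Qed.

Local Notation J := (jac (- 8)%:~R nonsq_eV).
Local Notation J' := (jac (- 2 * (- 8)%:~R) nonsq_eV').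
Local Notation T := (jtor (- 8)%:~R nonsq_eV).

Lemma on_jacV : on_jac (- 8)%:~R 32%:~R (1 : rat, (-7)%:~R).
Proof. by apply/eqP => /=; ring. Qed.
Definition genV : J := Jac nonsq_eV on_jacV.
Lemma on_jacV' : on_jac (- 2 * (- 8)%:~R) (4 * ((- 8)%:~R ^+ 2 - 32%:~R)) (2^-1 : rat, 1).
Proof. by apply/eqP => /=; field. Qed.
Definition genV' : J' := Jac nonsq_eV' on_jacV'.

Lemma jdual_genV' : jdual nonsq_eV genV' = genV.
Proof. by apply: val_inj => /=; congr (_, _); field. Qed.

Lemma descentV (P : J) : exists g (d : bool) R, P + T *+ g + genV *+ d = R *+ 2.
Proof.
rewrite -jdual_genV'; apply: (@double_descent _ _ _ nonsq_eV nonsq_eV') => {}P.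
  exact: (@jclass_square_or_shift _ _ _ 5 4).
(* On the isogenous quartic, with parameters 16 and 128, the class of [genV'] is -4 and
   [16^2 - 128 = 2 * 8^2]. *)
move: P; apply: (@jclass_square_or_shifts _ _ _ _ _ 8 true false false true).
- by rewrite (_ : 4 * _ = 512%:~R); [exact: (@nonsquare_int 512 22)|ring].
- by apply: (@jclass_pow2_rat _ _ _ 16 128 7); [ring|ring|].
- by exists 2; split=> //; rewrite /jclass /= expr0 expr1; field.
- by [].
- by rewrite expr0 expr1; ring.
- by [].
Qed.

(** If [s = 2 x], then [r] is odd, [w = 4 z], and [z^2 = x^4 + 4 r^2 x^2 + 2 r^4] is 2 or 3 modulo
    4. *)
Lemma odd_denV (r s w : int) : coprimez r s ->
  w ^+ 2 = s ^+ 4 - 2 * (- 8) * r ^+ 2 * s ^+ 2 + 32 * r ^+ 4 -> odd `|s|.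
Proof.
move=> rs h; apply/negPn/negP => es.
have or := coprime_odd rs es.
have [x hx] := even_absz es.
have [k hk] := odd_sqr_mod or.
have [y hy] : exists y, w = 2 * y.
  apply: (@even_of_sqr _ (8 * x ^+ 4 + 32 * r ^+ 2 * x ^+ 2 + 16 * r ^+ 4)).
  by rewrite h hx; ring.
have hy2 : y ^+ 2 = 4 * x ^+ 4 + 16 * (r ^+ 2 * x ^+ 2) + 8 * r ^+ 4.
  apply: (@mulfI _ 4) => //; transitivity (w ^+ 2); first by rewrite hy; ring.
  by rewrite h hx; ring.
have [z hz] : exists z, y = 2 * z.
  by apply: (@even_of_sqr _ (2 * x ^+ 4 + 8 * (r ^+ 2 * x ^+ 2) + 4 * r ^+ 4)); rewrite hy2; ring.
have hz2 : z ^+ 2 = (x ^+ 2) ^+ 2 + 4 * (r ^+ 2 * x ^+ 2) + 2 * (64 * k ^+ 2 + 16 * k + 1).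
  have -> : 64 * k ^+ 2 + 16 * k + 1 = (r ^+ 2) ^+ 2 by rewrite hk; ring.
  apply: (@mulfI _ 4) => //; transitivity (y ^+ 2); first by rewrite hz; ring.
  by rewrite hy2; ring.
have [l hl] := sqr_mod z; have [m hm] := sqr_mod x.
have [n hn] : exists n, (x ^+ 2) ^+ 2 = 4 * n \/ (x ^+ 2) ^+ 2 = 4 * n + 1.
  case: hm => ->; first by exists (4 * m ^+ 2); left; ring.
  by exists (16 * m ^+ 2 + 4 * m); right; ring.
move: hz2 hl hn; move: (z ^+ 2) ((x ^+ 2) ^+ 2) (r ^+ 2 * x ^+ 2) (k ^+ 2).
by clear => Z X Y K -> [] ? [] ?; lia.
Qed.

(** Since [E = 32] is positive, [y^4 - 32 x^4] can be small by cancellation. This needs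
    [x <= y <= 4 x], and there the numerator [2 x y W] is large enough; elsewhere one of the two
    fourth powers dominates. *)
Lemma leq_height_doubleV (x y W : nat) : (y ^ 2 <= W)%N ->
  (maxn x y ^ 4 <= 2 * maxn (2 * x * y * W) (absz (y%:Z ^+ 4 - 32 * x%:Z ^+ 4)%R))%N.
Proof.
move=> yW; rewrite -[4%N]/(2 * 2)%N maxnMr; case: (leqP x y) => xy.
  have [le|lt] := leqP y (4 * x).
    rewrite leq_max; apply/orP; left.
    apply: leq_trans (_ : y ^ 2 * (4 * x * y) <= _)%N.
      by rewrite expnM -mulnn leq_mul // -mulnn leq_mul.
    apply: leq_trans (leq_mul yW (leqnn _)) _.
    by rewrite mulnC !mulnA.
  rewrite leq_max; apply/orP; right.
  have : (256 * x ^ 4 <= y ^ 4)%N by rewrite -[256%N]/(4 ^ 4)%N -expnMn leq_exp2r // ltnW.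
  by lia.
have : (y ^ 4 <= x ^ 4)%N by rewrite leq_exp2r // ltnW.
by lia.
Qed.

Lemma sqr_between (w k n : int) : 0 <= k -> w ^+ 2 = n -> k * k < n < (k + 1) * (k + 1) -> False.
Proof.
move=> k0 <- /andP[lo hi]; move: lo hi; rewrite -expr2 -(expr2 (k + 1)) -(real_normK (num_real w)).
rewrite !ltr_sqr ?nnegrE ?addr_ge0 //; lia.
Qed.

(** A finite check: for every other coprime pair in the range, the right-hand side lies strictly
    between two consecutive squares. *)
Lemma small_pointsV (r s w : int) : 0 < s -> odd `|s| -> coprimez r s ->
    w ^+ 2 = s ^+ 4 - 2 * (- 8) * r ^+ 2 * s ^+ 2 + 32 * r ^+ 4 ->
    (`|r| <= 8)%N -> (`|s| <= 8)%N ->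
  r = 0 \/ r ^+ 2 = s ^+ 2.
Proof.
move=> s0 os rs hws r8 s8; have {hws} : w ^+ 2 = (s ^+ 2) ^+ 2 + 16 * r ^+ 2 * s ^+ 2 + 32 * (r ^+ 2) ^+ 2.
  by rewrite hws; ring.
have -> : r ^+ 2 = (`|r|%N)%:Z ^+ 2 by rewrite abszE real_normK ?num_real.
have -> : s ^+ 2 = (`|s|%N)%:Z ^+ 2 by rewrite abszE real_normK ?num_real.
have -> : (r = 0) = (`|r|%N = 0%N) by apply/propext; split; [move=> ->|move/eqP; rewrite absz_eq0 => /eqP].
have : (`|s|%N \in [:: 1; 3; 5; 7])%N by move: os s8 s0; clear; rewrite !inE; lia.
have : (`|r|%N \in [:: 0; 1; 2; 3; 4; 5; 6; 7; 8])%N by move: r8; clear; rewrite !inE; lia.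
move: rs; rewrite coprimezE; move: (absz r) (absz s) => x y; clear -w.
rewrite !inE => rs hx hy; move: rs.
have nosq (k : int) n : w ^+ 2 = n -> 0 <= k -> k * k < n < (k + 1) * (k + 1) -> False.
  by move=> e k0; apply: sqr_between e.
move: hx hy; do ![case/orP] => /eqP -> ; do ![case/orP] => /eqP -> //; try by [left|right].
all: move=> _ /nosq h; exfalso.
(* The numbers are the integer parts of the square roots of the values to be excluded; for instance
   [r = 1], [s = 3] gives 257, just above the square of 16. *)
all: first [by apply: (h 16); lia|by apply: (h 24); lia|by apply: (h 32); lia
  |by apply: (h 34); lia|by apply: (h 52); lia|by apply: (h 56); lia|by apply: (h 77); lia
  |by apply: (h 82); lia|by apply: (h 91); lia|by apply: (h 102); lia|by apply: (h 109); lia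
  |by apply: (h 123); lia|by apply: (h 142); lia|by apply: (h 152); lia|by apply: (h 153); lia
  |by apply: (h 204); lia|by apply: (h 205); lia|by apply: (h 237); lia|by apply: (h 268); lia
  |by apply: (h 278); lia|by apply: (h 289); lia|by apply: (h 311); lia|by apply: (h 363); lia
  |by apply: (h 374); lia|by apply: (h 396); lia|by apply: (h 428); lia].
Qed.

Lemma height_descentV (P R : J) g (d : bool) : P + T *+ g + genV *+ d = R *+ 2 ->
  (height R.1 < height P.1)%N \/ in_span genV P.
Proof.
move=> h.
(* A factor 2 is lost in [leq_height_doubleV] and a factor 32 in the denominator [s^2 - 32 r^2] of
   the translate by [genV]. As [64 < 9^2], heights from 9 on decrease. *)
have hP : (height R.1 ^ 4 <= 64 * height P.1 ^ 2)%N.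
  have [r [s [w [s0 rs hr hw hws]]]] := jac_int R.
  have os := odd_denV rs hws; have sn0 : s != 0 by rewrite gt_eqF.
  have : (height R.1 ^ 4 <= 2 * height (jval (R *+ 2)).1)%N.
    rewrite (@jac_double_height (- 8) 32 _ _ 5 4 r s w) // hr height_coprime //.
    have e x : x ^+ 4 = (`|x|%N)%:Z ^+ 4 :> int.
      by rewrite abszE (exprM `|x| 2 2) real_normK ?num_real // -exprM.
    rewrite !abszM (e s) (e r); apply: leq_height_doubleV.
    have : s ^+ 2 <= `|w|.
      rewrite -ler_sqr ?nnegrE ?sqr_ge0 // real_normK ?num_real // hws -exprM.
      have := sqr_ge0 (r * s); have := sqr_ge0 (r ^+ 2).
      have -> : 2 * -8 * r ^+ 2 * s ^+ 2 = - (16 * (r * s) ^+ 2) by ring.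
      have -> : r ^+ 4 = (r ^+ 2) ^+ 2 by ring.
      by clear; move: (s ^+ (2 * 2)) ((r * s) ^+ 2) ((r ^+ 2) ^+ 2) => *; lia.
    by rewrite -lez_nat abszE -abszX gez0_abs ?sqr_ge0.
  rewrite -h; move: (P + T *+ g) (height_shift P g) => {h hr hw hws os rs s0 sn0} Q <- le.
  apply: (leq_trans le); rewrite -[64%N]/(2 * 32)%N -mulnA leq_pmul2l //.
  case: d {le}; last by rewrite addr0 (leq_trans (leq_sqr _)) ?leq_pmull.
  have {r s w} [r [s [w [s0 rs hr hw hws]]]] := jac_int Q.
  have sn0 : s != 0 by rewrite gt_eqF.
  rewrite mulr1n; have b := height_shift_unit (P0 := genV) (V0 := - 7) sn0 erefl hr hw.
  apply: (leq_trans b); rewrite hr height_coprime //.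
  have := sqr_le_max r s; set m := maxn `|r| `|s| => -[hr2 hs2 hrs].
  have m0 : 0 <= m%:Z ^+ 2 by exact: sqr_ge0.
  have hw3 : `|w| <= 7 * m%:Z ^+ 2.
    apply: norm_le_sqr; first by rewrite mulr_ge0.
    have [r0 s0'] := (sqr_ge0 r, sqr_ge0 s).
    have ss := ler_pM s0' s0' hs2 hs2; have rs' := ler_pM r0 s0' hr2 hs2.
    have rr := ler_pM r0 r0 hr2 hr2.
    have -> : w ^+ 2 = s ^+ 2 * s ^+ 2 + 16 * (r ^+ 2 * s ^+ 2) + 32 * (r ^+ 2 * r ^+ 2).
      by rewrite hws; ring.
    have -> : (7 * m%:Z ^+ 2) ^+ 2 = 49 * (m%:Z ^+ 2 * m%:Z ^+ 2) by ring.
    move: ss rs' rr {hr2 hs2 hrs m0 r0 s0' hws hw hr b}.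
    move: (s ^+ 2 * s ^+ 2) (r ^+ 2 * s ^+ 2) (r ^+ 2 * r ^+ 2) (m%:Z ^+ 2 * m%:Z ^+ 2).
    by move=> X Y Z W; lia.
  rewrite geq_max -!lez_nat !abszE PoszM (_ : (m ^ 2)%N = m%:Z ^+ 2 :> int) //.
  have := sqr_ge0 r; have := sqr_ge0 s; move: hr2 hs2 hrs m0 hw3.
  rewrite -mulrA; clear.
  by move: (r ^+ 2) (s ^+ 2) (m%:Z ^+ 2) (r * s) => X Y Z W *; lia.
have [lt|ge] := ltnP 8 (height P.1); [left|right].
  rewrite ltnNge; apply/negP => le.
  have : (height P.1 ^ 4 <= 64 * height P.1 ^ 2)%N by apply: leq_trans hP; rewrite leq_exp2r.
  have h9 : (9 ^ 2 <= height P.1 ^ 2)%N by rewrite leq_exp2r.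
  rewrite (expnM _ 2 2) -[X in (X <= _)%N]mulnn leq_pmul2r; lia.
have [r [s [w [s0 rs hr hw hws]]]] := jac_int P.
have os := odd_denV rs hws; move: ge; rewrite hr height_coprime ?gt_eqF // geq_max => /andP[r2 s2].
have sn0 : s%:~R != 0 :> rat by rewrite intr_eq0 gt_eqF.
have [r0|r1] := small_pointsV s0 os rs hws r2 s2.
  by apply: in_span_u0; rewrite hr r0 mul0r.
apply: in_span_sqr_u; rewrite hr expr_div_n -!rmorphXn /= r1 divff ?expr1n //.
by rewrite rmorphXn expf_neq0.
Qed.

Lemma MW_EV : MW_Z_Z2 EV (Some (0, 2)).
Proof.
have -> : EV = shifted_weierstrass (- 8)%:~R 8 1.
  by congr Weierstrass; ring.
have -> : Some (0, 2) = jac_weier (- 8)%:~R 1 genV.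
  by rewrite /jac_weier /=; congr (Some (_, _)); field.
apply: (MW_of_jac _ _ nonsq_eV'); [by ring|by []| | | ].
- rewrite -jdual_genV'; apply: jdual_not_double.
    by rewrite (_ : jclass _ = (- 4)%:~R); [exact: nonsquare_intN|rewrite /jclass /=; field].
  rewrite (_ : jclass _ = (- 8)%:~R); first exact: nonsquare_intN.
  by rewrite /jclass jvalDT /=; field.
- move=> R hR; have [k] := jclass_double nonsq_eV' R; rewrite hR.
  rewrite (_ : jclass _ = 32%:~R); last by rewrite /jclass jvalDT /=; field.
  by move/esym/eqP; apply/negP; apply: (@nonsquare_int 32 5).
exact: descent descentV height_descentV.
Qed.

End CurveEV.

(** * The rank 0 curve *)

Section RankZero.

Lemma nonsq_eW : nonsquare ((- 8)%:~R : rat). Proof. exact: nonsquare_intN. Qed.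
Lemma nonsq_eW' : nonsquare (4 * (0%:~R ^+ 2 - (- 8)%:~R) : rat).
Proof. by rewrite (_ : _ * _ = 32%:~R); [exact: (@nonsquare_int 32 5)|ring]. Qed.

Local Notation J := (jac 0%:~R nonsq_eW).
Local Notation J' := (jac (- 2 * 0%:~R) nonsq_eW').
Local Notation T := (jtor 0%:~R nonsq_eW).

(** An obstruction at 2. If [s] is odd, congruences modulo 8 force [x] and [y] to be odd, but [x y]
    is even. If [s] is even, then [x] and [y] are even, so 4 divides [2 r^2] although [r] is odd. *)
Lemma twisted_quartic_unsolvable (r s x y : int) : coprimez r s ->
  s ^+ 2 = 2 * x ^+ 2 - y ^+ 2 -> x * y = 2 * r ^+ 2 -> False.
Proof.
move=> rs h hxy; have [es|os] := boolP (odd `|s|%N); last first.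
  have [k hk] := odd_sqr_mod (coprime_odd rs os); have [z hz] := even_absz os.
  have [t ht] : exists t, y = 2 * t.
    apply: (@even_of_sqr _ (x ^+ 2 - 2 * z ^+ 2)).
    by transitivity (2 * x ^+ 2 - s ^+ 2); [rewrite h|rewrite hz]; ring.
  have [u hu] : exists u, x = 2 * u.
    apply: (@even_of_sqr _ (z ^+ 2 + t ^+ 2)); apply: (@mulfI _ 2) => //.
    by transitivity (s ^+ 2 + y ^+ 2); [rewrite h|rewrite hz ht]; ring.
  have : 4 * (u * t) = 2 * (8 * k + 1) by rewrite -hk -hxy hu ht; ring.
  by move: (u * t); clear; lia.
have [k hk] := odd_sqr_mod es; have [l hl] := sqr_mod x.
have oy : odd `|y|%N.
  apply/negPn/negP => /even_absz[t ht].
  have : 8 * k + 1 = 2 * (x ^+ 2) - 4 * t ^+ 2 by rewrite -hk h ht; ring.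
  by move: (x ^+ 2) (t ^+ 2); clear; lia.
have [m hm] := odd_sqr_mod oy.
have ox : odd `|x|%N.
  apply/negPn/negP => /even_absz[t ht].
  have : 8 * k + 1 = 8 * (t ^+ 2) - (8 * m + 1) by rewrite -hk -hm h ht; ring.
  by move: (t ^+ 2); clear; lia.
have : odd (absz (x * y)%R) by rewrite abszM oddM ox.
by rewrite hxy; move: (r ^+ 2); clear; lia.
Qed.

(** The integers [s^2 + w] and [s^2 - w] have product [- 32 r^4]. If the class is -1 they are
    [- 2 m^2] and [n^2]; if it is 2 they are [n^2] and [- 2 m^2]. In both cases [m n] is [4 r^2] up
    to the choice of signs, and adding gives the equation refuted in [main]. *)
Lemma excluded_classes (a e : rat) (he : nonsquare e) (P : jac a he) :
    a = 0%:~R -> e = 32%:~R ->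
  ~ sq_class (jclass P) true false /\ ~ sq_class (jclass P) false true.
Proof.
move=> ea ee; subst a e; have [r [s [w [s0 rs hr hw hws]]]] := jac_int P.
have sq0 : s%:~R != 0 :> rat by rewrite intr_eq0 gt_eqF.
have -> : jclass P = 2 * (s ^+ 2 + w)%:~R / s%:~R ^+ 2.
  rewrite /jclass hw; move: (P.1) => u; rewrite rmorphD rmorphXn /=; field.
  exact: sq0.
have hN : (s ^+ 2 + w) * (s ^+ 2 - w) = - (32 * r ^+ 4).
  by transitivity (s ^+ 4 - w ^+ 2); [ring|rewrite hws; ring].
have main (m n : int) : m * n = 4 * r ^+ 2 ->
    2 * s ^+ 2 = n ^+ 2 - 2 * m ^+ 2 -> False.
  move=> hmn h2; have [y hy] : exists y, n = 2 * y.
    apply: (@even_of_sqr _ (s ^+ 2 + m ^+ 2)).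
    by transitivity (2 * s ^+ 2 + 2 * m ^+ 2); [rewrite h2|]; ring.
  apply: (@twisted_quartic_unsolvable r s y m) => //; apply: (@mulfI _ 2) => //.
    by rewrite h2 hy; ring.
  by transitivity (m * n); [rewrite hy|rewrite hmn]; ring.
have quot (m X c : int) : m != 0 -> X * m ^+ 2 = (2 * c * r ^+ 2) ^+ 2 ->
    exists2 n : int, m * n = 2 * c * r ^+ 2 & X = n ^+ 2.
  move=> m0 hX; have mq0 : m%:~R != 0 :> rat by rewrite intr_eq0.
  have hq : (2 * c%:~R * r%:~R ^+ 2 / m%:~R) ^+ 2 = X%:~R :> rat.
    apply: (mulIf (expf_neq0 2 mq0)).
    transitivity ((X * m ^+ 2)%:~R : rat); last by rewrite rmorphM rmorphXn.
    by rewrite hX; field.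
  have [n hn] := rat_sqrt_int hq; exists n; apply: (@intr_inj rat).
    by transitivity (m%:~R * n%:~R : rat); [exact: rmorphM|rewrite -hn; field].
  by rewrite rmorphXn /= -hn hq.
have sqint (k c : rat) (X : int) : 2 * (s ^+ 2 + w)%:~R / s%:~R ^+ 2 = c * k ^+ 2 -> c != 0 -> X%:~R = 2 * (s ^+ 2 + w)%:~R / c ->
    exists m : int, k * s%:~R = m%:~R /\ m ^+ 2 = X.
  move=> hk c0 hX; have hm : (k * s%:~R) ^+ 2 = X%:~R.
    rewrite hX; apply: (mulfI c0); rewrite exprMn mulrA -hk; field.
    by rewrite c0 sq0.
  have [m hm1] := rat_sqrt_int hm; exists m; split=> //.
  by apply: (@intr_inj rat); rewrite rmorphXn /= -hm1 hm.
split=> -[k [k0]]; rewrite ?expr0 ?expr1 => hk.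
  have [] := sqint k _ (- (2 * (s ^+ 2 + w))) hk; first by [].
    by rewrite rmorphN rmorphM /=; field.
  move=> m1 [hm hm1]; have m10 : m1 != 0 by rewrite -(intr_eq0 rat) -hm mulf_neq0.
  have [m em] : exists m, m1 = 2 * m.
    by apply: (@even_of_sqr _ (- (s ^+ 2 + w))); rewrite hm1; ring.
  have m0 : m != 0 by apply: contra_neq m10 => m0; rewrite em m0.
  have e1 : s ^+ 2 + w = - (2 * m ^+ 2).
    apply: (@mulfI _ (- 2)) => //; transitivity (m1 ^+ 2); first by rewrite hm1; ring.
    by rewrite em; ring.
  have [|n hmn hn] := quot m (s ^+ 2 - w) 2 m0.
    apply: (@mulfI _ (- 2)) => //; transitivity ((s ^+ 2 + w) * (s ^+ 2 - w)).
      by rewrite e1; ring.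
    by rewrite hN; ring.
  by apply: (main m n hmn); rewrite -hn -[2 * m ^+ 2]opprK -e1; ring.
have [] := sqint k _ (s ^+ 2 + w) hk; first by [].
  by field.
move=> n [hn hn2]; have n0 : n != 0 by rewrite -(intr_eq0 rat) -hn mulf_neq0.
have [|q1 hq1 hX] := quot n (- 2 * (s ^+ 2 - w)) 4 n0.
  by transitivity (- 2 * ((s ^+ 2 + w) * (s ^+ 2 - w))); [rewrite hn2|rewrite hN]; ring.
have [q hq] : exists q, q1 = 2 * q.
  by apply: (@even_of_sqr _ (- (s ^+ 2 - w))); rewrite -hX; ring.
apply: (main q n).
  by apply: (@mulfI _ 2) => //; transitivity (n * q1); [rewrite hq|rewrite hq1]; ring.
apply: (@mulfI _ 2) => //; transitivity (2 * n ^+ 2 - q1 ^+ 2); last by rewrite hq; ring.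
by rewrite -hX hn2; ring.
Qed.

(** On the isogenous quartic, with parameters 0 and 32, [a^2 - e = -2 * 4^2]: translation by the
    2-torsion point exchanges the classes 1 and -2, and the other two are excluded. Hence
    [double_descent] applies with [0] as the additional point, and the rank is 0. *)
Lemma descentW (P : J) : exists g (d : bool) R, P + T *+ g + 0 *+ d = R *+ 2.
Proof.
have jdual0 : jdual nonsq_eW (0 : J') = 0.
  by apply: val_inj => /=; congr (_, _); field; rewrite ?oner_neq0.
rewrite -jdual0; apply: (@double_descent _ _ _ nonsq_eW nonsq_eW') => {}P.
  exact: (@jclass_square_or_shift _ _ _ 3 2).
have c0 : jclass (0 : J') = 2 ^+ 2 by rewrite /jclass /=; ring.
have [->|PT] := eqVneq P (jtor _ nonsq_eW').
  exists 1%N, false, 2; split=> //; rewrite -c0; congr (jclass _).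
have zg g : P + jtor _ nonsq_eW' *+ g + 0 *+ false = P + jtor _ nonsq_eW' *+ g.
  exact: addr0.
have z0 : P + jtor _ nonsq_eW' *+ 0 + 0 *+ false = P by rewrite zg; exact: addr0.
have [e0|P0] := eqVneq P 0.
  by exists 0%N, false, 2; split; [|rewrite z0 e0 c0].
have u0 : P.1 != 0.
  by apply/eqP => /jac_u_eq0[] h; [rewrite h eqxx in P0|rewrite h eqxx in PT].
have ea : - 2 * 0%:~R = 0%:~R :> rat by ring.
have ee : 4 * (0%:~R ^+ 2 - (- 8)%:~R) = 32%:~R :> rat by ring.
have [nF nT] := excluded_classes P ea ee.
have [[] [[] hP]] := @jclass_pow2_rat _ _ nonsq_eW' 0 32 5 ea ee erefl P PT.
- have [||k [k0 hk]] := @sq_class_jclassDT _ _ nonsq_eW' P 4 true true true true u0 _ _ hP.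
  + by [].
  + by rewrite ea ee expr1; ring.
  by exists 1%N, false, k; split; [|rewrite (zg 1%N) hk expr0 !mul1r].
- by case: nF.
- by case: nT.
have [k [k0 hk]] := hP.
by exists 0%N, false, k; split; [|rewrite z0 hk expr0 !mul1r].
Qed.

Lemma odd_denW (r s w : int) : coprimez r s ->
  w ^+ 2 = s ^+ 4 - 2 * 0 * r ^+ 2 * s ^+ 2 + (- 8) * r ^+ 4 -> odd `|s|.
Proof.
move=> rs h; apply/negPn/negP => es.
have [x hx] := even_absz es; have [k hk] := odd_sqr_mod (coprime_odd rs es).
have [y hy] : exists y, w = 2 * y.
  apply: (@even_of_sqr _ (8 * x ^+ 4 - 4 * r ^+ 4)).
  by rewrite h hx; ring.
have : 4 * y ^+ 2 = 16 * x ^+ 4 - 8 * (64 * k ^+ 2 + 16 * k + 1).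
  have -> : 64 * k ^+ 2 + 16 * k + 1 = (r ^+ 2) ^+ 2 by rewrite hk; ring.
  by transitivity (w ^+ 2); [rewrite hy|rewrite h hx]; ring.
have [l hl] := sqr_mod y.
by move: hl; move: (x ^+ 4) (k ^+ 2) (y ^+ 2); clear => X K Z [->|->]; lia.
Qed.

Lemma jacW_u_eq0 (P : J) : P.1 = 0.
Proof.
have [n [k ->]] : in_span 0 P; last first.
  rewrite mul0rz add0r jtor_muln.
  by case: (odd k).
apply: descent descentW _ P => P R g d h.
have hP : (height R.1 ^ 4 <= height P.1)%N.
  have [r [s [w [s0 rs hr hw hws]]]] := jac_int R.
  have os := odd_denW rs hws; have sn0 : s != 0 by rewrite gt_eqF.
  rewrite -(height_shift P g) -[P + _]addr0 -[X in _ + X](mul0rn _ d) h.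
  rewrite (@jac_double_height 0 (- 8) _ _ 3 2 r s w) // hr height_coprime //.
  by rewrite leq_max (absz_pow4D r s 8) leq_max_pow4 ?orbT.
have [lt|ge] := ltnP 1 (height P.1); [left|right].
  rewrite ltnNge; apply/negP => le.
  have : (height P.1 ^ 4 <= height P.1)%N by apply: leq_trans hP; rewrite leq_exp2r.
  by rewrite -{2}[height _]expn1 leq_exp2l.
have [r [s [w [s0 rs hr hw hws]]]] := jac_int P.
move: ge; rewrite hr height_coprime ?gt_eqF // geq_max => /andP[r1 s1].
have es : s = 1 by move: s0 s1; clear; lia.
apply: in_span_u0; rewrite hr; suff -> : r = 0 by rewrite mul0r.
apply/eqP/negPn/negP => r0.
have r2 : r ^+ 2 = 1.
  have : (r == 1) || (r == -1) by move: r0 r1; clear; lia.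
  by case/orP => /eqP ->.
have := sqr_ge0 w; rewrite hws es; have -> : r ^+ 4 = (r ^+ 2) ^+ 2 by ring.
by rewrite r2.
Qed.

Lemma cubic_no_square (n y : rat) : y ^+ 2 = n * (n ^+ 2 + 2) -> n = 0.
Proof.
move=> h; apply/eqP/negPn/negP => n0.
have e8 : (- 8)%:~R = 0%:~R ^+ 2 - 4 * 2 :> rat by ring.
have on : short_on 0%:~R 2 (n, y) by rewrite /short_on /= h; ring.
have y0 : y != 0 by apply: contra_neq n0 => /(short_y_eq0 e8 nonsq_eW on).
have /= := jacW_u_eq0 (Jac nonsq_eW (short_jac_on e8 nonsq_eW on)).
rewrite /short_jac /= (negPf n0) /= => /eqP.
by rewrite mulf_eq0 invr_eq0 (negPf n0) (negPf y0).
Qed.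

End RankZero.

Local Open Scope classical_set_scope.
Local Open Scope ring_scope.
Local Open Scope complex_scope.

(** * Coordinates in Q(zeta8) *)

Arguments zeta : simpl never.
Arguments expi : simpl never.
Arguments conjc : simpl never.

Section Expi.
Variable R : realType.

Lemma expiD (s t : R) : expi (s + t) = expi s * expi t.
Proof. by rewrite /expi cosD sinD; simpc; rewrite [sin s * cos t + _]addrC. Qed.

Lemma expi0 : expi (0 : R) = 1. Proof. by rewrite /expi cos0 sin0. Qed.

Lemma expiMn (t : R) n : expi t ^+ n = expi (t *+ n).
Proof. by elim: n => [|n IHn]; rewrite ?expr0 ?mulr0n ?expi0 // exprS mulrS IHn expiD. Qed.

Lemma conjc_expi (t : R) : conjc (expi t) = expi (- t).
Proof. by rewrite /expi cosN sinN. Qed.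

Lemma expi_neq0 (t : R) : expi t != 0.
Proof.
apply/eqP => h; have := expiD t (- t); rewrite subrr expi0 h mul0r => /eqP.
by rewrite oner_eq0.
Qed.

Lemma expiV (t : R) : (expi t)^-1 = expi (- t).
Proof. by apply: (mulfI (expi_neq0 t)); rewrite divff ?expi_neq0 // -expiD subrr expi0. Qed.

Lemma expi_pi : expi (pi : R) = -1.
Proof. by rewrite /expi cospi sinpi; apply/eqP; rewrite eq_complex /= oppr0 !eqxx. Qed.

Lemma zetaXn n : (0 < n)%N -> zeta R n ^+ n = 1.
Proof.
move=> n0; rewrite expiMn -[_ *+ n]mulr_natr divfK ?pnatr_eq0 -?lt0n //.
by rewrite mulr_natl mulr2n expiD expi_pi mulrNN mulr1.
Qed.

End Expi.

Section Zeta8.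
Variable R : realType.
Local Notation z := (zeta R 8).

Lemma zeta8E : z = expi (pi / 4).
Proof. by rewrite /zeta; congr expi; field. Qed.

Lemma zeta8_4 : z ^+ 4 = -1.
Proof. by rewrite zeta8E expiMn -expi_pi -[_ *+ 4]mulr_natr divfK ?pnatr_eq0. Qed.

Lemma zeta8_neq0 : z != 0. Proof. exact: expi_neq0. Qed.

Lemma conj_zeta8 : conjc z = - z ^+ 3.
Proof.
apply: (mulfI zeta8_neq0); rewrite /zeta conjc_expi -expiD subrr expi0.
by rewrite -/(zeta R 8) mulrN -exprS zeta8_4 opprK.
Qed.

Lemma zeta8_sqr : z ^+ 2 = 'i%C.
Proof.
rewrite zeta8E expiMn; have -> : (pi / 4) *+ 2 = pi / 2 :> R by field.
by rewrite /expi cos_pihalf sin_pihalf.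
Qed.

Lemma zeta8_ReIm : exists h : R, [/\ 0 < h, 2 * h ^+ 2 = 1 & z = h +i* h].
Proof.
exists (cos (pi / 4)); have c0 : 0 < cos (pi / 4 : R).
  by apply: cos_gt0_pihalf; have := pi_gt0 R; move=> p0; apply/andP; split; lra.
have /eqP := zeta8_sqr; rewrite zeta8E /expi expr2 => /eqP; simpc => -[re im].
have e : cos (pi / 4 : R) = sin (pi / 4).
  apply/eqP; have /eqP : cos (pi / 4) ^+ 2 = sin (pi / 4) ^+ 2 :> R.
    by apply/eqP; rewrite -subr_eq0 !expr2 re.
  rewrite eqf_sqr => /orP[//|/eqP e]; exfalso; move: im; rewrite e.
  have : 0 <= sin (pi / 4 : R) ^+ 2 by exact: sqr_ge0.
  by rewrite expr2; lra.
by split=> //; [rewrite -e in im; rewrite expr2; lra | rewrite -e].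
Qed.

Lemma ratr_complex (q : rat) : ratr q = (ratr q : R)%:C.
Proof. by rewrite -(fmorph_rat (real_complex R)). Qed.

Lemma conj_ratr (q : rat) : conjc (ratr q : R[i]) = ratr q.
Proof. by rewrite (fmorph_rat (conjc : {rmorphism R[i] -> R[i]})). Qed.

Definition q4 (a b c d : rat) : R[i] :=
  ratr a + ratr b * z + ratr c * z ^+ 2 + ratr d * z ^+ 3.

(** Real and imaginary parts have the form [s + t h] with [s], [t] rational and [2 h^2 = 1], and [h]
    is irrational. *)
Lemma q4_eq0 a b c d : q4 a b c d = 0 -> [/\ a = 0, b = 0, c = 0 & d = 0].
Proof.
have [h [h0 hh zE]] := zeta8_ReIm.
have irr (s t : rat) : (ratr s : R) + ratr t * h = 0 -> s = 0 /\ t = 0.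
  move=> e; have t0 : t = 0.
    have es : ratr s = - (ratr t * h) :> R by apply/eqP; rewrite -addr_eq0 e.
    have e2 : 2 * s ^+ 2 = t ^+ 2.
      apply: (@fmorph_inj _ _ (ratr : {rmorphism rat -> R})).
      rewrite rmorphM !rmorphXn /= es rmorph_nat sqrrN exprMn mulrCA hh mulr1 //.
    have [s0|s0] := eqVneq s 0.
      by move: e2; rewrite s0 expr0n mulr0 => /esym/eqP; rewrite expf_eq0 => /eqP.
    by have /eqP[] := @nonsquare2 (t / s); rewrite expr_div_n -e2 mulfK ?expf_neq0.
  by move: e; rewrite t0 rmorph0 mul0r addr0 => /eqP; rewrite fmorph_eq0 => /eqP ->.
rewrite /q4 [z ^+ 3]exprSr zeta8_sqr zE !ratr_complex; simpc => /eqP; rewrite eq_complex /=.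
move=> /andP[/eqP re /eqP im].
have [|a0 bd] := irr a (b - d); first by rewrite rmorphB mulrBl addrA.
have [|c0 bd'] := irr c (b + d); first by rewrite rmorphD mulrDl addrCA addrA.
by split=> //; lra.
Qed.

Lemma q4B a b c d a' b' c' d' :
  q4 a b c d - q4 a' b' c' d' = q4 (a - a') (b - b') (c - c') (d - d').
Proof. by rewrite /q4 !rmorphB; ring. Qed.

Lemma q4_inj a b c d a' b' c' d' : q4 a b c d = q4 a' b' c' d' ->
  [/\ a = a', b = b', c = c' & d = d'].
Proof.
move=> /eqP; rewrite -subr_eq0 q4B => /eqP /q4_eq0[/eqP + /eqP + /eqP + /eqP].
by rewrite !subr_eq0 => /eqP -> /eqP -> /eqP -> /eqP ->.
Qed.

Lemma conj_ratrM (q : rat) (x : R[i]) : conjc (ratr q * x) = ratr q * conjc x.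
Proof. by rewrite -[X in _ = X * _]conj_ratr; exact: (rmorphM (conjc : {rmorphism R[i] -> R[i]})). Qed.

Lemma tauE l m : tau R l m = q4 m m l (- l).
Proof. by rewrite /tau /q4 rmorphN; ring. Qed.

Lemma conj_tauE l m : conjc (tau R l m) = q4 m l (- l) (- m).
Proof.
have hz := zeta8_4; rewrite /tau rmorphD /= !conj_ratrM rmorphB rmorphD rmorph1 !rmorphXn /=.
by rewrite conj_zeta8 /q4 !rmorphN; ring: hz.
Qed.

Definition vec (l m x y : rat) : R[i] := ratr x + ratr y * tau R l m.

Lemma conj_vec l m x y : conjc (vec l m x y) = ratr x + ratr y * q4 m l (- l) (- m).
Proof. by rewrite /vec rmorphD /= conj_ratrM conj_ratr conj_tauE. Qed.

Lemma conj_q4 a b c d : conjc (q4 a b c d) = q4 a (- d) (- c) (- b).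
Proof.
have hz := zeta8_4; rewrite /q4 !rmorphD /= !conj_ratrM conj_ratr !rmorphXn /=.
by rewrite conj_zeta8 !rmorphN; ring: hz.
Qed.

Lemma zeta8M_q4 a b c d : z * q4 a b c d = q4 (- d) a b c.
Proof. by have hz := zeta8_4; rewrite /q4 !rmorphN; ring: hz. Qed.

Lemma zeta8M2_q4 a b c d : z ^+ 2 * q4 a b c d = q4 (- c) (- d) a b.
Proof. by have hz := zeta8_4; rewrite /q4 !rmorphN; ring: hz. Qed.

Lemma zeta8M3_q4 a b c d : z ^+ 3 * q4 a b c d = q4 (- b) (- c) (- d) a.
Proof. by have hz := zeta8_4; rewrite /q4 !rmorphN; ring: hz. Qed.

Lemma zeta8M4_q4 a b c d : z ^+ 4 * q4 a b c d = q4 (- a) (- b) (- c) (- d).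
Proof. by have hz := zeta8_4; rewrite /q4 !rmorphN; ring: hz. Qed.

Section Vec.
Variables l m : rat.
Local Notation p := (l ^+ 2 + m ^+ 2).
Local Notation r := (l ^+ 2 - 2 * l * m - m ^+ 2).

Lemma vec_mul_conj x1 y1 x2 y2 :
  vec l m x1 y1 * conjc (vec l m x2 y2) =
  q4 (x1 * x2 + (x2 * y1 + x1 * y2) * m + 2 * p * (y1 * y2))
     (x2 * y1 * m + x1 * y2 * l - r * (y1 * y2))
     ((x2 * y1 - x1 * y2) * l)
     (- (x2 * y1 * l) - x1 * y2 * m + r * (y1 * y2)).
Proof.
have hz := zeta8_4; rewrite conj_vec /vec tauE /q4; ring: hz.
Qed.

Lemma conj_vec_mul_conj x1 y1 x2 y2 :
  conjc (vec l m x1 y1 * conjc (vec l m x2 y2)) = vec l m x2 y2 * conjc (vec l m x1 y1).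
Proof. by rewrite rmorphM /= conjcK mulrC. Qed.

(* The two rational equations expressing that
   [v1 * conj v2 = zeta8 ^+ k * conj (v1 * conj v2)]. *)
Definition angle_eqs (k : nat) (x1 y1 x2 y2 : rat) : Prop :=
  match k with
  | 0 => x2 * y1 = x1 * y2
  | 1 => x1 * y2 * (l + m) = r * (y1 * y2) /\
         x1 * x2 + x1 * y2 * (m - l) + (2 * p + r) * (y1 * y2) = 0
  | 2 => x2 * y1 * l + x1 * y2 * m = r * (y1 * y2) /\
         x1 * x2 + x2 * y1 * (m - l) + x1 * y2 * (m + l) + 2 * p * (y1 * y2) = 0
  | 3 => x2 * y1 * (m - l) + 2 * (x1 * y2) * l = r * (y1 * y2) /\
         x1 * x2 + x2 * y1 * (m + l) + 2 * (x1 * y2) * m + (2 * p - r) * (y1 * y2) = 0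
  | _ => (x2 * y1 + x1 * y2) * (l + m) = 2 * r * (y1 * y2) /\
         x1 * x2 + (x2 * y1 + x1 * y2) * m + 2 * p * (y1 * y2) = 0
  end.

Lemma angle_eqsP k x1 y1 x2 y2 : (k <= 4)%N -> l != 0 \/ m != 0 ->
  (vec l m x1 y1 * conjc (vec l m x2 y2)
    = z ^+ k * (vec l m x2 y2 * conjc (vec l m x1 y1)))
  <-> angle_eqs k x1 y1 x2 y2.
Proof.
move=> k4 lm; rewrite -conj_vec_mul_conj vec_mul_conj conj_q4.
case: k k4 => [|[|[|[|[|//]]]]] _.
- rewrite expr0 mul1r /=; split=> [/q4_inj[_ h1 h2 _]|h]; last first.
    by rewrite h; congr q4; ring.
  have {}h2 : (x2 * y1 - x1 * y2) * l = 0 by lra.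
  have {}h1 : (x2 * y1 - x1 * y2) * m = 0 by lra.
  apply/eqP; rewrite -subr_eq0; case: lm => nz.
    by rewrite -(mulIr_eq0 _ (mulIf nz)) h2.
  by rewrite -(mulIr_eq0 _ (mulIf nz)) h1.
- rewrite expr1 zeta8M_q4 /=; split=> [/q4_inj[] *|[h1 h2]]; first by split; lra.
  by congr q4; lra.
- rewrite zeta8M2_q4 /=; split=> [/q4_inj[] *|[h1 h2]]; first by split; lra.
  by congr q4; lra.
- rewrite zeta8M3_q4 /=; split=> [/q4_inj[] *|[h1 h2]]; first by split; lra.
  by congr q4; lra.
rewrite zeta8M4_q4 /=; split=> [/q4_inj[] *|[h1 h2]]; first by split; lra.
by congr q4; lra.
Qed.

End Vec.

End Zeta8.

(** * Rational angles in terms of complex conjugation *)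

Section Angles.
Variable R : realType.
Local Notation C := R[i].
Implicit Types (v w : C) (V : set C).
Local Notation z := (zeta R 8).

Lemma conjcM v w : conjc (v * w) = conjc v * conjc w.
Proof. exact: (rmorphM (conjc : {rmorphism C -> C})). Qed.

Lemma conjcV v : conjc v^-1 = (conjc v)^-1.
Proof. exact: (fmorphV (conjc : {rmorphism C -> C})). Qed.

Lemma mul_conjc v : exists2 t : R, 0 <= t & v * conjc v = t%:C.
Proof.
case: v => a b; exists (a ^+ 2 + b ^+ 2); first by rewrite addr_ge0 ?sqr_ge0.
by rewrite /conjc; simpc; rewrite !expr2 [b * a]mulrC addNr.
Qed.

Lemma mul_conjc_gt0 v : v != 0 -> exists2 t : R, 0 < t & v * conjc v = t%:C.
Proof.
move=> v0; have [t t0 e] := mul_conjc v; exists t => //.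
rewrite lt_neqAle t0 andbT eq_sym; apply: contra_neq v0 => t1.
by move: e; rewrite t1 => /eqP; rewrite mulf_eq0 conjc_eq0 orbb => /eqP.
Qed.

Lemma conjc_eq_real v : conjc v = v -> exists x : R, v = x%:C.
Proof.
case: v => a b; rewrite /conjc => -[/eqP]; rewrite eq_sym -subr_eq0 opprK -mulr2n mulrn_eq0 /= => /eqP ->.
by exists a.
Qed.

Lemma conjc_unity_root (nu : C) n : (0 < n)%N -> nu ^+ n = 1 -> conjc nu = nu^-1.
Proof.
move=> n0 h; have nu0 : nu != 0.
  by apply: contra_eq_neq h => ->; rewrite expr0n eqn0Ngt n0 /= eq_sym oner_eq0.
apply: (mulfI nu0); rewrite divff //; have [t t0 e] := mul_conjc nu; rewrite e.
suff -> : t = 1 by [].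
have : t ^+ n = 1.
  apply: (@complexI R); rewrite rmorphXn /= -e exprMn h mul1r -rmorphXn /= h.
  exact: rmorph1.
by move/eqP; rewrite pexpr_eq1 // => /eqP.
Qed.

Lemma R_independentP v w : R_independent v w <-> v * conjc w != w * conjc v.
Proof.
split=> [ind|/eqP ne a b e].
  apply/eqP => e; have [w0|w0] := eqVneq w 0.
    have [|_ /eqP] := ind 0 1; first by rewrite w0 mulr0 mul0r addr0.
    by rewrite oner_eq0.
  have [t t0 et] := mul_conjc_gt0 w0.
  have [x ex] : exists x : R, v * conjc w = x%:C.
    by apply: conjc_eq_real; rewrite conjcM conjcK mulrC -e.
  have [|/eqP] := ind t (- x); last by rewrite gt_eqF.
  by rewrite -et rmorphN /= -ex; ring.
have [a0|a0] := eqVneq a 0.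
  move: e; rewrite a0 mul0r add0r => /eqP; rewrite mulf_eq0 => /orP[/eqP[->] //|/eqP w0].
  by case: ne; rewrite w0 conjc0 mulr0 mul0r.
case: ne; have ac0 : a%:C != 0 by rewrite -(inj_eq (@complexI R)) in a0.
have -> : v = - (b%:C / a%:C) * w.
  by apply: (mulfI ac0); rewrite -[LHS](addrK (b%:C * w)) e; field.
by rewrite conjcM rmorphN /= conjcM conjcV /= !conjc_real; ring.
Qed.

(** The quotient of [v * conjc w] by its conjugate is [expi (2 q pi)], a root of unity whose order
    divides the denominator of [q]. *)
Lemma rational_angle_unity V v w : rational_angle V v w ->
  exists2 n, (0 < n)%N & (v * conjc w) ^+ n = (w * conjc v) ^+ n.
Proof.
move=> [_ _ ind [r [q [r0 e]]]].
have w0 : w != 0.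
  by apply/eqP => w0; move/R_independentP: ind; rewrite w0 conjc0 mulr0 mul0r eqxx.
have ev : v = r%:C * expi (ratr q * pi) * w by rewrite -e divfK.
have d0 : (0 < `|denq q|)%N by rewrite absz_gt0 denq_neq0.
exists `|denq q|%N => //; rewrite ev !conjcM conjc_real conjc_expi !exprMn.
have -> : expi (ratr q * pi : R) ^+ `|denq q| = expi (- (ratr q * pi)) ^+ `|denq q|.
  have -> : expi (ratr q * pi : R) = expi (- (ratr q * pi)) * expi (2 * (ratr q * pi)).
    by rewrite -expiD; congr expi; ring.
  rewrite exprMn -[RHS]mulr1; congr (_ * _); rewrite expiMn.
  have -> : 2 * (ratr q * pi) *+ `|denq q| = (2 * pi) * (numq q)%:~R :> R.
    rewrite -mulr_natr natr_absz normr_denq /ratr; field.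
    by rewrite intr_eq0 denq_neq0.
  have e1 : expi (2 * pi : R) = 1 by rewrite -[LHS]expr1 -(zetaXn R (n := 1)) // /zeta divr1.
  case: (numq q) => n.
    by rewrite -[n%:~R]/(n%:R) mulr_natr -expiMn e1 expr1n.
  by rewrite NegzE mulrNz mulrN -conjc_expi -[_%:~R]/(n.+1%:R) mulr_natr -expiMn e1 expr1n conjc1.
ring.
Qed.

Lemma sqamp_of_conj V v w (t : rat) (nu : C) n : V v -> V w -> R_independent v w ->
    nu = expi (ratr t * pi) -> (0 < n)%N -> nu ^+ n = 1 ->
    nu ^+ 2 * (v * conjc w) = w * conjc v ->
  rational_angle V v w /\ exists x : R, nu * v / w = x%:C.
Proof.
move=> Vv Vw ind enu n0 nun e.
have w0 : w != 0.
  by apply/eqP => w0; move/R_independentP: ind; rewrite w0 conjc0 mulr0 mul0r eqxx.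
have nu0 : nu != 0 by rewrite enu expi_neq0.
have cn : conjc nu = nu^-1 := conjc_unity_root n0 nun.
have [x ex] : exists x : R, nu * v / w = x%:C.
  apply: conjc_eq_real; rewrite !conjcM conjcV cn.
  have cw0 : conjc w != 0 by rewrite conjc_eq0.
  apply: (mulIf (mulf_neq0 w0 cw0)); transitivity (nu^-1 * (w * conjc v)); first by field; rewrite ?nu0 ?w0 ?cw0.
  by rewrite -e; field; rewrite ?nu0 ?w0 ?cw0.
split; last by exists x.
have x0 : x != 0.
  apply/eqP => x0; move: ex; rewrite x0 => /eqP; rewrite !mulf_eq0 invr_eq0 (negPf nu0) (negPf w0) /=.
  rewrite orbF => /eqP v0; move/R_independentP: ind.
  by rewrite v0 conjc0 mulr0 mul0r eqxx.
split=> //; have evw : v / w = x%:C * nu^-1 by rewrite -ex; field; rewrite ?nu0 ?w0 ?cw0.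
(* [rational_angle] asks for a positive factor; when [x] is negative, [pi] is added to the
   argument. *)
have [xp|xn] := ltP 0 x.
  exists x, (- t); split=> //; rewrite evw enu expiV; congr (_ * expi _).
  by rewrite rmorphN mulNr.
exists (- x), (1 - t); split; first by rewrite oppr_gt0 lt_neqAle x0.
rewrite evw enu expiV rmorphB rmorph1 mulrBl mul1r expiD expi_pi rmorphN /=.
by rewrite mulN1r mulrNN.
Qed.

Lemma angle_sqampP V v w k : V v -> V w -> R_independent v w ->
  angle_sqamp V (z ^+ k) v w <->
  v * conjc w = z ^+ k * (w * conjc v) \/ w * conjc v = z ^+ k * (v * conjc w).
Proof.
move=> Vv Vw ind; have w0 : w != 0.
  by apply/eqP => w0; move/R_independentP: ind; rewrite w0 conjc0 mulr0 mul0r eqxx.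
have cw0 : conjc w != 0 by rewrite conjc_eq0.
have z0 : z != 0 by exact: zeta8_neq0.
split=> [[_ [nu [[n n0 nun] [x ex] enu]]]|e].
  have cn := conjc_unity_root n0 nun.
  have nu0 : nu != 0.
    by apply: contra_eq_neq nun => ->; rewrite expr0n eqn0Ngt n0 /= eq_sym oner_eq0.
  have {ex} e : nu ^+ 2 * (v * conjc w) = w * conjc v.
    have : conjc (nu * v / w) = nu * v / w by rewrite ex conjc_real.
    rewrite !conjcM conjcV cn => e2.
    transitivity (nu * w * conjc w * (nu * v / w)); first by field; rewrite ?nu0 ?w0 ?cw0.
    by rewrite -e2; field; rewrite ?nu0 ?w0 ?cw0.
  case: enu => enu; [right|left]; rewrite -e enu //.
  by rewrite mulrA divff ?mul1r // expf_neq0.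
have hz n : z ^+ n = expi (ratr n%:R * pi / 4).
  by rewrite zeta8E expiMn -mulr_natr ratr_nat; congr expi; ring.
have h2 (t : R) : expi t ^+ 2 = expi (2 * t) by rewrite expiMn; congr expi; ring.
(* [expi (k pi / 8)] is a square root of [zeta8 ^ k], hence a 16th root of unity; its inverse serves
   for the other alternative. *)
pose t : rat := k%:R / 8.
have ht : expi (ratr t * pi : R) ^+ 2 = z ^+ k.
  by rewrite hz h2 /t rmorphM fmorphV /= !rmorph_nat; congr expi; field.
have h16 (nu : C) : nu ^+ 2 = z ^+ k -> nu ^+ 16 = 1.
  by rewrite (exprM nu 2 8) => ->; rewrite -exprM mulnC exprM (exprM z 4 2) zeta8_4 sqrrN !expr1n.
case: e => e.
  have hnu : (expi (ratr (- t) * pi) : C) = (expi (ratr t * pi))^-1.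
    by rewrite expiV rmorphN mulNr.
  have nu16 : (expi (ratr (- t) * pi) : C) ^+ 16 = 1.
    by rewrite hnu exprVn h16 // invr1.
  have [] := @sqamp_of_conj V v w (- t) _ 16 Vv Vw ind erefl isT nu16.
    by rewrite hnu exprVn ht e mulKf // expf_neq0.
  move=> ra hx; split=> //; exists (expi (ratr (- t) * pi)); split=> //.
    by exists 16%N.
  by right; rewrite hnu exprVn ht.
have nu16 := h16 _ ht.
have [] := @sqamp_of_conj V v w t _ 16 Vv Vw ind erefl isT nu16.
  by rewrite ht e.
move=> ra hx; split=> //; exists (expi (ratr t * pi)); split=> //; last by left.
by exists 16%N.
Qed.

End Angles.

(** * Binary quadratic forms and the solution of the angle equations *)

Section Forms.
Variables l m : rat.
Hypothesis lm : l != 0 \/ m != 0.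

(** A zero gives [(l - m)^2 = 2 m^2], and 2 is not a rational square. *)
Lemma form_r_neq0 : l ^+ 2 - 2 * l * m - m ^+ 2 != 0.
Proof.
apply/eqP => h; have [m0|m0] := eqVneq m 0.
  move: h lm; rewrite m0 mulr0 expr0n /= !subr0 => /eqP; rewrite expf_eq0 /= => /eqP ->.
  by rewrite eqxx => -[].
have /eqP[] := @nonsquare2 ((l - m) / m); rewrite expr_div_n.
have -> : (l - m) ^+ 2 = 2 * m ^+ 2 by lra.
by rewrite mulfK ?expf_neq0.
Qed.

Lemma form_q_neq0 : l ^+ 2 + 2 * l * m - m ^+ 2 != 0.
Proof.
apply/eqP => h; have [m0|m0] := eqVneq m 0.
  move: h lm; rewrite m0 mulr0 expr0n /= addr0 subr0 => /eqP; rewrite expf_eq0 /= => /eqP ->.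
  by rewrite eqxx => -[].
have /eqP[] := @nonsquare2 ((l + m) / m); rewrite expr_div_n.
have -> : (l + m) ^+ 2 = 2 * m ^+ 2 by lra.
by rewrite mulfK ?expf_neq0.
Qed.

Lemma form_p_gt0 : 0 < l ^+ 2 + m ^+ 2.
Proof.
have [l2 m2] := (sqr_ge0 l, sqr_ge0 m).
rewrite lt_neqAle addr_ge0 // andbT eq_sym paddr_eq0 // !expf_eq0 /=.
by rewrite negb_and; apply/orP.
Qed.

(** The form is [2 p + q = (l + m)^2 + 2 l^2], where [p = l^2 + m^2] and [q = l^2 + 2 l m - m^2]. *)
Lemma form_2pq_gt0 : 0 < 3 * l ^+ 2 + 2 * l * m + m ^+ 2.
Proof.
have [l2 m2] := (sqr_ge0 (l + m), sqr_ge0 l).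
have [l0|l0] := eqVneq l 0; first by have := form_p_gt0; rewrite l0; lra.
have : 0 < l ^+ 2 by rewrite exprn_even_gt0.
lra.
Qed.

End Forms.

Lemma pair_neq0 (F : fieldType) (l m : F) : (l, m) != (0, 0) -> l != 0 \/ m != 0.
Proof. by rewrite -pair_eqE /pair_eq negb_and => /orP. Qed.

Section SolveAngles.
Variables l m : rat.
Local Notation p := (l ^+ 2 + m ^+ 2).
Local Notation r := (l ^+ 2 - 2 * l * m - m ^+ 2).
Local Notation eqs := (angle_eqs l m).

Lemma angle_eqs_scale k s t y1 y2 : y1 != 0 -> y2 != 0 ->
  eqs k (s * y1) y1 (t * y2) y2 <-> eqs k s 1 t 1.
Proof.
move=> y10 y20; have n0 := mulf_neq0 y10 y20.
have red (A B A' B' : rat) : A' = A * (y1 * y2) -> B' = B * (y1 * y2) -> (A' = B') <-> (A = B).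
  by move=> -> ->; split=> [/(mulIf n0)|->].
have andE (P Q P' Q' : Prop) : (P <-> P') -> (Q <-> Q') -> (P /\ Q <-> P' /\ Q') by tauto.
by case: k => [|[|[|[|k]]]] /=; [apply: red; ring|..]; apply: andE; apply: red; ring.
Qed.

(** If [y1] or [y2] vanishes, the first equation reduces to the vanishing of [x1 * y2] or [x2 * y1]
    times one of [m], [2 l], [l + m], [l], [m - l]. The zeros of these factors are the four
    exceptional points. *)
Lemma angle_eqs_indep_y k x1 y1 x2 y2 : [\/ k = 2, k = 3 | k = 4] ->
    l != 0 -> m != 0 -> l != m -> l + m != 0 ->
  x2 * y1 != x1 * y2 -> eqs k x1 y1 x2 y2 -> y1 != 0 /\ y2 != 0.
Proof.
move=> hk l0 m0; rewrite -subr_eq0 => lm0 ln0 ind e.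
have ml0 : m - l != 0 by rewrite -oppr_eq0 opprB.
split; apply/eqP => y0; move: ind e; rewrite y0 ?mulr0 ?mul0r.
  rewrite eq_sym => xy0; have [x10 y20] : x1 != 0 /\ y2 != 0.
    by move: xy0; rewrite mulf_eq0 negb_or => /andP.
  have z c : c != 0 -> c * (x1 * y2) = 0 -> False.
    by move=> c0 /eqP; rewrite mulf_eq0 (negPf c0) (negPf xy0).
  by case: hk => -> [h _]; [apply: (z m)|apply: (z (2 * l))|apply: (z (l + m))];
    rewrite ?mulf_neq0 //; move: h; rewrite !(mulr0, mul0r, add0r) => <-; ring.
move=> xy0.
have z c : c != 0 -> c * (x2 * y1) = 0 -> False.
  by move=> c0 /eqP; rewrite mulf_eq0 (negPf c0) (negPf xy0).
by case: hk => -> [h _]; [apply: (z l)|apply: (z (m - l))|apply: (z (l + m))];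
  rewrite ?mulf_neq0 //; move: h; rewrite !(mulr0, mul0r, addr0) => <-; ring.
Qed.

(** The first equation is divisible by [y2]. The root [y2 = 0] is the angle between [1] and [tau];
    otherwise [x1 / y1] is determined and the second equation is linear in [x2]. *)
Lemma solve_angle1 x1 y1 x2 y2 : l != 0 \/ m != 0 -> l + m != 0 ->
    x2 * y1 != x1 * y2 -> eqs 1 x1 y1 x2 y2 ->
  x1 = 0 /\ y2 = 0 \/
  [/\ y1 != 0, y2 != 0, x1 = r / (l + m) * y1 &
       x2 = - (2 * (l ^+ 3 + 2 * l ^+ 2 * m - l * m ^+ 2) / r) * y2].
Proof.
move=> lm ln0 ind [h1 h2]; have r0 := form_r_neq0 lm.
have [y20|y20] := eqVneq y2 0; [left|right].
  split=> //; move: h2 ind; rewrite y20 !mulr0 !mul0r !addr0 => /eqP.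
  by rewrite mulf_eq0 => /orP[/eqP ->|/eqP ->]; rewrite ?mul0r ?eqxx.
have hx1 : x1 = r / (l + m) * y1.
  by apply: (mulIf y20); apply: (mulIf ln0); rewrite h1; field.
have y10 : y1 != 0.
  by apply: contraNneq ind => y10; rewrite hx1 y10 !mulr0 mul0r.
split=> //; apply: (mulIf (mulf_neq0 y10 r0)).
transitivity ((x1 * x2) * (l + m)); first by rewrite hx1; field.
have -> : x1 * x2 = - (x1 * y2 * (m - l) + (2 * p + r) * (y1 * y2)).
  by apply/eqP; rewrite -addr_eq0 addrA h2.
by rewrite hx1; field; rewrite r0 ln0.
Qed.

(** The first equation gives [t]; the second becomes quadratic in [s], and completing the square
    exhibits the quartic as its discriminant up to a square. *)
Lemma solve_angle2 s t : l != 0 -> m != 0 -> eqs 2 s 1 t 1 ->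
  (l ^+ 2 - m ^+ 2 - m * s) ^+ 2 = l * (l ^+ 3 + l ^+ 2 * m + l * m ^+ 2 + m ^+ 3)
  /\ t = (r - m * s) / l.
Proof.
move=> l0 m0 /= [h1 h2]; have ht : t = (r - m * s) / l.
  by apply: (mulIf l0); rewrite divfK //; lra.
split=> //; apply/eqP; rewrite -subr_eq0 -(mulr0 (- l * m)) -h2 ht; apply/eqP.
by field.
Qed.

(** Here the quadratic equation left for [s] splits over the rationals, so no condition on [l] and
    [m] appears. *)
Lemma solve_angle3 s t : l != 0 -> m != l -> eqs 3 s 1 t 1 ->
  s = (- l ^+ 2 - 2 * l * m + m ^+ 2) / (2 * l) /\ t = - 2 * (l + m) \/
  s = - 2 * m /\ t = (l ^+ 2 + 2 * l * m - m ^+ 2) / (m - l).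
Proof.
rewrite -(subr_eq0 m l) => l0 ml0 /= [h1 h2].
have ht : t = (r - 2 * l * s) / (m - l).
  by apply: (mulIf ml0); rewrite divfK //; lra.
have /eqP : (s - (- l ^+ 2 - 2 * l * m + m ^+ 2) / (2 * l)) * (s - - 2 * m) = 0.
  by rewrite -(mulr0 (- (m - l) / (2 * l))) -h2 ht; field; rewrite l0 ml0.
rewrite mulf_eq0 !subr_eq0 => /orP[]/eqP es; [left|right]; split=> //.
  by rewrite ht es; field; rewrite l0 ml0.
by rewrite ht es; field; rewrite ml0.
Qed.

Lemma solve_angle4 s t : l + m != 0 -> eqs 4 s 1 t 1 ->
  (r - (l + m) * s) ^+ 2 = 3 * l ^+ 4 + 2 * l ^+ 3 * m + 4 * l ^+ 2 * m ^+ 2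
                           + 2 * l * m ^+ 3 + m ^+ 4
  /\ t = 2 * r / (l + m) - s.
Proof.
move=> ln0 /= [h1 h2]; have ht : t = 2 * r / (l + m) - s.
  by apply: (mulIf ln0); rewrite mulrBl divfK //; lra.
split=> //; apply/eqP; rewrite -subr_eq0 -(mulr0 (- (l + m) ^+ 2)) -h2 ht; apply/eqP.
by field.
Qed.

End SolveAngles.

Section Spaces.
Variable R : realType.
Local Notation C := R[i].
Local Notation z := (zeta R 8).
Local Notation vec := (vec R).

Section Vec.
Variables l m : rat.
Hypothesis lm : l != 0 \/ m != 0.
Local Notation vec := (vec l m).
Local Notation V := (@Vpair R l m).

Lemma VpairP v : V v <-> exists x y, v = vec x y.
Proof. by split=> -[x [y e]]; exists x, y; rewrite e /vec ?mulr1. Qed.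

Lemma Vpair_vec x y : V (vec x y). Proof. by apply/VpairP; exists x, y. Qed.

Lemma vec_inj x y x' y' : vec x y = vec x' y' -> x = x' /\ y = y'.
Proof.
have e s t : vec s t = q4 R (s + t * m) (t * m) (t * l) (- (t * l)).
  by rewrite /vec tauE /q4 !(rmorphN, rmorphD, rmorphM); ring.
rewrite !e => /q4_inj[h0 h1 h2 _]; have ey : y = y'.
  by case: lm => n0; apply: (mulIf n0).
by split=> //; move: h0; rewrite ey => /addIr.
Qed.

Lemma vec_indep x1 y1 x2 y2 :
  R_independent (vec x1 y1) (vec x2 y2) <-> x2 * y1 != x1 * y2.
Proof.
rewrite R_independentP; have := angle_eqsP R (k := 0) x1 y1 x2 y2 isT lm.
rewrite expr0 mul1r /= => -[h1 h2].
by split=> /eqP h; apply/eqP => e; apply: h; [apply: h2|apply: h1].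
Qed.

Lemma vec_sqamp k x1 y1 x2 y2 : (k <= 4)%N ->
  angle_sqamp V (z ^+ k) (vec x1 y1) (vec x2 y2) <->
  x2 * y1 != x1 * y2 /\
  (angle_eqs l m k x1 y1 x2 y2 \/ angle_eqs l m k x2 y2 x1 y1).
Proof.
move=> k4; rewrite -!(angle_eqsP R _ _ _ _ k4 lm) -vec_indep.
have [V1 V2] := (Vpair_vec x1 y1, Vpair_vec x2 y2).
split=> [a|[ind /(angle_sqampP _ V1 V2 ind)]//].
have ind : R_independent (vec x1 y1) (vec x2 y2) by case: a => -[].
by split=> //; apply/(angle_sqampP _ V1 V2 ind).
Qed.

Lemma Qprop_vec x y x' y' c : c != 0 -> x' = c * x -> y' = c * y ->
  Qproportional (vec x y) (vec x' y').
Proof. by move=> c0 -> ->; exists c => //; rewrite /vec !rmorphM; ring. Qed.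

Lemma Qprop_vecE x y x' y' : Qproportional (vec x y) (vec x' y') ->
  exists c, [/\ c != 0, x' = c * x & y' = c * y].
Proof.
move=> [c c0 e]; exists c; have [|-> ->] // := @vec_inj x' y' (c * x) (c * y).
by rewrite e /vec !rmorphM; ring.
Qed.

Lemma Qprop_tauE a b : Qproportional (vec a 1) (vec b 1) -> a = b.
Proof.
move=> /Qprop_vecE[c [_ -> e]]; move: e; rewrite mulr1 => <-.
by rewrite mul1r.
Qed.

Lemma same_angleC (v w : C) A : same_angle A (v, w) -> same_angle A (w, v).
Proof. by move=> [[h1 h2]|[h1 h2]]; [right|left]. Qed.

Lemma angles_are_vec k (s : seq (C * C)) : (k <= 4)%N ->
    (forall A, A \in s -> exists x1 y1 x2 y2,
      [/\ A = (vec x1 y1, vec x2 y2), x2 * y1 != x1 * y2 &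
          angle_eqs l m k x1 y1 x2 y2 \/ angle_eqs l m k x2 y2 x1 y1]) ->
    (forall x1 y1 x2 y2, x2 * y1 != x1 * y2 -> angle_eqs l m k x1 y1 x2 y2 ->
      exists2 A, A \in s & same_angle A (vec x1 y1, vec x2 y2)) ->
  angles_are V (z ^+ k) s.
Proof.
move=> k4 hs ha; split=> [A /hs[x1 [y1 [x2 [y2 [-> ind e]]]]]|v1 v2 a].
  by apply/vec_sqamp.
have [V1 V2] : V v1 /\ V v2 by case: a => -[].
move: V1 V2 a => /VpairP[x1 [y1 ->]] /VpairP[x2 [y2 ->]] /(vec_sqamp _ _ _ _ k4)[ind [e|e]].
  exact: ha.
have [|A As /same_angleC h] := ha _ _ _ _ _ e; last by exists A.
by rewrite eq_sym.
Qed.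

End Vec.
End Spaces.

(** * Angles in V_[l:m] *)

Section ProjectiveLine.
Variable F : fieldType.
Implicit Types l m : F.

Lemma proj_mem l m : proj l m (l, m).
Proof. by exists 1; rewrite ?oner_neq0 // !mul1r. Qed.

Lemma projP l m l' m' :
  proj l m = proj l' m' <-> exists2 t : F, t != 0 & (l' = t * l) /\ (m' = t * m).
Proof.
split=> [e|[t t0 [-> ->]]].
  by have := proj_mem l' m'; rewrite -e => -[t t0 [-> ->]]; exists t.
apply/seteqP; split=> -[x y] [s s0 [-> ->]].
  by exists (s / t); rewrite ?mulf_neq0 ?invr_eq0 //; congr (_, _); field.
by exists (s * t); rewrite ?mulf_neq0 //; congr (_, _); ring.
Qed.

Lemma iota_proj l m : iotaP (proj l m) = proj (l + m) (l - m).
Proof.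
apply/seteqP; split=> -[x y].
  by move=> [_ [t t0 ->] [<- <-]]; exists t => //=; congr (_, _); ring.
by move=> [t t0 [-> ->]]; exists (t * l, t * m); [exists t|congr (_, _) => /=; ring].
Qed.

Hypothesis char2 : (2 : F) != 0.

Lemma iota_neq0 l m : (l, m) != (0, 0) -> (l + m, l - m) != (0, 0).
Proof.
apply: contra_neq => -[h1 h2]; congr (_, _); apply: (mulfI char2).
  by transitivity (l + m + (l - m)); [ring|rewrite h1 h2; ring].
by transitivity (l + m - (l - m)); [ring|rewrite h1 h2; ring].
Qed.

Lemma iota_projline (L : set (F * F)) : @projline F L -> @projline F (iotaP L).
Proof.
move=> [l [m [lm ->]]]; exists (l + m), (l - m).
by split; [exact: iota_neq0|exact: iota_proj].
Qed.

Lemma iotaK (L : set (F * F)) : @projline F L -> iotaP (iotaP L) = L.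
Proof.
move=> [l [m [_ ->]]]; rewrite !iota_proj; apply/esym/projP.
by exists 2 => //; split; ring.
Qed.

End ProjectiveLine.

Lemma not_Sexc (l m : rat) : (l, m) != (0, 0) -> ~ Sexc (proj l m) ->
  [/\ l != 0, m != 0, l != m & l + m != 0].
Proof.
move=> lm nS; split; apply/eqP => h; apply: nS.
- left; left; left; apply/esym/projP; exists m; last by rewrite h; split; ring.
  by have := lm; rewrite h; apply: contra_neq => ->.
- left; left; right; apply/esym/projP; exists l; last by rewrite h; split; ring.
  by have := lm; rewrite h; apply: contra_neq => ->.
- left; right; apply/esym/projP; exists m; last by rewrite h; split; ring.
  by have := lm; rewrite h; apply: contra_neq => ->.
right; apply/esym/projP; have e : l = - m by apply/eqP; rewrite -addr_eq0 h.
exists m; last by rewrite e; split; ring.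
by have := lm; rewrite e; apply: contra_neq => ->; rewrite oppr0.
Qed.

Section AngleCounts.
Variable R : realType.
Local Notation z := (zeta R 8).
Variables l m : rat.
Hypotheses (l0 : l != 0) (m0 : m != 0) (lm0 : l != m) (ln0 : l + m != 0).
Local Notation p := (l ^+ 2 + m ^+ 2).
Local Notation r := (l ^+ 2 - 2 * l * m - m ^+ 2).
Local Notation V := (@Vpair R l m).
Local Notation t := (tau R l m).

Let lm : l != 0 \/ m != 0. Proof. by left. Qed.
Let r0 : r != 0. Proof. exact: form_r_neq0. Qed.
Let ml0 : m - l != 0. Proof. by rewrite subr_eq0 eq_sym. Qed.

Lemma tauD_vec a : t + ratr a = vec R l m a 1.
Proof. by rewrite /vec rmorph1 mul1r addrC. Qed.

Lemma vec10 : 1 = vec R l m 1 0.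
Proof. by rewrite /vec rmorph1 rmorph0 mul0r addr0. Qed.

Lemma vec01 : t = vec R l m 0 1.
Proof. by rewrite /vec rmorph1 rmorph0 mul1r add0r. Qed.

Lemma same_angle_tau x1 y1 x2 y2 a b : y1 != 0 -> y2 != 0 ->
  x1 = a * y1 -> x2 = b * y2 ->
  same_angle (t + ratr a, t + ratr b) (vec R l m x1 y1, vec R l m x2 y2).
Proof.
by move=> y10 y20 -> ->; rewrite !tauD_vec; left; split;
  [apply: (@Qprop_vec R l m _ _ _ _ y1)|apply: (@Qprop_vec R l m _ _ _ _ y2)]; rewrite ?mulr1 // mulrC.
Qed.

Lemma same_angle_tauE a b a' b' :
  same_angle (t + ratr a, t + ratr b) (t + ratr a', t + ratr b') ->
  a = a' /\ b = b' \/ a = b' /\ b = a'.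
Proof. by rewrite !tauD_vec => -[[/= /(Qprop_tauE lm) -> /(Qprop_tauE lm) ->]|[/= /(Qprop_tauE lm) -> /(Qprop_tauE lm) ->]]; [left|right]. Qed.

(* The hypotheses list all the solutions of the angle equations normalized by
   [v1 = tau + s], [v2 = tau + t]. *)
Lemma angles_are_tau k (s : seq (rat * rat)) : [\/ k = 2, k = 3 | k = 4] ->
    (forall A, A \in s -> A.1 != A.2 /\ angle_eqs l m k A.1 1 A.2 1) ->
    (forall a b, a != b -> angle_eqs l m k a 1 b 1 -> (a, b) \in s \/ (b, a) \in s) ->
  angles_are V (z ^+ k) [seq (t + ratr A.1, t + ratr A.2) | A <- s].
Proof.
move=> hk hs ha; have k4 : (k <= 4)%N by case: hk => ->.
apply: (angles_are_vec lm k4) => [A /mapP[B Bs ->]|x1 y1 x2 y2 ind e].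
  have [ab e] := hs B Bs; exists B.1, 1, B.2, 1; rewrite !tauD_vec; split=> //.
  by rewrite !mulr1 eq_sym.
  by left.
have [y10 y20] := angle_eqs_indep_y hk l0 m0 lm0 ln0 ind e.
have [a ea] : exists a, x1 = a * y1 by exists (x1 / y1); rewrite divfK.
have [b eb] : exists b, x2 = b * y2 by exists (x2 / y2); rewrite divfK.
move: e; rewrite ea eb => /(angle_eqs_scale _ _ _ _ _ y10 y20) e.
have ab : a != b.
  by apply: contraNneq ind => ab; rewrite ea eb ab; apply/eqP; ring.
have [h|h] := ha a b ab e.
  by exists (t + ratr a, t + ratr b); [apply/mapP; exists (a, b)|exact: same_angle_tau].
exists (t + ratr b, t + ratr a); first by apply/mapP; exists (b, a).
by apply: same_angleC; apply: same_angle_tau.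
Qed.

Lemma two_angles1 :
  let a := r / (l + m) in
  let b := - (2 * (l ^+ 3 + 2 * l ^+ 2 * m - l * m ^+ 2) / r) in
  two_angles V z (1, t) (t + ratr a, t + ratr b).
Proof.
move=> a b; have ab : b != a.
  rewrite -subr_eq0; apply/eqP => h.
  have := form_2pq_gt0 lm; have := form_p_gt0 lm.
  (* Up to a nonzero factor, [b - a] is a product of two positive definite forms. *)
  have : (l ^+ 2 + m ^+ 2) * (3 * l ^+ 2 + 2 * l * m + m ^+ 2) = 0.
    rewrite -(mulr0 (- r * (l + m))) -h /a /b; field.
    by rewrite r0 ln0.
  by move=> /eqP; rewrite mulf_eq0 => /orP[]/eqP ->; rewrite ltxx.
split; last first.
  rewrite {1}vec10 {1}vec01 tauD_vec tauD_vec => -[[/(Qprop_vecE lm)]|[/(Qprop_vecE lm)]] /=;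
    by move=> [c [_ _ /eqP]]; rewrite mulr0 oner_eq0.
rewrite -[z]expr1; apply: (angles_are_vec lm) => // [A|x1 y1 x2 y2 ind e].
  rewrite !inE => /orP[]/eqP ->.
    exists 1, 0, 0, 1; split; [by rewrite -vec10 -vec01|by []|].
    by right; split; ring.
  exists a, 1, b, 1; rewrite !tauD_vec; split=> //; first by rewrite !mulr1.
  by left; rewrite /= /a /b; split; field; rewrite ?r0 ?ln0.
have [[x10 y20]|[y10 y20 ea eb]] := solve_angle1 lm ln0 ind e; last first.
  by exists (t + ratr a, t + ratr b); [rewrite !inE eqxx orbT|exact: same_angle_tau].
exists (1, t); first by rewrite !inE eqxx.
move: ind; rewrite x10 y20 mul0r mulf_eq0 negb_or => /andP[x20 y10].
rewrite {1}vec10 {1}vec01; right.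
by split; [apply: (Qprop_vec R l m x20)|apply: (Qprop_vec R l m y10)];
  rewrite ?mulr0 ?mulr1.
Qed.

Lemma two_angles3 :
  let c := (- l ^+ 2 - 2 * l * m + m ^+ 2) / (2 * l) in
  let d := - 2 * (l + m) in
  let c' := - 2 * m in
  let d' := (l ^+ 2 + 2 * l * m - m ^+ 2) / (m - l) in
  two_angles V (z ^+ 3) (t + ratr c, t + ratr d) (t + ratr c', t + ratr d').
Proof.
move=> c d c' d'; have F0 := form_2pq_gt0 lm; have q0 := form_q_neq0 lm.
have cd : c != d.
  rewrite -subr_eq0; apply/eqP => h.
  have : 3 * l ^+ 2 + 2 * l * m + m ^+ 2 = 0 by rewrite -(mulr0 (2 * l)) -h /c /d; field.
  by move=> e; rewrite e ltxx in F0.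
have cd' : c' != d'.
  rewrite -subr_eq0; apply/eqP => h; have p0 := form_p_gt0 lm.
  have e : p = 0 by rewrite -(mulr0 (l - m)) -h /c' /d'; field.
  by rewrite e ltxx in p0.
split.
  apply: (@angles_are_tau 3 [:: (c, d); (c', d')]); first by constructor 2.
    move=> A; rewrite !inE => /orP[]/eqP -> /=; split=> //.
      by rewrite /c /d; split; field.
    by rewrite /c' /d'; split; field.
  move=> a b ab e; have ml : m != l by rewrite eq_sym.
  by have [[-> ->]|[-> ->]] := solve_angle3 l0 ml e; left; rewrite !inE eqxx ?orbT.
move=> /same_angle_tauE[[h _]|[_ h]].
  have /eqP[] := r0; rewrite -(mulr0 (- 2 * l)) -(subrr c') -{1}h /c /c'; field.
  exact: l0.
by have /eqP[] := l0; rewrite -(mulr0 (- 2^-1)) -(subrr c') -{1}h /c' /d; field.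
Qed.

Lemma two_angles2 u : l * (l ^+ 3 + l ^+ 2 * m + l * m ^+ 2 + m ^+ 3) = u ^+ 2 ->
  let ep := (l ^+ 2 - m ^+ 2 - u) / m in
  let em := (l ^+ 2 - m ^+ 2 + u) / m in
  let fp := (- 2 * l * m + u) / l in
  let fm := (- 2 * l * m - u) / l in
  two_angles V (z ^+ 2) (t + ratr ep, t + ratr fp) (t + ratr em, t + ratr fm).
Proof.
move=> hu ep em fp fm.
have hp : u ^+ 2 = l * (l + m) * p by rewrite -hu; ring.
have p0 : p != 0 by rewrite gt_eqF ?form_p_gt0.
have u0 : u != 0.
  apply/eqP => u0; have /eqP[] := mulf_neq0 (mulf_neq0 l0 ln0) p0.
  by rewrite -hp u0 expr0n.
have F0 := form_2pq_gt0 lm.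
have ne0 v : v ^+ 2 = l * (l + m) * p -> (l ^+ 2 - m ^+ 2 - v) / m != (- 2 * l * m + v) / l.
  move=> hv; apply/eqP => h; have e : v * (l + m) = l * p.
    apply/eqP; rewrite -subr_eq0 -(mulr0 (- l * m)) -(subrr ((- 2 * l * m + v) / l)) -{1}h.
    by apply/eqP; field; rewrite l0 m0.
  have : m * (3 * l ^+ 2 + 2 * l * m + m ^+ 2) = 0.
    apply: (mulfI (mulf_neq0 l0 p0)); rewrite mulr0.
    transitivity (l * (l + m) * p * (l + m) ^+ 2 - (l * p) ^+ 2); first by ring.
    by rewrite -hv -e; ring.
  by move=> /eqP; rewrite mulf_eq0 (negPf m0) => /eqP e0; rewrite e0 ltxx in F0.
have ne : ep != fp by exact: ne0.
have ne' : em != fm by have := ne0 (- u); rewrite sqrrN opprK => /(_ hp).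
split.
  apply: (@angles_are_tau 2 [:: (ep, fp); (em, fm)]); first by constructor.
    move=> A; rewrite !inE => /orP[]/eqP -> /=; split=> //; rewrite /ep /em /fp /fm.
      split; first by field; rewrite l0 m0.
      by field: hp; rewrite l0 m0.
    split; first by field; rewrite l0 m0.
    by field: hp; rewrite l0 m0.
  move=> a b ab e; left; have [h ->] := solve_angle2 l0 m0 e.
  move: h; rewrite hu => /eqP; rewrite eqf_sqr => /orP[]/eqP h.
    have -> : a = ep by rewrite /ep -h; field.
    rewrite !inE; apply/orP; left; apply/eqP; congr (_, _).
    by rewrite /fp /ep; field; rewrite l0 m0.
  have -> : a = em by rewrite /em -[u]opprK -h; field.
  rewrite !inE; apply/orP; right; apply/eqP; congr (_, _).
  by rewrite /fm /em; field; rewrite l0 m0.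
move=> /same_angle_tauE[[h _]|[h h']].
  have /eqP[] := u0; rewrite -(mulr0 (- m / 2)) -(subrr em) -{1}h /ep /em; field.
  exact: m0.
have /eqP[] := mulf_neq0 u0 ml0.
transitivity (l * m / 2 * ((ep - fm) - (em - fp))).
  by rewrite /ep /fp /em /fm; field; rewrite l0 m0.
by rewrite h h' !subrr mulr0.
Qed.

Lemma contains_sqamp2 : contains_sqamp V (z ^+ 2) <->
  exists u, l * (l ^+ 3 + l ^+ 2 * m + l * m ^+ 2 + m ^+ 3) = u ^+ 2.
Proof.
split=> [[v [w a]]|[u /two_angles2[[h _] _]]]; last first.
  by eexists; eexists; apply: h (mem_head _ _).
have [Vv Vw] : V v /\ V w by case: a => -[].
have s2 : [\/ 2 = 2, 2 = 3 | 2 = 4]%N by constructor.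
have main x1 y1 x2 y2 : x2 * y1 != x1 * y2 -> angle_eqs l m 2 x1 y1 x2 y2 ->
    exists u, l * (l ^+ 3 + l ^+ 2 * m + l * m ^+ 2 + m ^+ 3) = u ^+ 2.
  move=> ind e; have [y10 y20] := angle_eqs_indep_y s2 l0 m0 lm0 ln0 ind e.
  rewrite -(divfK y10 x1) -(divfK y20 x2) in e.
  have [e2 _] := solve_angle2 l0 m0 (proj1 (angle_eqs_scale _ _ _ _ _ y10 y20) e).
  by rewrite -e2; eexists.
move: Vv Vw a => /VpairP[x1 [y1 ->]] /VpairP[x2 [y2 ->]] /(vec_sqamp R lm).
by case=> // ind [/main|/main]; apply; rewrite // eq_sym.
Qed.

(** The equations for [k = 4] are symmetric in the two vectors, so the two roots are exchanged and
    the list shows one angle in both orders. *)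
Lemma angles_are4 v :
    3 * l ^+ 4 + 2 * l ^+ 3 * m + 4 * l ^+ 2 * m ^+ 2 + 2 * l * m ^+ 3 + m ^+ 4 = v ^+ 2 ->
  let gp := (r - v) / (l + m) in
  let gm := (r + v) / (l + m) in
  angles_are V (z ^+ 4) [:: (t + ratr gp, t + ratr gm); (t + ratr gm, t + ratr gp)].
Proof.
move=> hv gp gm; have hp : v ^+ 2 = p * (3 * l ^+ 2 + 2 * l * m + m ^+ 2) by rewrite -hv; ring.
have v0 : v != 0.
  apply/eqP => v0; have := mulr_gt0 (form_p_gt0 lm) (form_2pq_gt0 lm).
  by rewrite -hp v0 expr0n ltxx.
have ne : gp != gm.
  rewrite -subr_eq0; apply/eqP => h; have /eqP[] := v0.
  by rewrite -(mulr0 (- (l + m) / 2)) -h /gp /gm; field.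
apply: (@angles_are_tau 4 [:: (gp, gm); (gm, gp)]); first by constructor 3.
  move=> A; rewrite !inE => /orP[]/eqP -> /=; split; rewrite ?ne // ?[_ == gp]eq_sym ?ne //;
    by rewrite /gp /gm; split; [field|field: hp].
move=> a b ab e; left; have [h ->] := solve_angle4 ln0 e.
move: h; rewrite hv => /eqP; rewrite eqf_sqr => /orP[]/eqP h.
  have -> : a = gp by rewrite /gp -h; field.
  rewrite !inE; apply/orP; left; apply/eqP; congr (_, _).
  by rewrite /gm /gp; field.
have -> : a = gm by rewrite /gm -[v]opprK -h; field.
rewrite !inE; apply/orP; right; apply/eqP; congr (_, _).
by rewrite /gm /gp; field.
Qed.

Lemma contains_sqamp4 : contains_sqamp V (z ^+ 4) <->
  exists v, 3 * l ^+ 4 + 2 * l ^+ 3 * m + 4 * l ^+ 2 * m ^+ 2 + 2 * l * m ^+ 3 + m ^+ 4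
            = v ^+ 2.
Proof.
split=> [[v [w a]]|[u /angles_are4[h _]]]; last first.
  by eexists; eexists; apply: h (mem_head _ _).
have [Vv Vw] : V v /\ V w by case: a => -[].
have s4 : [\/ 4 = 2, 4 = 3 | 4 = 4]%N by constructor 3.
have main x1 y1 x2 y2 : x2 * y1 != x1 * y2 -> angle_eqs l m 4 x1 y1 x2 y2 ->
    exists v, 3 * l ^+ 4 + 2 * l ^+ 3 * m + 4 * l ^+ 2 * m ^+ 2 + 2 * l * m ^+ 3 + m ^+ 4
              = v ^+ 2.
  move=> ind e; have [y10 y20] := angle_eqs_indep_y s4 l0 m0 lm0 ln0 ind e.
  rewrite -(divfK y10 x1) -(divfK y20 x2) in e.
  have [e2 _] := solve_angle4 ln0 (proj1 (angle_eqs_scale _ _ _ _ _ y10 y20) e).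
  by rewrite -e2; eexists.
move: Vv Vw a => /VpairP[x1 [y1 ->]] /VpairP[x2 [y2 ->]] /(vec_sqamp R lm).
by case=> // ind [/main|/main]; apply; rewrite // eq_sym.
Qed.

End AngleCounts.

(** * Homothety classes *)

Section Homothety.
Variable R : realType.
Local Notation C := R[i].
Local Notation z := (zeta R 8).
Local Notation tau := (@tau R).
Implicit Types (V W : set C).

Lemma homothetic_refl V : homothetic V V.
Proof.
exists 1; first exact: oner_neq0.
by apply/seteqP; split=> v; [exists v; rewrite ?mul1r|case=> w Vw <-; rewrite mul1r].
Qed.

Lemma homothetic_sym V W : homothetic V W -> homothetic W V.
Proof.
move=> [k k0 ->]; exists k^-1; first by rewrite invr_eq0.
apply/seteqP; split=> v; first by exists (k * v); [exists v|rewrite mulKf].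
by case=> _ [w Vw <-] <-; rewrite mulKf.
Qed.

Lemma homothetic_trans U V W : homothetic U V -> homothetic V W -> homothetic U W.
Proof.
move=> [k k0 ->] [h h0 ->]; exists (h * k); first by rewrite mulf_neq0.
apply/seteqP; split=> v; first by case=> _ [w Uw <-] <-; exists w; rewrite ?mulrA.
by case=> w Uw <-; exists (k * w); [exists w|rewrite mulrA].
Qed.

Lemma homothety_class_eq V W : homothetic V W -> homothety_class V = homothety_class W.
Proof.
move=> h; apply/seteqP; split=> U [sU hU]; split=> //.
  exact: homothetic_trans (homothetic_sym h) hU.
exact: homothetic_trans h hU.
Qed.

Lemma homothetic_contains_sqamp V W k : homothetic V W -> contains_sqamp V k -> contains_sqamp W k.
Proof.
move=> [c c0 ->] [v [w [[Vv Vw ind [r [q [r0 e]]]] [nu [hn [x ex] hk]]]]].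
have qe : (c * v) / (c * w) = v / w by rewrite -mulf_div divff // mul1r.
exists (c * v), (c * w); split.
  split; [by exists v|by exists w| |by exists r, q; rewrite qe].
  move=> a b; rewrite mulrCA [b%:C * _]mulrCA -mulrDr => /eqP.
  by rewrite mulf_eq0 (negPf c0) => /eqP /ind.
exists nu; split=> //; exists x; rewrite -ex -[in RHS]mulrA -qe.
by rewrite !mulrA.
Qed.

Lemma tauZ c l m : tau (c * l) (c * m) = ratr c * tau l m.
Proof. by rewrite /Defs.tau !rmorphM; ring. Qed.

Lemma tau_inj l m l' m' : tau l m = tau l' m' -> l = l' /\ m = m'.
Proof. by rewrite !tauE => /q4_inj[]. Qed.

Lemma tau_neq0 l m : (l, m) != (0, 0) -> tau l m != 0.
Proof.
by apply: contra_neq; rewrite tauE => /q4_eq0[_ -> -> _].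
Qed.

Lemma tau_conj l m : tau l m = z * conjc (tau l m).
Proof. by rewrite conj_tauE zeta8M_q4 tauE opprK. Qed.

Lemma tau_div_conj l m : (l, m) != (0, 0) -> tau l m / conjc (tau l m) = z.
Proof.
by move=> lm; rewrite {1}tau_conj mulfK // conjc_eq0 tau_neq0.
Qed.

Lemma Qspan_scale (c : rat) (v w : C) : c != 0 -> Qspan v (ratr c * w) = Qspan v w.
Proof.
move=> c0; apply/seteqP; split=> _ [x [y ->]].
  by exists x, (y * c); rewrite rmorphM; ring.
exists x, (y / c); rewrite fmorph_div /=; field.
by rewrite fmorph_eq0.
Qed.

Lemma Vpair_proj (l m l' m' : rat) : proj l m = proj l' m' -> @Vpair R l m = @Vpair R l' m'.
Proof.
by move=> /projP[t t0 [-> ->]]; rewrite /Vpair tauZ Qspan_scale.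
Qed.

Lemma Vproj_proj l m : @Vproj R (proj l m) = @Vpair R l m.
Proof.
apply/seteqP; split=> v; last by exists (l, m) => //; exact: proj_mem.
move=> [[l' m'] h] /=; rewrite (@Vpair_proj l m l' m') //.
by case: h => t t0 [-> ->]; apply/projP; exists t.
Qed.

Lemma Vpair_space l m : (l, m) != (0, 0) -> is_space (@Vpair R l m).
Proof.
move=> /pair_neq0 lm; exists 1, (tau l m); split=> //.
rewrite [X in R_independent X](vec10 R l m) [X in R_independent _ X](vec01 R l m).
by apply/(vec_indep R lm).
Qed.

Lemma conj_affine (x y : rat) (v : C) :
  conjc (ratr x + ratr y * v) = ratr x + ratr y * conjc v.
Proof.
by rewrite [LHS](rmorphD (conjc : {rmorphism C -> C})) /= conj_ratrM conj_ratr.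
Qed.

Lemma vecZ l m c x y : vec R l m (c * x) (c * y) = ratr c * vec R l m x y.
Proof. by rewrite /vec !rmorphM; ring. Qed.

Section TauIota.
Variables l m : rat.
Local Notation p := (l ^+ 2 + m ^+ 2).
Local Notation r := (l ^+ 2 - 2 * l * m - m ^+ 2).
Local Notation q := (l ^+ 2 + 2 * l * m - m ^+ 2).

(** So the [tau] of the image under [iota] is a rational multiple of the inverse of [conjc tau],
    which makes its space homothetic to the conjugate of [V]. *)
Lemma conj_tau_iota : conjc (tau l m) * tau (l + m) (l - m) = ratr (2 * q).
Proof.
have hz := zeta8_4 R; rewrite conj_tauE tauE /q4; ring: hz.
Qed.

(** The two vectors are proportional to [tau + b] and, where [l + m] is nonzero, [tau + a]: the
    second angle of squared amplitude [zeta8]. *)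
Lemma tau_iota_vec : tau (l + m) (l - m) * vec R l m (- 2 * l * q) r
                     = vec R l m (- 2 * q * r) (- 2 * q * (l + m)).
Proof.
have hz := zeta8_4 R; rewrite /vec !tauE /q4; ring: hz.
Qed.

Hypothesis lm0 : (l, m) != (0, 0).
Let lm := pair_neq0 lm0.

Lemma Vpair_basis a b c d : a * d - b * c != 0 ->
  Qspan (vec R l m a b) (vec R l m c d) = @Vpair R l m.
Proof.
move=> det; apply/seteqP; split=> _ [x [y ->]].
  exists (x * a + y * c), (x * b + y * d).
  by rewrite /vec !(rmorphD, rmorphM) /=; ring.
exists ((x * d - y * c) / (a * d - b * c)), ((y * a - x * b) / (a * d - b * c)).
have detR : ratr a * ratr d - ratr b * ratr c != 0 :> C.
  by rewrite -!rmorphM -rmorphB fmorph_eq0.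
by rewrite /vec !(fmorph_div, rmorphB, rmorphM) /=; field.
Qed.

Lemma homothetic_iota : homothetic (@Vpair R l m) (@Vpair R (l + m) (l - m)).
Proof.
apply: homothetic_sym; have r0 := form_r_neq0 lm.
have g0 : vec R l m (- 2 * l * q) r != 0.
  apply/eqP => g0; have [] : - 2 * l * q = 0 /\ r = 0.
    by apply: (vec_inj lm (R := R)); rewrite g0 /vec !rmorph0 mul0r addr0.
  by move=> _ /eqP; rewrite (negPf r0).
exists (vec R l m (- 2 * l * q) r) => //.
rewrite -(@Vpair_basis (- 2 * l * q) r (- 2 * q * r) (- 2 * q * (l + m))); last first.
  have := mulr_gt0 (form_p_gt0 lm) (form_2pq_gt0 lm).
  have q0 := form_q_neq0 lm; rewrite (_ : _ - _ = 2 * q * (p * (3 * l ^+ 2 + 2 * l * m + m ^+ 2))); last by ring.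
  by move=> h; rewrite !mulf_neq0 // gt_eqF // ?form_p_gt0 // ?form_2pq_gt0.
apply/seteqP; split=> v.
  by move=> [x [y ->]]; exists (ratr x * 1 + ratr y * tau (l + m) (l - m));
   [exists x, y|rewrite -tau_iota_vec; ring].
by move=> [_ [x [y ->]] <-]; exists x, y; rewrite -tau_iota_vec; ring.
Qed.

Lemma homothetic_conj : homothetic (conjc @` @Vpair R l m) (@Vpair R l m).
Proof.
apply: homothetic_trans (homothetic_sym homothetic_iota).
have ct0 : conjc (tau l m) != 0 by rewrite conjc_eq0 tau_neq0.
have q0 : 2 * q != 0 by rewrite mulf_neq0 // form_q_neq0.
exists (conjc (tau l m))^-1; first by rewrite invr_eq0.
have tiE : tau (l + m) (l - m) = ratr (2 * q) * (conjc (tau l m))^-1.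
  by rewrite -conj_tau_iota mulrAC divff // mul1r.
rewrite /Vpair tiE Qspan_scale //; apply/seteqP; split=> v.
  move=> [x [y ->]]; exists (conjc (ratr y * 1 + ratr x * tau l m)).
    by exists (ratr y * 1 + ratr x * tau l m) => //; exists y, x.
  by rewrite !mulr1 conj_affine; field.
move=> [_ [_ [x [y ->]] <-] <-]; exists y, x.
by rewrite !mulr1 conj_affine; field.
Qed.

(** The inverse homothety carries [1] and [tau l' m'] to [w1] and [w2] in the first space with
    [w2 = tau l' m' * w1], so [(w2, w1)] solves the angle equations for [k = 1]. The two solutions
    give the point itself and its image under [iota]. The second is written without dividing by
    [l + m], so that the exceptional points are covered as well. *)
Lemma homothetic_Vpair l' m' : (l', m') != (0, 0) ->
    homothetic (@Vpair R l m) (@Vpair R l' m') ->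
  proj l' m' = proj l m \/ proj l' m' = proj (l + m) (l - m).
Proof.
move=> lm0' [k k0 e]; have r0 := form_r_neq0 lm.
have [w1 V1 e1] : exists2 w, @Vpair R l m w & k * w = 1.
  have : @Vpair R l' m' 1 by exists 1, 0; rewrite rmorph1 rmorph0; ring.
  by rewrite e => -[w Vw ew]; exists w.
have [w2 V2 e2] : exists2 w, @Vpair R l m w & k * w = tau l' m'.
  have : @Vpair R l' m' (tau l' m') by exists 0, 1; rewrite rmorph1 rmorph0; ring.
  by rewrite e => -[w Vw ew]; exists w.
have w10 : w1 != 0 by apply: contra_eq_neq e1 => ->; rewrite mulr0 eq_sym oner_neq0.
have tw : tau l' m' * w1 = w2.
  by apply: (mulfI k0); rewrite e2 mulrCA e1 mulr1.
have cw : conjc w2 = conjc (tau l' m') * conjc w1 by rewrite -tw conjcM.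
have t0 := tau_neq0 lm0'.
move: V1 V2 => /VpairP[x1 [y1 h1]] /VpairP[x2 [y2 h2]].
have eqs : angle_eqs l m 1 x2 y2 x1 y1.
  apply/(@angle_eqsP R l m 1 x2 y2 x1 y1 isT lm); rewrite -h1 -h2 expr1 cw -tw {1}tau_conj; ring.
have c10 : conjc w1 != 0 by rewrite conjc_eq0.
have ct0 : conjc (tau l' m') != 0 by rewrite conjc_eq0.
have ind : x1 * y2 != x2 * y1.
  apply/eqP => e0; have := proj2 (@angle_eqsP R l m 0 x2 y2 x1 y1 isT lm) e0.
  rewrite expr0 mul1r -h1 -h2 cw -tw => e3.
  have : z = 1.
    apply: (mulIf (mulf_neq0 (mulf_neq0 ct0 w10) c10)).
    transitivity (tau l' m' * w1 * conjc w1); first by rewrite [in RHS]tau_conj; ring.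
    by rewrite e3; ring.
  move=> z1; have := zeta8_4 R; rewrite z1 expr1n => /eqP.
  by rewrite -subr_eq0 opprK -(natrD _ 1 1) pnatr_eq0.
have finish (c : rat) a b : tau l' m' = ratr c * tau a b -> proj l' m' = proj a b.
  rewrite -tauZ => /tau_inj[el em]; apply/esym/projP; exists c; last by [].
  by have := lm0'; rewrite el em; apply: contra_neq => ->; rewrite !mul0r.
case: eqs => E1 E2; have [y10|y10] := eqVneq y1 0; [left|right].
  move: ind E2; rewrite y10 !mulr0 => ind E2.
  move: ind; rewrite mulf_eq0 negb_or => /andP[x10 y20].
  have x20 : x2 = 0.
    by move: E2; rewrite !mul0r !addr0 => /eqP; rewrite mulf_eq0 (negPf x10) orbF => /eqP.
  apply: (finish (y2 / x1)); apply: (mulIf w10); rewrite tw h1 h2 y10 x20 /vec.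
  by rewrite fmorph_div rmorph0 /=; field; rewrite fmorph_eq0.
have x20 : x2 != 0.
  apply: contraNneq ind => x20; move: E1; rewrite x20 !mul0r => /esym/eqP.
  by rewrite !mulf_eq0 (negPf r0) (negPf y10) orbF /= => /eqP ->; rewrite eqxx orbT.
have ey2 : y2 = x2 / r * (l + m).
  by apply: (mulIf (mulf_neq0 r0 y10)); rewrite [LHS]mulrCA -E1; field.
have ex1 : x1 = - 2 * l * q / r * y1.
  apply: (mulfI (mulf_neq0 r0 x20)).
  transitivity (r * (x2 * x1 + x2 * y1 * (m - l) + (2 * p + r) * (y2 * y1))
     - r * (x2 * y1 * (m - l) + (2 * p + r) * (y2 * y1))); first by ring.
  by rewrite E2 ey2; field.
have q0 := form_q_neq0 lm.
apply: (finish (- (x2 / (2 * q * y1)))); apply: (mulIf w10); rewrite tw.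
have -> : w1 = ratr (y1 / r) * vec R l m (- 2 * l * q) r.
  by rewrite -vecZ h1; congr vec; [rewrite ex1; field|rewrite divfK].
have -> : w2 = ratr (x2 / r) * vec R l m r (l + m).
  by rewrite -vecZ h2; congr vec; rewrite ?divfK // ey2.
transitivity (ratr (- (x2 / (2 * q * y1))) * ratr (y1 / r)
              * (tau (l + m) (l - m) * vec R l m (- 2 * l * q) r)); last by ring.
rewrite tau_iota_vec vecZ mulrA -!rmorphM.
by congr (ratr _ * _); field; rewrite q0 r0 y10.
Qed.
End TauIota.

(** A fixed point of [iota] is a rational zero of [l^2 - 2 l m - m^2]. *)
Lemma proj_iota_neq (l m : rat) : (l, m) != (0, 0) -> proj (l + m) (l - m) <> proj l m.
Proof.
move=> /pair_neq0 lm /esym/projP[t t0 [e1 e2]].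
have /eqP[] := form_r_neq0 lm; have h : (l + m) * m = (l - m) * l by rewrite e1 e2; ring.
by transitivity ((l - m) * l - (l + m) * m); [ring|rewrite h subrr].
Qed.

Lemma two_to_one_homothety :
  two_to_one (@projline rat) (fun L => homothety_class (@Vproj R L)).
Proof.
move=> L [l [m [lm ->]]].
have char2 : (2 : rat) != 0 by [].
have lm' := iota_neq0 char2 lm.
apply/eq_cardSP; exists (proj l m); first by split=> //; exists l, m.
suff -> : (@projline rat `&` [set y | homothety_class (@Vproj R y) = homothety_class (@Vproj R (proj l m))])
          `\ proj l m = [set proj (l + m) (l - m)] by exact: card_set1.
apply/seteqP; split=> L'.
  move=> [[[l' [m' [lm2 ->]]] /=]]; rewrite !Vproj_proj => e ne.
  have : homothety_class (@Vpair R l m) (@Vpair R l' m').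
    by rewrite -e; split; [exact: Vpair_space|exact: homothetic_refl].
  by move=> [_ /(homothetic_Vpair lm lm2)[]].
move=> ->; split; last by move/(proj_iota_neq lm).
split; first by exists (l + m), (l - m).
rewrite /= !Vproj_proj; apply/esym/homothety_class_eq; exact: homothetic_iota.
Qed.

Lemma homothety_class_iota L : @projline rat L ->
  homothety_class (@Vproj R (iotaP L)) = homothety_class (@Vproj R L).
Proof.
move=> [l [m [lm ->]]]; rewrite iota_proj !Vproj_proj; apply/esym/homothety_class_eq.
exact: homothetic_iota.
Qed.

Lemma q4_scale (c a b e d : rat) :
  ratr c * q4 R a b e d = q4 R (c * a) (c * b) (c * e) (c * d).
Proof. by rewrite /q4 !rmorphM; ring. Qed.

Lemma q4_horner (p : {poly rat}) : exists a b c d, (map_poly ratr p).[z] = q4 R a b c d.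
Proof.
elim/poly_ind: p => [|p x [a [b [c [d e]]]]].
  by exists 0, 0, 0, 0; rewrite rmorph0 horner0 /q4 rmorph0; ring.
exists (x - d), a, b, c; rewrite rmorphD rmorphM /= map_polyX map_polyC hornerMXaddC e mulrC zeta8M_q4.
by rewrite /q4 rmorphB rmorphN; ring.
Qed.

(* The conjugate z |-> -z gives the relative norm to Q(i). *)
Lemma q4V a b c d : q4 R a b c d != 0 ->
  exists a' b' c' d', (q4 R a b c d)^-1 = q4 R a' b' c' d'.
Proof.
move=> x0; have hz := zeta8_4 R.
set e := a ^+ 2 - c ^+ 2 + 2 * b * d; set f := 2 * a * c - b ^+ 2 + d ^+ 2.
have xy : q4 R a b c d * q4 R a (- b) c (- d) = q4 R e 0 f 0.
  by rewrite /q4 /e /f; ring: hz.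
have n0 : e ^+ 2 + f ^+ 2 != 0.
  apply/eqP => /eqP; rewrite paddr_eq0 ?sqr_ge0 // !expf_eq0 /= => /andP[/eqP e0 /eqP f0].
  move: xy; rewrite e0 f0 => /eqP.
  rewrite {3}/q4 !rmorph0 !mul0r !addr0 mulf_eq0 (negPf x0) /= => /eqP/q4_eq0[a0 /eqP b0 c0 /eqP d0].
  move: b0 d0 x0; rewrite !oppr_eq0 a0 c0 => /eqP -> /eqP ->.
  by rewrite /q4 !rmorph0 !mul0r !addr0 eqxx.
set n := (e ^+ 2 + f ^+ 2)^-1.
exists (n * (a * e + c * f)), (n * - (b * e + d * f)), (n * (c * e - a * f)), (n * (b * f - d * e)).
apply: (mulfI x0); rewrite divff // -q4_scale mulrCA.
transitivity (ratr (n * (e ^+ 2 + f ^+ 2)) : C); first by rewrite /n mulVf // rmorph1.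
rewrite rmorphM /=; congr (_ * _); rewrite /q4 /e /f; ring: hz.
Qed.

Lemma q4M a b c d a' b' c' d' : exists a1 b1 c1 d1,
  q4 R a b c d * q4 R a' b' c' d' = q4 R a1 b1 c1 d1.
Proof.
have hz := zeta8_4 R.
exists (a * a' - b * d' - c * c' - d * b'), (a * b' + b * a' - c * d' - d * c'),
  (a * c' + b * b' + c * a' - d * d'), (a * d' + b * c' + c * b' + d * a').
by rewrite /q4; ring: hz.
Qed.

Lemma Qadjoin_q4 t : Qadjoin z t -> exists a b c d, t = q4 R a b c d.
Proof.
move=> [p [q [q0 ->]]]; have [a [b [c [d ->]]]] := q4_horner p.
have [a1 [b1 [c1 [d1 e1]]]] := q4_horner q.
by move: q0; rewrite e1 => /q4V[a2 [b2 [c2 [d2 ->]]]]; exact: q4M.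
Qed.

Lemma tau_of_squared_angle (t : C) : Qadjoin z t -> is_space (Qspan 1 t) ->
  t / conjc t = z -> exists l m : rat, (l, m) != (0, 0) /\ t = tau l m.
Proof.
move=> /Qadjoin_q4[a [b [c [d et]]]] _ h.
have t0 : conjc t != 0.
  by apply: contra_eq_neq h => ->; rewrite invr0 mulr0 eq_sym zeta8_neq0.
have : t = z * conjc t by rewrite -h divfK.
rewrite {2}et conj_q4 zeta8M_q4 opprK {1}et => /q4_inj[eb _ ec _].
have e : t = tau c b by rewrite et tauE eb ec opprK.
exists c, b; split=> //.
apply: contra_neq t0 => -[c0 b0].
by rewrite e c0 b0 tauE /q4 !(oppr0, rmorph0) !mul0r !addr0 conjc0.
Qed.

Lemma tau_half_angle (l m : rat) :
  tau l m = ratr l * (Num.sqrt (2 - Num.sqrt 2))%:C * zeta R 16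
          + ratr m * (Num.sqrt (2 + Num.sqrt 2))%:C * zeta R 16.
Proof.
set w := zeta R 16; have ew : w = expi (pi / 8) by rewrite /w /zeta; congr expi; field.
have w2 : z = w ^+ 2.
  by rewrite zeta8E ew expiMn; congr expi; rewrite -[RHS]mulr_natr; field.
have p0 := pi_gt0 R.
have c0 : 0 < cos (pi / 8 : R) by apply: cos_gt0_pihalf; apply/andP; split; lra.
have s0 : 0 < sin (pi / 8 : R) by apply: sin_gt0_pi; apply/andP; split; lra.
have h0 : 0 < cos (pi / 4 : R) by apply: cos_gt0_pihalf; apply/andP; split; lra.
have e1 := cos2Dsin2 (pi / 8 : R).
have e2 : cos (pi / 4 : R) = cos (pi / 8) ^+ 2 - sin (pi / 8) ^+ 2.
  have -> : pi / 4 = pi / 8 + pi / 8 :> R by field.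
  by rewrite cosD; ring.
have e3 : 2 * cos (pi / 4 : R) ^+ 2 = 1.
  have := zeta8_sqr R; rewrite zeta8E expiMn.
  have e4 := cos2Dsin2 (pi / 4 : R).
  have : cos (pi / 4 + pi / 4 : R) = 0 by rewrite -cos_pihalf; congr cos; field.
  by rewrite cosD => h _; lra.
(* Half-angle formulas turn the radicals into [2 sin (pi / 8)] and [2 cos (pi / 8)], which are then
   expressed through [w] and its conjugate, with [w ^ 4] equal to the imaginary unit. *)
have -> : Num.sqrt 2 = 2 * cos (pi / 4) :> R.
  transitivity (Num.sqrt ((2 * cos (pi / 4 : R)) ^+ 2)); first by congr Num.sqrt; rewrite exprMn; lra.
  by rewrite sqrtr_sqr gtr0_norm // mulr_gt0.
have -> : 2 - 2 * cos (pi / 4) = (2 * sin (pi / 8)) ^+ 2 :> R by rewrite exprMn; lra.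
have -> : 2 + 2 * cos (pi / 4) = (2 * cos (pi / 8)) ^+ 2 :> R by rewrite exprMn; lra.
rewrite !sqrtr_sqr !gtr0_norm ?mulr_gt0 //.
have w1 : w * conjc w = 1 by rewrite ew conjc_expi -expiD subrr expi0.
have -> : (2 * cos (pi / 8))%:C = w + conjc w.
  by rewrite ew /expi; simpc; congr (_ +i* _); ring.
have -> : (2 * sin (pi / 8))%:C = w ^+ 4 * (conjc w - w).
  have -> : w ^+ 4 = 'i%C by rewrite -zeta8_sqr w2 -exprM.
  by rewrite ew /expi; simpc; congr (_ +i* _); ring.
by rewrite /Defs.tau w2; ring: w1.
Qed.

Lemma not_sqamp2_sqamp4 (l m : rat) : (l, m) != (0, 0) -> ~ Sexc (proj l m) ->
  ~ (contains_sqamp (@Vpair R l m) (z ^+ 2) /\ contains_sqamp (@Vpair R l m) (z ^+ 4)).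
Proof.
move=> lm /(not_Sexc lm)[l0 m0 lm0 ln0] [].
move=> /(contains_sqamp2 R l0 m0 lm0 ln0)[u hu] /(contains_sqamp4 R l0 m0 lm0 ln0)[v hv].
have p0 : l ^+ 2 + m ^+ 2 != 0 by rewrite gt_eqF // form_p_gt0 //; left.
(* The quartics are [l (l + m) p] and [p (3 l^2 + 2 l m + m^2)] with the common factor
   [p = l^2 + m^2]; dividing their product by [p^2 l^4] leaves the cubic in [n = (l + m) / l]. *)
have : (u * v / ((l ^+ 2 + m ^+ 2) * l ^+ 2)) ^+ 2
    = (l + m) / l * (((l + m) / l) ^+ 2 + 2).
  by rewrite expr_div_n exprMn -hu -hv; field; rewrite l0 p0.
move=> /cubic_no_square/eqP; by rewrite mulf_eq0 invr_eq0 (negPf l0) (negPf ln0).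
Qed.

End Homothety.

(** * Rational tuples in the exceptional spaces *)

Section CyclotomicDegree.
Variable F : fieldType.
Variable iota : {rmorphism rat -> F}.

Lemma root_Cyclotomic (x : F) n :
  n.-primitive_root x -> root (map_poly intr 'Phi_n) x.
Proof.
move=> px; have n0 := prim_order_gt0 px.
have : root (map_poly intr (\prod_(d <- divisors n) 'Phi_d)) x.
  rewrite prod_Cyclotomic // rmorphB rmorph1 /= map_polyXn /root !hornerE.
  by rewrite (prim_expr_order px) subrr.
rewrite rmorph_prod /root horner_prod prodf_seq_eq0 => /hasP[d dn /= rd].
have d0 : (0 < d)%N by move: dn; rewrite -dvdn_divisors // => /dvdn_gt0; apply.
suff -> : n = d by [].
apply/eqP; rewrite eqn_dvd (dvdn_divisors d n0) dn andbT (prim_order_dvd px) -subr_eq0.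
have := prod_Cyclotomic d0; rewrite (big_rem d) /=; last by rewrite -dvdn_divisors.
move=> /(congr1 (fun p : {poly int} => (map_poly intr p : {poly F}).[x])).
rewrite rmorphM rmorphB rmorph1 /= map_polyXn !hornerE (eqP rd) mul0r => <-.
by rewrite eqxx.
Qed.

(** The minimal polynomial of a primitive root of unity is known in [algC], while [x] lives in [F].
    The rational gcd of [P] and the cyclotomic polynomial transfers the problem: it has the root
    [x], so it is not constant and has a root in [algC], again primitive of order [n]. *)
Lemma totient_lt_size (x : F) n (P : {poly rat}) : n.-primitive_root x ->
  P != 0 -> root (map_poly iota P) x -> (totient n < size P)%N.
Proof.
move=> px P0 rx; have n0 := prim_order_gt0 px.
pose g := gcdp (map_poly intr 'Phi_n) P.
have g0 : g != 0 by rewrite gcdp_eq0 negb_and P0 orbT.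
have rg : root (map_poly iota g) x.
  rewrite gcdp_map root_gcd rx andbT -map_poly_comp.
  have -> : map_poly (iota \o intr) 'Phi_n = map_poly intr 'Phi_n.
    by apply: eq_map_poly => k /=; rewrite rmorph_int.
  exact: root_Cyclotomic.
have sg : (1 < size g)%N by rewrite -(size_map_poly iota); apply: root_size_gt1 rg; rewrite map_poly_eq0.
have [y ry] : exists y : algC, root (map_poly ratr g) y.
  by apply/closed_rootP; rewrite size_map_poly gtn_eqF.
have py : n.-primitive_root y.
  have : root (map_poly ratr (map_poly intr 'Phi_n : {poly rat})) y.
    have /dvdpP[h ->] : g %| map_poly intr 'Phi_n by rewrite dvdp_gcdl.
    by rewrite rmorphM rootM ry orbT.
  have [w pw] := C_prim_root_exists n0.
  rewrite -map_poly_comp (eq_map_poly (fun k => rmorph_int _ k)).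
  by rewrite (Cintr_Cyclotomic pw) root_cyclotomic.
have [p [ep _] hp] := minCpolyP y.
have : p %| g by rewrite -hp.
move=> /dvdp_trans /(_ (dvdp_gcdr _ _)) /(dvdp_leq P0); apply: leq_trans.
rewrite -(size_map_poly (ratr : {rmorphism rat -> algC})) -ep (minCpoly_cyclotomic py).
by rewrite size_cyclotomic.
Qed.
End CyclotomicDegree.

Section RootsOfUnity.
Variable R : realType.
Local Notation z := (zeta R 8).

Lemma prim_root_zeta8 : 8.-primitive_root z.
Proof.
have [m pm m8] := prim_order_exists (isT : (0 < 8)%N) (zetaXn R (isT : (0 < 8)%N)).
have : m \in divisors 8 by rewrite -dvdn_divisors.
rewrite !inE => h; suff : ~~ (m %| 4)%N by case/or4P: h pm => /eqP ->.
rewrite (prim_order_dvd pm) zeta8_4 -subr_eq0 -opprD oppr_eq0.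
by rewrite (_ : 1 + 1 = 2%:R) ?pnatr_eq0.
Qed.

Lemma q4_totient a b c d n : n.-primitive_root (q4 R a b c d) -> (totient n <= 4)%N.
Proof.
move=> px; pose e := a ^+ 2 - c ^+ 2 + 2 * b * d; pose f := 2 * a * c - b ^+ 2 + d ^+ 2.
(* The characteristic polynomial. Over Q(i) the element is a root of
   [X^2 - 2 (a + c i) X + (e + f i)], where [e + f i] is its relative norm; [s] lists the
   coefficients of the product of this polynomial with its conjugate. *)
pose s := [:: e ^+ 2 + f ^+ 2; - 4 * (a * e + c * f); 4 * a ^+ 2 + 4 * c ^+ 2 + 2 * e; - 4 * a; 1].
have sP : (size (Poly s) <= 5)%N by exact: size_Poly.
rewrite -ltnS; apply: (leq_trans _ sP).
apply: (totient_lt_size (iota := ratr) px).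
  by apply/eqP => /(congr1 (fun p : {poly rat} => p`_4)); rewrite coef_Poly coef0 /= => /eqP.
rewrite /root (@horner_coef_wide _ 5) ?size_map_poly //.
rewrite !big_ord_recl big_ord0 !coef_map !coef_Poly /= /e /f /q4.
by have hz := zeta8_4 R; apply/eqP; ring: hz.
Qed.

Lemma q4X a b c d n : exists a1 b1 c1 d1, q4 R a b c d ^+ n = q4 R a1 b1 c1 d1.
Proof.
elim: n => [|n [a1 [b1 [c1 [d1 e]]]]]; last by rewrite exprS e; exact: q4M.
by exists 1, 0, 0, 0; rewrite /q4; ring.
Qed.

Lemma q4_unity_root a b c d n : (0 < n)%N -> q4 R a b c d ^+ n = 1 ->
  exists2 k, (k < 8)%N & q4 R a b c d = z ^+ k.
Proof.
move=> n0 xn; have pz := prim_root_zeta8.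
have [N pN _] := prim_order_exists n0 xn; have N0 := prim_order_gt0 pN.
have a16 : ~~ (16 %| N)%N.
  apply/negP => /(dvdn_prim_root pN); have [? [? [? [? ->]]]] := q4X a b c d (N %/ 16).
  by move/q4_totient.
have [m cop eN] := pfactor_coprime (isT : prime 2) N0.
have m0 : (0 < m)%N by move: N0; rewrite eN muln_gt0 => /andP[].
have cop8 : coprime 8 m by rewrite (_ : 8 = 2 ^ 3)%N // coprimeXl.
(* For a root [nu] of odd order [m], the order of [z * nu] is [8 m], whose totient is 4 times that
   of [m]. *)
have m1 : m = 1%N.
  have mN : (m %| N)%N by rewrite eN dvdn_mulr.
  have pnu := dvdn_prim_root pN mN.
  set nu := q4 R a b c d ^+ _ in pnu.
  have w1 : (z * nu) ^+ (8 * m) = 1.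
    by rewrite exprMn exprM (prim_expr_order pz) expr1n mul1r mulnC exprM (prim_expr_order pnu) expr1n.
  have m8 : (0 < 8 * m)%N by rewrite muln_gt0.
  have [k pk km] := prim_order_exists m8 w1.
  have mk : (m %| k)%N.
    rewrite -(@Gauss_dvdr m 8) 1?coprime_sym // (prim_order_dvd pnu).
    have : (z * nu) ^+ (8 * k) = 1 by rewrite mulnC exprM (prim_expr_order pk) expr1n.
    by rewrite exprMn exprM (prim_expr_order pz) expr1n mul1r => ->.
  have k8 : (8 %| k)%N.
    have /eqP e : nu ^+ k == 1 by rewrite -(prim_order_dvd pnu).
    by have := prim_expr_order pk; rewrite (prim_order_dvd pz) exprMn e mulr1 => ->.
  have ek : k = (8 * m)%N by apply/eqP; rewrite eqn_dvd km Gauss_dvd // k8.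
  have : (totient k <= 4)%N.
    move: pk; rewrite /nu; have [? [? [? [? ->]]]] := q4X a b c d (N %/ m).
    by rewrite zeta8M_q4 => /q4_totient.
  rewrite ek totient_coprime // (_ : totient 8 = 4%N) // -[X in (_ <= X)%N]muln1 leq_pmul2l //.
  rewrite leqNgt totient_gt1 -leqNgt.
  by move: m0 cop; clear; case: m => [|[|[|]]].
suff : q4 R a b c d ^+ 8 = 1 by move=> /(prim_rootP pz)[[k k8] ->]; exists k.
apply/eqP; rewrite -(prim_order_dvd pN) eN m1 mul1n.
rewrite (_ : 8 = 2 ^ 3)%N // dvdn_exp2l // leqNgt.
by apply: contra a16 => h; rewrite (_ : 16 = 2 ^ 4)%N // pfactor_dvdn.
Qed.

End RootsOfUnity.

Section RationalTuples.
Variable R : realType.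
Local Notation C := R[i].
Local Notation z := (zeta R 8).

Lemma rational_angle_sqamp l m x1 y1 x2 y2 : l != 0 \/ m != 0 ->
    rational_angle (@Vpair R l m) (vec R l m x1 y1) (vec R l m x2 y2) ->
  x2 * y1 != x1 * y2 /\ exists2 k, (1 <= k <= 4)%N &
    angle_eqs l m k x1 y1 x2 y2 \/ angle_eqs l m k x2 y2 x1 y1.
Proof.
move=> lm h; set v := vec R l m x1 y1 in h *; set w := vec R l m x2 y2 in h *.
have ind : x2 * y1 != x1 * y2 by apply/(vec_indep R lm); case: h.
split=> //; have [n n0 e] := rational_angle_unity h.
have F0 : w * conjc v != 0.
  apply/eqP => F0; case: h => _ _ /R_independentP + _.
  by rewrite -(conj_vec_mul_conj R l m x2 y2 x1 y1) F0 conjc0 eqxx.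
have [a [b [c [d eF]]]] : exists a b c d, v * conjc w / (w * conjc v) = q4 R a b c d.
  move: F0; rewrite !vec_mul_conj => /q4V[? [? [? [? ->]]]]; exact: q4M.
have [k k8 ek] : exists2 k, (k < 8)%N & v * conjc w = z ^+ k * (w * conjc v).
  have [|k k8 ek] := @q4_unity_root R a b c d n n0.
    by rewrite -eF expr_div_n e divff // expf_neq0.
  by exists k => //; rewrite -ek -eF divfK.
have k0 : k != 0%N.
  by apply: contra_neq ind => k0; move: ek; rewrite k0; apply: (angle_eqsP R (k := 0) x1 y1 x2 y2 isT lm).1.
case: (leqP k 4) => k4.
  by exists k; rewrite ?k4 ?lt0n ?k0 //; left; apply/(angle_eqsP R).
(* Exchanging the two vectors inverts the squared amplitude, replacing [k] by [8 - k]. *)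
exists (8 - k)%N; first by lia.
right; apply/(angle_eqsP R); [lia|done|].
rewrite -/v -/w ek mulrA -exprD subnK 1?ltnW //.
by rewrite zetaXn // mul1r.
Qed.

Lemma vec_rational_angle l m k x1 y1 x2 y2 : l != 0 \/ m != 0 -> (k <= 4)%N ->
  x2 * y1 != x1 * y2 -> angle_eqs l m k x1 y1 x2 y2 \/ angle_eqs l m k x2 y2 x1 y1 ->
  rational_angle (@Vpair R l m) (vec R l m x1 y1) (vec R l m x2 y2).
Proof. by move=> lm k4 ind h; have [] := (vec_sqamp R lm x1 y1 x2 y2 k4).2 (conj ind h). Qed.

Lemma rational_angle_scale (V : set C) (k v w : C) : k != 0 ->
  rational_angle V v w -> rational_angle ((fun x => k * x) @` V) (k * v) (k * w).
Proof.
move=> k0 [Vv Vw ind [r [q [r0 e]]]]; split; [by exists v|by exists w| |].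
  move=> a b; rewrite mulrCA [b%:C * _]mulrCA -mulrDr => /eqP.
  by rewrite mulf_eq0 (negPf k0) => /eqP /ind.
by exists r, q; rewrite -mulf_div divff // mul1r.
Qed.

Lemma homothetic_of_type (V W : set C) ns : homothetic V W -> of_type V ns -> of_type W ns.
Proof.
move=> [k k0 ->] [ts [sz tup dis]].
exists (map (map (fun x => k * x)) ts); split.
- by rewrite -map_comp -sz; apply: eq_map => s /=; rewrite size_map.
- move=> _ /mapP[s /tup[Vs hs] ->]; split.
    by move=> _ /mapP[v /Vs Vv ->]; exists v.
  move=> i j; rewrite size_map => /andP[ij js].
  rewrite !(nth_map 0) ?(ltn_trans ij) //; apply: rational_angle_scale => //.
  by apply: hs; rewrite ij.
move=> i j; rewrite size_map => /andP[ij js].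
rewrite !(nth_map [::]) ?(ltn_trans ij) // => _ _ /mapP[v vs ->] /mapP[w ws ->] [r r0 e].
have /dis : (i < j < size ts)%N by rewrite ij.
by move=> /(_ v w vs ws); apply; exists r => //; apply: (mulfI k0); rewrite e mulrCA.
Qed.

End RationalTuples.

(** * The triples of V_[1:0] and the quadruple of V_[0:1] *)

Section SpecialSpaces.
Variable R : realType.
Local Notation C := R[i].
Local Notation z := (zeta R 8).
Local Notation tau := (@tau R).
Local Notation V := (@Vpair R).

Definition in_lines (s : seq (rat * rat)) (x y : rat) : Prop :=
  exists2 p, p \in s & exists2 c : rat, c != 0 & x = c * p.1 /\ y = c * p.2.

Definition lines1 : seq (rat * rat) := [:: (1, 1); (-2, 1); (-2^-1, 1)].
Definition lines2 : seq (rat * rat) := [:: (1, 0); (0, 1); (-1, 1)].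

(** At [(1, 0)] the equations for [k] at most 3 have explicit solutions, all among the six listed
    lines, whereas [k = 4] with [y1] and [y2] nonzero leads to [(s - 1)^2 = 3]. Any rational angle
    thus stays inside one of the two triples, which makes them the only ones. *)
Lemma angle_eqs10_lines k x1 y1 x2 y2 : (1 <= k <= 4)%N -> x2 * y1 != x1 * y2 ->
  angle_eqs 1 0 k x1 y1 x2 y2 ->
  in_lines lines1 x1 y1 /\ in_lines lines1 x2 y2 \/
  in_lines lines2 x1 y1 /\ in_lines lines2 x2 y2.
Proof.
move=> k14 ind e.
have in1 (x y c : rat) p : p \in lines1 -> c != 0 -> x = c * p.1 -> y = c * p.2 -> in_lines lines1 x y.
  by move=> *; exists p => //; exists c.
have in2 (x y c : rat) p : p \in lines2 -> c != 0 -> x = c * p.1 -> y = c * p.2 -> in_lines lines2 x y.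
  by move=> *; exists p => //; exists c.
have [y10|y10] := eqVneq y1 0.
  have x10 : x1 != 0 by apply: contra_neq ind => ->; rewrite y10; ring.
  have y20 : y2 != 0 by apply: contra_neq ind => ->; rewrite y10; ring.
  move: e; rewrite y10; case: k k14 => [|[|[|[|[|k]]]]] //= _ [e1 e2].
  - by case/eqP: (mulf_neq0 x10 y20); lra.
  - right; split; first by apply: (in2 _ _ x1 (1, 0)) => //=; lra.
    apply: (in2 _ _ y2 (-1, 1)) => //=; last lra.
    by apply: (mulfI x10); lra.
  - by case/eqP: (mulf_neq0 x10 y20); lra.
  - by case/eqP: (mulf_neq0 x10 y20); lra.
have [y20|y20] := eqVneq y2 0.
  have x20 : x2 != 0 by apply: contra_neq ind => ->; rewrite y20; ring.
  have n0 := mulf_neq0 x20 y10.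
  move: e; rewrite y20; case: k k14 => [|[|[|[|[|k]]]]] //= _ [e1 e2].
  - right; split; last by apply: (in2 _ _ x2 (1, 0)) => //=; lra.
    apply: (in2 _ _ y1 (0, 1)) => //=; last lra.
    by apply: (mulIf x20); lra.
  - by case/eqP: n0; lra.
  - by case/eqP: n0; lra.
  - by case/eqP: n0; lra.
have [s es] : exists s, x1 = s * y1 by exists (x1 / y1); rewrite divfK.
have [t et] : exists t, x2 = t * y2 by exists (x2 / y2); rewrite divfK.
move: e; rewrite es et (angle_eqs_scale 1 0 k s t y10 y20).
have st : s != t by apply: contra_neq ind => st; rewrite es et st; ring.
case: k k14 => [|[|[|[|[|k]]]]] //= _ [e1 e2].
- have s1 : s = 1 by lra.
  have t1 : t = -2 by move: e2; rewrite s1; lra.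
  by left; split; [apply: (in1 _ _ y1 (1, 1)); rewrite ?s1 //=|apply: (in1 _ _ y2 (-2, 1)); rewrite ?t1 //=]; lra.
- have t1 : t = 1 by lra.
  have s1 : s = -2^-1 by move: e2; rewrite t1; lra.
  by left; split; [apply: (in1 _ _ y1 (-2^-1, 1)); rewrite ?s1 //=|apply: (in1 _ _ y2 (1, 1)); rewrite ?t1 //=]; lra.
- have t1 : t = 2 * s - 1 by lra.
  have : s * (2 * s + 1) = 0 by move: e2; rewrite t1; lra.
  move=> /eqP; rewrite mulf_eq0 => /orP[/eqP s1|/eqP s1].
    have t2 : t = -1 by lra.
    by right; split; [apply: (in2 _ _ y1 (0, 1)); rewrite ?s1 //=|apply: (in2 _ _ y2 (-1, 1)); rewrite ?t2 //=]; lra.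
  have s2 : s = -2^-1 by lra.
  have t2 : t = -2 by lra.
  by left; split; [apply: (in1 _ _ y1 (-2^-1, 1)); rewrite ?s2 //=|apply: (in1 _ _ y2 (-2, 1)); rewrite ?t2 //=]; lra.
have t1 : t = 2 - s by lra.
have /eqP : (s - 1) ^+ 2 = 3 by move: e2; rewrite t1; lra.
by rewrite (negPf (@nonsquare_int 3 1 isT isT (s - 1))).
Qed.

Lemma in_lines_disjoint x y : in_lines lines1 x y -> in_lines lines2 x y -> False.
Proof.
move=> [p p1 [c c0 [-> ->]]] [q q2 [d d0 []]]; move: p1 q2; rewrite !inE.
by move=> /or3P[]/eqP -> /or3P[]/eqP -> /= e1 e2; case/eqP: c0; lra.
Qed.

Lemma Qprop_not_indep (u v w : C) : R_independent v w -> Qproportional v u ->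
  Qproportional w u -> False.
Proof.
move=> ind [r r0 er] [s s0 es]; have [] := ind (ratr r) (- ratr s).
  by rewrite rmorphN /= -!ratr_complex -er es; ring.
by move/eqP; rewrite fmorph_eq0 (negPf r0).
Qed.

(** The choice of a proportional entry is an injective map of a finite set to itself, hence a
    bijection. *)
Lemma same_triple (u v : 'I_3 -> C) :
  (forall i, exists j, Qproportional (v i) (u j)) ->
  (forall i i' j, Qproportional (v i) (u j) -> Qproportional (v i') (u j) -> i = i') ->
  same_tuple (codom v) (codom u).
Proof.
move=> /choice[f hf] inj; have finj : injective f.
  by move=> i i' e; apply: (inj i i' (f i)); [exact: hf|rewrite e; exact: hf].
have [g _ gK] := injF_bij finj.
split=> [_ /codomP[i ->]|_ /codomP[j ->]]; first by exists (u (f i)) => //; exact: codom_f.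
by exists (v (g j)); [exact: codom_f|rewrite -{2}(gK j); exact: hf].
Qed.

Lemma codom_ord3 (v : 'I_3 -> C) : codom v = [:: v i0; v i1; v i2].
Proof.
rewrite /codom /image_mem !enum_ordSl enum_ord0 /=.
by congr [:: v _; v _; v _]; apply: val_inj.
Qed.

Definition vec_seq l m (ps : seq (rat * rat)) : seq C := [seq vec R l m p.1 p.2 | p <- ps].

Lemma rational_tuple_vec l m ps : l != 0 \/ m != 0 ->
  (forall i j, (i < j < size ps)%N -> exists2 k, (k <= 4)%N &
     let p := nth (0, 0) ps i in let q := nth (0, 0) ps j in
     q.1 * p.2 != p.1 * q.2 /\
     (angle_eqs l m k p.1 p.2 q.1 q.2 \/ angle_eqs l m k q.1 q.2 p.1 p.2)) ->
  rational_tuple (V l m) (vec_seq l m ps).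
Proof.
move=> lm h; split=> [_ /mapP[p _ ->]|i j]; first exact: Vpair_vec.
rewrite size_map => /andP[ij js].
rewrite !(nth_map (0, 0)) ?(ltn_trans ij) //.
have [|k k4 [ind e]] := h i j; first by rewrite ij.
exact: vec_rational_angle k4 ind e.
Qed.

Lemma rational_triple1 : rational_tuple (V 1 0) (vec_seq 1 0 lines1).
Proof.
apply: rational_tuple_vec; first by left.
move=> i j ij; have : (i, j) \in [:: (0, 1); (0, 2); (1, 2)]%N.
  by move: ij; rewrite !inE !xpair_eqE /=; lia.
rewrite !inE => /or3P[]/eqP[-> ->]; [exists 1%N|exists 2%N|exists 3%N] => //; cbn [nth lines1 lines2 fst snd angle_eqs]; (split; first by []).
- by left; split; ring.
- by right; split; field.
- by right; split; field.
Qed.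

Lemma rational_triple2 : rational_tuple (V 1 0) (vec_seq 1 0 lines2).
Proof.
apply: rational_tuple_vec; first by left.
move=> i j ij; have : (i, j) \in [:: (0, 1); (0, 2); (1, 2)]%N.
  by move: ij; rewrite !inE !xpair_eqE /=; lia.
rewrite !inE => /or3P[]/eqP[-> ->]; [exists 1%N|exists 2%N|exists 3%N] => //; cbn [nth lines1 lines2 fst snd angle_eqs]; (split; first by []).
- by right; split; ring.
- by left; split; ring.
- by left; split; ring.
Qed.

Definition quadruple : seq (rat * rat) := [:: (1, 0); (0, 1); (-1, 1); (-2, 1)].

Lemma rational_quadruple : rational_tuple (V 0 1) (vec_seq 0 1 quadruple).
Proof.
apply: rational_tuple_vec; first by right.
move=> i j ij; have : (i, j) \in [:: (0, 1); (0, 2); (0, 3); (1, 2); (1, 3); (2, 3)]%N.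
  by move: ij; rewrite !inE !xpair_eqE /=; lia.
rewrite !inE => /or4P[/eqP|/eqP|/eqP|/or3P[]/eqP] [-> ->];
  [exists 1%N|exists 2%N|exists 3%N|exists 1%N|exists 4%N|exists 3%N] => //; cbn [nth lines1 lines2 quadruple fst snd angle_eqs]; (split; first by []).
- by right; split; ring.
- by right; split; ring.
- by left; split; ring.
- by right; split; ring.
- by left; split; ring.
- by right; split; ring.
Qed.

Lemma vec_seq_lines1 : vec_seq 1 0 lines1 = [:: tau 1 0 + 1; tau 1 0 - 2; tau 1 0 - 2^-1].
Proof.
rewrite /vec_seq /= /vec !rmorph1 !mul1r !rmorphN fmorphV !rmorph_nat /=.
by congr [:: _; _; _]; exact: addrC.
Qed.

Lemma vec_seq_lines2 : vec_seq 1 0 lines2 = [:: 1; tau 1 0; tau 1 0 - 1].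
Proof.
rewrite /vec_seq /= /vec !(rmorph0, rmorph1) !mul1r mul0r !rmorphN rmorph1 addr0 add0r.
by congr [:: _; _; _]; exact: addrC.
Qed.

Lemma vec_seq_quadruple : vec_seq 0 1 quadruple = [:: 1; tau 0 1; tau 0 1 - 1; tau 0 1 - 2].
Proof.
rewrite /vec_seq /= /vec !(rmorph0, rmorph1) !mul1r mul0r !rmorphN rmorph1 rmorph_nat addr0 add0r.
by congr [:: _; _; _; _]; exact: addrC.
Qed.

Lemma same_tuple_lines ps (s : seq C) : size ps = 3%N -> size s = 3%N ->
  (forall i, (i < 3)%N -> exists x y, s`_i = vec R 1 0 x y /\ in_lines ps x y) ->
  (forall i j, (i < j < 3)%N -> R_independent s`_i s`_j) ->
  same_tuple s (vec_seq 1 0 ps).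
Proof.
move=> ps3 s3 hs ind.
have codomE (t : seq C) : size t = 3%N -> codom (fun i : 'I_3 => t`_i) = t.
  by rewrite codom_ord3; case: t => [|a [|b [|c [|d t]]]].
rewrite -(codomE s) // -(codomE (vec_seq 1 0 ps)) ?size_map //; apply: same_triple.
  move=> i; have [x [y [-> [p pp [c c0 [ex ey]]]]]] := hs i (ltn_ord i).
  have ip : (index p ps < 3)%N by rewrite -ps3 index_mem.
  exists (Ordinal ip); rewrite (nth_map (0, 0)) ?ps3 //= nth_index //.
  by apply: (@Qprop_vec R 1 0 _ _ _ _ c^-1); rewrite ?invr_eq0 // ?ex ?ey mulKf.
have lt (i j k : 'I_3) : Qproportional s`_i (vec_seq 1 0 ps)`_k ->
    Qproportional s`_j (vec_seq 1 0 ps)`_k -> (i < j)%N -> False.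
  move=> h1 h2 ij; apply: (Qprop_not_indep (ind i j _) h1 h2).
  by rewrite ij ltn_ord.
move=> i j k h1 h2; case: (ltngtP i j) => [ij|ij|/val_inj //].
  by case: (lt i j k h1 h2 ij).
by case: (lt j i k h2 h1 ij).
Qed.

Lemma rational_triples s : size s = 3%N -> rational_tuple (V 1 0) s ->
  same_tuple s (vec_seq 1 0 lines1) \/ same_tuple s (vec_seq 1 0 lines2).
Proof.
move=> s3 [Vs hs].
have lm : (1 : rat) != 0 \/ (0 : rat) != 0 by left.
have Vi i : (i < 3)%N -> exists x y, s`_i = vec R 1 0 x y.
  by move=> i3; apply/VpairP/Vs/mem_nth; rewrite s3.
have [x0 [y0 e0]] := Vi 0%N isT; have [x1 [y1 e1]] := Vi 1%N isT.
have [x2 [y2 e2]] := Vi 2%N isT.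
have pair i j x y x' y' : (i < j < 3)%N -> s`_i = vec R 1 0 x y -> s`_j = vec R 1 0 x' y' ->
  in_lines lines1 x y /\ in_lines lines1 x' y' \/ in_lines lines2 x y /\ in_lines lines2 x' y'.
  move=> ij ei ej; have := hs i j; rewrite s3 => /(_ ij).
  rewrite ei ej => /(rational_angle_sqamp lm)[ind [k k14 [h|h]]].
    exact: angle_eqs10_lines ind h.
  by rewrite eq_sym in ind; have [[]|[]] := angle_eqs10_lines k14 ind h; [left|right].
have ind i j : (i < j < 3)%N -> R_independent s`_i s`_j.
  by move=> ij; have := hs i j; rewrite s3 => /(_ ij)[].
have := pair _ _ _ _ _ _ (isT : (0 < 1 < 3)%N) e0 e1.
have := pair _ _ _ _ _ _ (isT : (0 < 2 < 3)%N) e0 e2.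
move=> [[a0 a2]|[a0 a2]] [[b0 b1]|[b0 b1]].
- left; apply: same_tuple_lines => // -[|[|[|i]]] // _; by [exists x0, y0|exists x1, y1|exists x2, y2].
- by case: (in_lines_disjoint a0 b0).
- by case: (in_lines_disjoint b0 a0).
- right; apply: same_tuple_lines => // -[|[|[|i]]] // _; by [exists x0, y0|exists x1, y1|exists x2, y2].
Qed.

Lemma triples_disjoint : Qdisjoint (vec_seq 1 0 lines1) (vec_seq 1 0 lines2).
Proof.
have lm : (1 : rat) != 0 \/ (0 : rat) != 0 by left.
move=> _ _ /mapP[p pp ->] /mapP[q qq ->] /(Qprop_vecE lm)[c [c0 e1 e2]].
have n1 : (1 : rat) != 0 := oner_neq0 _.
apply: (@in_lines_disjoint q.1 q.2); first by exists p => //; exists c.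
by exists q => //; exists 1; rewrite // !mul1r.
Qed.

Lemma quadruple_sqamp k : (1 <= k <= 4)%N -> exists v w,
  [/\ v \in vec_seq 0 1 quadruple, w \in vec_seq 0 1 quadruple
    & angle_sqamp (V 0 1) (z ^+ k) v w].
Proof.
have lm : (0 : rat) != 0 \/ (1 : rat) != 0 by right.
move=> k14; suff [p [q [pq qq ind e]]] : exists p q,
    [/\ p \in quadruple, q \in quadruple, q.1 * p.2 != p.1 * q.2 &
        angle_eqs 0 1 k p.1 p.2 q.1 q.2 \/ angle_eqs 0 1 k q.1 q.2 p.1 p.2].
  exists (vec R 0 1 p.1 p.2), (vec R 0 1 q.1 q.2); split.
  - exact: (map_f (fun p => vec R 0 1 p.1 p.2)).
  - exact: (map_f (fun p => vec R 0 1 p.1 p.2)).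
  - by apply/(vec_sqamp R lm) => //; case/andP: k14.
have [|k2] := eqVneq k 1%N; first (move=> ->; exists (1, 0), (0, 1); split => //; cbn [fst snd angle_eqs]).
  by right; split; ring.
have [|k3] := eqVneq k 2%N; first (move=> ->; exists (1, 0), (-1, 1); split => //; cbn [fst snd angle_eqs]).
  by right; split; ring.
have [|k4] := eqVneq k 3%N; first (move=> ->; exists (1, 0), (-2, 1); split => //; cbn [fst snd angle_eqs]).
  by left; split; ring.
have -> : k = 4%N by lia.
exists (0, 1), (-2, 1); split => //; cbn [fst snd angle_eqs].
by left; split; ring.
Qed.

Lemma rhombus_quadruple : let t := tau 0 1 in
  exists A B D E : C, rhombus A B D E (pi / 4) (3 * pi / 4) /\
    same_tuple [:: B - A; E - A; D - A; E - B] [:: 1; t; t - 1; t - 2].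
Proof.
have et : tau 0 1 = 1 + z by rewrite /Defs.tau rmorph0 rmorph1; ring.
have z0 := zeta8_neq0 R; have hz := zeta8_4 R.
(* As [tau 0 1 = 1 + z], the rhombus spanned by [1] and [z] has sides [1] and [t - 1] and diagonals
   [t] and [t - 2]. *)
move=> t; exists 0, 1, t, z; rewrite !subr0 /t et {t et}.
have -> : 1 + z - 1 = z by ring.
have -> : 1 + z - 2 = z - 1 by ring.
split.
  split; rewrite ?subr0 ?sub0r //.
  - by ring.
  - rewrite normr1 zeta8E /expi normc_def /= cos2Dsin2 sqrtr1 //.
  - by exists 1 => //; rewrite divr1 mul1r zeta8E.
  exists 1 => //; rewrite mul1r.
  have -> : 3 * pi / 4 = pi / 4 *+ 3 :> R by rewrite -[RHS]mulr_natl; field.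
  rewrite -expiMn -zeta8E (_ : 1 + z - 1 = z); last by ring.
  by apply: (mulIf z0); rewrite divfK // -exprSr hz.
have Q1 v : Qproportional v v by exists 1; rewrite ?oner_neq0 ?rmorph1 ?mul1r.
by split=> v hv; exists v => //; move: hv; rewrite !inE => /or4P[]/eqP ->; rewrite eqxx ?orbT.
Qed.

Lemma of_type_quadruple L : L = proj 0 1 \/ L = proj (-1) 1 -> of_type (@Vproj R L) [:: 4%N].
Proof.
have type01 : of_type (V 0 1) [:: 4%N].
  exists [:: vec_seq 0 1 quadruple]; split=> // [s|i j /= ij]; last by exfalso; lia.
  by rewrite inE => /eqP ->; exact: rational_quadruple.
case=> ->; rewrite Vproj_proj //; apply: homothetic_of_type type01.
rewrite (@Vpair_proj R (-1) 1 (0 + 1) (0 - 1)); first exact: homothetic_iota.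
by apply/projP; exists (-1) => //; split; ring.
Qed.

Lemma of_type_triples L : L = proj 1 0 \/ L = proj 1 1 -> of_type (@Vproj R L) [:: 3%N; 3%N].
Proof.
have type10 : of_type (V 1 0) [:: 3%N; 3%N].
  exists [:: vec_seq 1 0 lines1; vec_seq 1 0 lines2]; split=> // [s|i j].
    rewrite !inE => /orP[]/eqP ->; [exact: rational_triple1|exact: rational_triple2].
  move=> ij; have [-> ->] : i = 0%N /\ j = 1%N by move: ij => /=; lia.
  exact: triples_disjoint.
case=> ->; rewrite Vproj_proj //; apply: homothetic_of_type type10.
rewrite (@Vpair_proj R 1 1 (1 + 0) (1 - 0)); first exact: homothetic_iota.
by apply/projP; exists 1 => //; split; ring.
Qed.

(** Multiplication by [w = z^2 + z + 1] sends [1] and [tau 1 0] to [w] and [w - 1]. *)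
Lemma homothetic_V10 : homothetic (V 1 0) (Qspan 1 (z ^+ 2 + z + 1)).
Proof.
have hz := zeta8_4 R; set w := z ^+ 2 + z + 1.
have et : w * tau 1 0 = w - 1.
  by rewrite /w /Defs.tau rmorph0 rmorph1; ring: hz.
have w0 : w != 0.
  by apply/eqP => w0; move/eqP: et; rewrite w0 mul0r sub0r eq_sym oppr_eq0 oner_eq0.
exists w => //; apply/seteqP; split=> [_ [x [y ->]]|_ [_ [x [y ->]] <-]].
  exists (ratr (x + y) * 1 + ratr (- x) * tau 1 0); first by exists (x + y), (- x).
  by rewrite mulrDr mulrCA [w * (_ * tau _ _)]mulrCA et rmorphD rmorphN /=; ring.
exists (- y), (x + y).
by rewrite mulrDr mulrCA [w * (_ * tau _ _)]mulrCA et rmorphD rmorphN /=; ring.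
Qed.

End SpecialSpaces.

(** * Smoothness and genus *)

Section Evaluation.
Variables (F : numFieldType) (P : 'I_3 -> F).
Implicit Types p q : mpoly 3 rat.

Lemma pevalD p q : peval (p + q) P = peval p P + peval q P.
Proof. exact: (rmorphD (mmap ratr P)). Qed.
Lemma pevalN p : peval (- p) P = - peval p P.
Proof. exact: (rmorphN (mmap ratr P)). Qed.
Lemma pevalM p q : peval (p * q) P = peval p P * peval q P.
Proof. exact: (rmorphM (mmap ratr P)). Qed.
Lemma pevalX p n : peval (p ^+ n) P = peval p P ^+ n.
Proof. exact: (rmorphXn (mmap ratr P)). Qed.
Lemma pevalZ c p : peval (c *: p) P = ratr c * peval p P.
Proof. exact: (mmapZ P ratr c p). Qed.
Lemma peval0 : peval 0 P = 0.
Proof. exact: (rmorph0 (mmap ratr P)). Qed.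
Lemma peval1 : peval 1 P = 1.
Proof. exact: (rmorph1 (mmap ratr P)). Qed.
Lemma peval_coord i : peval (coordX i) P = P i.
Proof. by rewrite /peval /coordX mmapX mmap1U. Qed.
End Evaluation.

Lemma mderiv_coord (i j : 'I_3) : mderiv i (coordX j) = (i == j)%:R.
Proof.
rewrite /coordX mderivX mnm1E eq_sym; have [->|_] := eqVneq; last by rewrite scale0r.
rewrite scale1r -mpolyX0; congr (mpolyX _ _); apply/mnmP => k.
by rewrite mnmBE subnn mnm0E.
Qed.

Section Homogeneous.
Variable w : 'I_3 -> nat.
Implicit Types p q : mpoly 3 rat.

Lemma whomogD d p q : whomog w d p -> whomog w d q -> whomog w d (p + q).
Proof. by move=> hp hq; apply: rpredD. Qed.
Lemma whomogN d p : whomog w d p -> whomog w d (- p).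
Proof. by move=> hp; apply: rpredNr. Qed.
Lemma whomogZ d c p : whomog w d p -> whomog w d (c *: p).
Proof. by move=> hp; apply: rpredZ. Qed.
Lemma whomogM d e p q : whomog w d p -> whomog w e q -> whomog w (d + e) (p * q).
Proof. exact: dhomogM. Qed.
Lemma whomog1 : whomog w 0 1.
Proof. exact: dhomog1. Qed.
Lemma whomogX d n p : whomog w d p -> whomog w (d * n) (p ^+ n).
Proof. exact: dhomogMn. Qed.
Lemma whomog_coord i : whomog w (w i) (coordX i).
Proof.
apply/dhomogP => m; rewrite /coordX msuppX inE => /eqP -> /=.
rewrite /wdeg (bigD1 i) //= mnm1E eqxx muln1 big1 ?addn0 // => j ne.
by rewrite mnm1E eq_sym (negPf ne) muln0.
Qed.
End Homogeneous.

Section Curves.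
Variables (F : numFieldType) (P : 'I_3 -> F).
Local Notation X := (P i0).
Local Notation Y := (P i1).
Local Notation Z := (P i2).

Definition pevalE := (pevalD, pevalN, pevalM, pevalX, pevalZ, peval_coord, peval0, peval1).

Lemma peval_curveU : peval curveU P =
  Z ^+ 2 - X * (X ^+ 3 + X ^+ 2 * Y + X * Y ^+ 2 + Y ^+ 3).
Proof. by rewrite /curveU !pevalE. Qed.

Lemma peval_curveV : peval curveV P =
  Z ^+ 2 - (3 * X ^+ 4 + 2 * X ^+ 3 * Y + 4 * X ^+ 2 * Y ^+ 2 + 2 * X * Y ^+ 3 + Y ^+ 4).
Proof. by rewrite /curveV !pevalE !rmorph_nat; ring. Qed.

Lemma peval_wcubic E : peval (wcubic E) P =
  Y ^+ 2 * Z + ratr (wa1 E) * (X * Y * Z) + ratr (wa3 E) * (Y * Z ^+ 2)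
  - (X ^+ 3 + ratr (wa2 E) * (X ^+ 2 * Z) + ratr (wa4 E) * (X * Z ^+ 2) + ratr (wa6 E) * Z ^+ 3).
Proof. by rewrite /wcubic !pevalE. Qed.

Lemma peval_mderivM i p q :
  peval (mderiv i (p * q)) P = peval (mderiv i p) P * peval q P + peval p P * peval (mderiv i q) P.
Proof. by rewrite mderivM !pevalE. Qed.

Lemma peval_mderivX i p n :
  peval (mderiv i (p ^+ n)) P = peval p P ^+ n.-1 * peval (mderiv i p) P *+ n.
Proof.
elim: n => [|n IHn]; first by rewrite expr0 -mpolyC1 mderivC peval0.
rewrite exprS peval_mderivM IHn pevalE; case: n {IHn} => [|n].
  by rewrite !expr0 mulr0n mulr0 addr0 mulr1 mul1r.
by rewrite mulrnAr mulrA -exprS [RHS]mulrS; congr (_ + _); exact: mulrC.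
Qed.

Lemma peval_mderivD i p q : peval (mderiv i (p + q)) P = peval (mderiv i p) P + peval (mderiv i q) P.
Proof. by rewrite mderivD pevalE. Qed.
Lemma peval_mderivN i p : peval (mderiv i (- p)) P = - peval (mderiv i p) P.
Proof. by rewrite mderivN pevalE. Qed.
Lemma peval_mderivZ i c p : peval (mderiv i (c *: p)) P = ratr c * peval (mderiv i p) P.
Proof. by rewrite mderivZ pevalE. Qed.
Lemma peval_mderiv_coord i j : peval (mderiv i (coordX j)) P = (i == j)%:R.
Proof. by rewrite mderiv_coord; case: (i == j); rewrite ?peval1 ?peval0. Qed.

Definition pderivE := (peval_mderivD, peval_mderivN, peval_mderivZ, peval_mderivX,
  peval_mderivM, peval_mderiv_coord).

Lemma curveU_partials : [/\ peval (mderiv i2 curveU) P = 2 * Z,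
  peval (mderiv i0 curveU) P = - (4 * X ^+ 3 + 3 * X ^+ 2 * Y + 2 * X * Y ^+ 2 + Y ^+ 3)
  & peval (mderiv i1 curveU) P = - (X ^+ 3 + 2 * X ^+ 2 * Y + 3 * X * Y ^+ 2)].
Proof. by rewrite /curveU; split; rewrite !pderivE !pevalE /=; ring. Qed.

Lemma curveV_partials : [/\ peval (mderiv i2 curveV) P = 2 * Z,
  peval (mderiv i0 curveV) P = - (12 * X ^+ 3 + 6 * X ^+ 2 * Y + 8 * X * Y ^+ 2 + 2 * Y ^+ 3)
  & peval (mderiv i1 curveV) P = - (2 * X ^+ 3 + 8 * X ^+ 2 * Y + 6 * X * Y ^+ 2 + 4 * Y ^+ 3)].
Proof. by rewrite /curveV; split; rewrite !pderivE !pevalE /=; ring. Qed.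

Lemma wcubic_partials E : [/\
  peval (mderiv i0 (wcubic E)) P = ratr (wa1 E) * (Y * Z)
    - (3 * X ^+ 2 + 2 * ratr (wa2 E) * (X * Z) + ratr (wa4 E) * Z ^+ 2),
  peval (mderiv i1 (wcubic E)) P = 2 * (Y * Z) + ratr (wa1 E) * (X * Z) + ratr (wa3 E) * Z ^+ 2
  & peval (mderiv i2 (wcubic E)) P = Y ^+ 2 + ratr (wa1 E) * (X * Y) + 2 * ratr (wa3 E) * (Y * Z)
    - (ratr (wa2 E) * X ^+ 2 + 2 * ratr (wa4 E) * (X * Z) + 3 * ratr (wa6 E) * Z ^+ 2)].
Proof. by rewrite /wcubic; split; rewrite !pderivE !pevalE /=; ring. Qed.
End Curves.

Lemma ord3P (i : 'I_3) : [\/ i = i0, i = i1 | i = i2].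
Proof. by case: i => [[|[|[|i]]] h] //; [constructor 1|constructor 2|constructor 3]; apply: val_inj. Qed.

Lemma natmul_exp_eq0 (F : numFieldType) (n : nat) (x : F) k : n.+1%:R * x ^+ k.+1 = 0 -> x = 0.
Proof.
move=> /eqP; rewrite mulf_eq0 pnatr_eq0 /= expf_eq0 => /andP[_ /eqP //].
Qed.

Section Smoothness.
Variable P : 'I_3 -> algC.
Local Notation X := (P i0).
Local Notation Y := (P i1).
Local Notation Z := (P i2).

Lemma curveU_XY : points curveU P -> X != 0 \/ Y != 0.
Proof.
move=> [[i hi]]; rewrite peval_curveU => h; have [X0|] := eqVneq X 0; last by left.
right; apply/eqP => Y0; move: h; rewrite X0 mul0r subr0 => /eqP; rewrite expf_eq0 /= => /eqP Z0.
by move: hi; case: (ord3P i) => ->; rewrite ?X0 ?Y0 ?Z0 eqxx.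
Qed.

Lemma curveV_XY : points curveV P -> X != 0 \/ Y != 0.
Proof.
move=> [[i hi]]; rewrite peval_curveV => h; have [X0|] := eqVneq X 0; last by left.
right; apply/eqP => Y0; have Z0 : Z = 0.
  apply: (@natmul_exp_eq0 _ 0 _ 1); rewrite mul1r -{}h X0 Y0; ring.
by move: hi; case: (ord3P i) => ->; rewrite ?X0 ?Y0 ?Z0 eqxx.
Qed.

Lemma weight1_nonzero : X != 0 \/ Y != 0 -> exists i, w112 i = 1%N /\ P i != 0.
Proof. by case=> h; [exists i0|exists i1]; split. Qed.

Lemma smooth_criterion (p : mpoly 3 rat) :
  ~ [/\ peval (mderiv i0 p) P = 0, peval (mderiv i1 p) P = 0 & peval (mderiv i2 p) P = 0] ->
  exists j, peval (mderiv j p) P != 0.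
Proof.
move=> h; have [h0|] := eqVneq (peval (mderiv i0 p) P) 0; last by exists i0.
have [h1|] := eqVneq (peval (mderiv i1 p) P) 0; last by exists i1.
by exists i2; apply/eqP => h2; apply: h.
Qed.
End Smoothness.

Lemma smooth_curveU : smooth_curve w112 curveU.
Proof.
move=> P hP; have XY := curveU_XY hP; split; first exact: weight1_nonzero.
apply: smooth_criterion; have [-> -> ->] := curveU_partials P => -[/eqP + /eqP + _].
rewrite !oppr_eq0 => /eqP A0 /eqP B0.
(* Elimination between two partial derivatives: the combinations below equal 16 times the fifth
   power of each coordinate, up to sign. Both arguments of [natmul_exp_eq0] are one less than the
   numbers meant. *)
case: XY => /eqP; apply; apply: (@natmul_exp_eq0 _ 15 _ 4).
  transitivity ((4 * P i0 ^+ 2 - 3 * P i0 * P i1) * 0 + P i1 ^+ 2 * 0 : algC); last by ring.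
  by rewrite -{1}A0 -B0; ring.
transitivity ((5 * P i0 ^+ 2 + 10 * P i0 * P i1 + 16 * P i1 ^+ 2) * 0
  - (20 * P i0 ^+ 2 + 15 * P i0 * P i1 + 14 * P i1 ^+ 2) * 0 : algC); last by ring.
by rewrite -{1}A0 -B0; ring.
Qed.

Lemma smooth_curveV : smooth_curve w112 curveV.
Proof.
move=> P hP; have XY := curveV_XY hP; split; first exact: weight1_nonzero.
apply: smooth_criterion; have [-> -> ->] := curveV_partials P => -[/eqP + /eqP + _].
rewrite !oppr_eq0 => /eqP A0 /eqP B0.
case: XY => /eqP; apply; apply: (@natmul_exp_eq0 _ 63 _ 4).
  transitivity ((7 * P i0 ^+ 2 + 3 * P i0 * P i1 - 2 * P i1 ^+ 2) * 0
    + (P i1 ^+ 2 - 10 * P i0 ^+ 2 + P i0 * P i1) * 0 : algC); last by ring.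
  by rewrite -{1}A0 -B0; ring.
transitivity ((6 * P i1 ^+ 2 - 7 * P i0 ^+ 2 - 21 * P i0 * P i1) * 0
  + (42 * P i0 ^+ 2 - 21 * P i0 * P i1 + 13 * P i1 ^+ 2) * 0 : algC); last by ring.
by rewrite -{1}A0 -B0; ring.
Qed.

Lemma smooth_wcubicU : smooth_curve w111 (wcubic EU).
Proof.
move=> P [[i hi]]; rewrite peval_wcubic /= !rmorph0 !rmorph1 => hP.
split; first by exists i; split=> //; case: (ord3P i) => ->.
apply: smooth_criterion; have [-> -> ->] := wcubic_partials P EU.
rewrite /= !rmorph0 !rmorph1 => -[A0 B0 C0].
have [Z0|Z0] := eqVneq (P i2) 0.
  have X0 : P i0 = 0 by apply: (@natmul_exp_eq0 _ 0 _ 2); apply: oppr_inj; rewrite oppr0 mul1r -[RHS]hP Z0; ring.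
  have Y0 : P i1 = 0 by apply: (@natmul_exp_eq0 _ 0 _ 1); rewrite mul1r -C0 Z0 X0; ring.
  by move: hi; case: (ord3P i) => ->; rewrite ?X0 ?Y0 ?Z0 eqxx.
have Y0 : P i1 = 0.
  apply/eqP; have /eqP : P i1 * (2 * P i2) = 0 by rewrite -B0; ring.
  by rewrite mulf_eq0 mulf_eq0 pnatr_eq0 (negPf Z0) !orbF.
case/eqP: Z0; apply: (@natmul_exp_eq0 _ 3 _ 3).
have p0 : P i0 ^+ 3 + P i0 ^+ 2 * P i2 + P i0 * P i2 ^+ 2 + P i2 ^+ 3 = 0.
  by apply: oppr_inj; rewrite oppr0 -[RHS]hP Y0; ring.
have q0 : 3 * P i0 ^+ 2 + 2 * P i0 * P i2 + P i2 ^+ 2 = 0.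
  by apply: oppr_inj; rewrite oppr0 -[RHS]A0; ring.
transitivity ((4 * P i2 - 3 * P i0) * 0 + (P i0 ^+ 2 - P i0 * P i2) * 0 : algC); last by ring.
by rewrite -{1}p0 -q0; ring.
Qed.

Lemma smooth_wcubicV : smooth_curve w111 (wcubic EV).
Proof.
move=> P [[i hi]]; rewrite peval_wcubic /= !(rmorphN, rmorph_nat, rmorph0) => hP.
split; first by exists i; split=> //; case: (ord3P i) => ->.
apply: smooth_criterion; have [-> -> ->] := wcubic_partials P EV.
rewrite /= !(rmorphN, rmorph_nat, rmorph0) => -[A0 B0 C0].
have [Z0|Z0] := eqVneq (P i2) 0.
  have X0 : P i0 = 0 by apply: (@natmul_exp_eq0 _ 0 _ 2); apply: oppr_inj; rewrite oppr0 mul1r -[RHS]hP Z0; ring.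
  have Y0 : P i1 = 0 by apply: (@natmul_exp_eq0 _ 0 _ 1); rewrite mul1r -C0 Z0 X0; ring.
  by move: hi; case: (ord3P i) => ->; rewrite ?X0 ?Y0 ?Z0 eqxx.
have Y0 : P i1 = P i2 - P i0.
  apply/eqP; rewrite -subr_eq0; have /eqP : (P i1 - (P i2 - P i0)) * (2 * P i2) = 0 by rewrite -B0; ring.
  by rewrite mulf_eq0 mulf_eq0 pnatr_eq0 (negPf Z0) !orbF.
case/eqP: Z0; apply: (@natmul_exp_eq0 _ 127 _ 3).
have p0 : P i0 ^+ 3 - 5 * P i0 ^+ 2 * P i2 - 5 * P i0 * P i2 ^+ 2 + P i2 ^+ 3 = 0.
  by apply: oppr_inj; rewrite oppr0 -[RHS]hP Y0; ring.
have q0 : 10 * P i0 * P i2 + 5 * P i2 ^+ 2 - 3 * P i0 ^+ 2 = 0.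
  by rewrite -[RHS]A0 Y0; ring.
transitivity ((53 * P i2 - 15 * P i0) * 0
  + (26 * P i0 * P i2 + 15 * P i2 ^+ 2 - 5 * P i0 ^+ 2) * 0 : algC); last by ring.
by rewrite -{1}p0 -q0; ring.
Qed.

(* [form n g]: g is a rational binary form of degree n - 1 (zero if n = 0). *)
Definition form (n : nat) (g : algC -> algC -> algC) : Prop :=
  exists2 alpha : {poly rat}, (size alpha <= n)%N &
    forall l m, g l m = \sum_(i < n) ratr alpha`_i * l ^+ (n.-1 - i) * m ^+ i.

Section Forms.
Implicit Types (g h : algC -> algC -> algC).

Lemma form0 n : form n (fun _ _ => 0).
Proof.
exists 0; first by rewrite size_poly0.
by move=> l m; rewrite big1 // => i _; rewrite coef0 rmorph0 !mul0r.
Qed.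

Lemma form_ext n g h : (forall l m, g l m = h l m) -> form n g -> form n h.
Proof. by move=> e [al sz E]; exists al => // l m; rewrite -e. Qed.

Lemma formD n g h : form n g -> form n h -> form n (fun l m => g l m + h l m).
Proof.
move=> [al sal eal] [be sbe ebe]; exists (al + be).
  by rewrite (leq_trans (size_polyD _ _)) // geq_max sal.
move=> l m; rewrite eal ebe -big_split; apply: eq_bigr => i _ /=.
by rewrite coefD rmorphD /= !mulrDl.
Qed.

Lemma formZ n c g : form n g -> form n (fun l m => ratr c * g l m).
Proof.
move=> [al sal eal]; exists (c *: al); first exact: leq_trans (size_scale_leq _ _) sal.
move=> l m; rewrite eal mulr_sumr; apply: eq_bigr => i _.
by rewrite coefZ rmorphM /= !mulrA.
Qed.

Lemma form_l n g : form n g -> form n.+1 (fun l m => l * g l m).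
Proof.
move=> [al sal eal]; exists al; first exact: leqW.
move=> l m; rewrite big_ord_recr /= nth_default // rmorph0 !mul0r addr0.
rewrite eal mulr_sumr; apply: eq_bigr => -[i /= i_n] _.
have -> : (n - i = (n.-1 - i).+1)%N by lia.
by rewrite exprS; ring.
Qed.

Lemma form_m n g : form n g -> form n.+1 (fun l m => m * g l m).
Proof.
move=> [al sal eal]; exists (al * 'X).
  have [->|al0] := eqVneq al 0; first by rewrite mul0r size_poly0.
  by rewrite size_mulX.
move=> l m; rewrite big_ord_recl coefMX /= rmorph0 !mul0r add0r.
rewrite eal mulr_sumr; apply: eq_bigr => -[i /= i_n] _.
rewrite coefMX /bump /= add1n /=.
have -> : (n - i.+1 = n.-1 - i)%N by lia.
by rewrite exprS; ring.
Qed.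

Lemma form_monomial a b n g : form n g -> form (a + b + n) (fun l m => l ^+ a * m ^+ b * g l m).
Proof.
move=> hg; have hb : form (b + n) (fun l m => m ^+ b * g l m).
  elim: b => [|b IHb]; first by apply: form_ext hg => l m; rewrite expr0 mul1r.
  by apply: form_ext (form_m IHb) => l m; rewrite exprS mulrA.
elim: a => [|a IHa]; first by apply: form_ext hb => l m; rewrite expr0 mul1r.
by apply: form_ext (form_l IHa) => l m; rewrite exprS !mulrA.
Qed.

Lemma form_horner n (al : {poly rat}) (l m : algC) : (size al <= n)%N -> l != 0 ->
  \sum_(i < n) ratr al`_i * l ^+ (n.-1 - i) * m ^+ i = l ^+ n / l * (map_poly ratr al).[m / l].
Proof.
move=> sz l0; rewrite (@horner_coef_wide _ n) ?size_map_poly // mulr_sumr.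
apply: eq_bigr => -[i /= i_n] _; rewrite coef_map /= expr_div_n.
have -> : n = ((n.-1 - i) + i).+1 by lia.
by rewrite exprSr exprD mulfK //= addnK; field; rewrite expf_neq0.
Qed.
End Forms.

(** * The genus through the cohomology of the cover by two charts *)

Section GenusOne.
Variables (p : mpoly 3 rat) (a0 a1 a2 a3 a4 : rat).
Definition quartic (l m : algC) : algC :=
  ratr a0 * l ^+ 4 + ratr a1 * (l ^+ 3 * m) + ratr a2 * (l ^+ 2 * m ^+ 2)
  + ratr a3 * (l * m ^+ 3) + ratr a4 * m ^+ 4.
Hypothesis pE : forall P : 'I_3 -> algC, peval p P = P i2 ^+ 2 - quartic (P i0) (P i1).
Hypothesis XY : forall P : 'I_3 -> algC, points p P -> P i0 != 0 \/ P i1 != 0.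
(** Guarantees two distinct points of the curve above each of the infinitely many values 1, 2, 3,
    ... of [m / l]. *)
Hypothesis quartic_neq0 : forall n : nat, quartic 1 n.+1%:R != 0.

Lemma form_quartic n g : form n g -> form (4 + n) (fun l m => quartic l m * g l m).
Proof.
move=> hg.
have f0 := formZ a0 (form_monomial 4 0 hg); have f1 := formZ a1 (form_monomial 3 1 hg).
have f2 := formZ a2 (form_monomial 2 2 hg); have f3 := formZ a3 (form_monomial 1 3 hg).
have f4 := formZ a4 (form_monomial 0 4 hg).
apply: form_ext (formD (formD (formD (formD f0 f1) f2) f3) f4) => l m.
by rewrite /quartic; ring.
Qed.

Lemma form_quarticX a b q : form (a + b + 4 * q).+1 (fun l m => l ^+ a * m ^+ b * quartic l m ^+ q).
Proof.
have h : form (4 * q).+1 (fun l m => quartic l m ^+ q).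
  elim: q => [|q IHq].
    exists 1; first by rewrite size_poly1.
    by move=> l m; rewrite big_ord1 coef1 rmorph1 !expr0 !mul1r.
  by rewrite mulnS -addnS; apply: form_ext (form_quartic IHq) => l m; rewrite exprS.
by rewrite -addnS; exact: form_monomial.
Qed.

(* On the curve, a form of degree d is A + u B, with A and B binary forms. *)
Lemma peval_normal_form d G : whomog w112 d G -> exists A B,
  [/\ form d.+1 A, form d.-1 B &
   forall P, points p P -> peval G P = A (P i0) (P i1) + P i2 * B (P i0) (P i1)].
Proof.
move=> /dhomogP hG; rewrite /peval /mmap.
elim: (msupp G) hG => [|mon s IHs] hG.
  exists (fun _ _ => 0), (fun _ _ => 0); split; [exact: form0|exact: form0|].
  by move=> P _; rewrite big_nil mulr0 addr0.
have [|A [B [fA fB e]]] := IHs; first by move=> k ks; apply: hG; rewrite inE ks orbT.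
have hd : (mon i0 + mon i1 + 2 * mon i2)%N = d.
  have := hG mon (mem_head _ _); rewrite /= /wdeg !big_ord_recl big_ord0 /= => <-.
  rewrite /w112 /vec3 !(tnth_nth 0%N) /= !mul1n addn0 addnA.
  by congr (mon _ + mon _ + 2 * mon _)%N; apply: val_inj.
have e1 (P : 'I_3 -> algC) : mmap1 P mon = P i0 ^+ mon i0 * P i1 ^+ mon i1 * P i2 ^+ mon i2.
  rewrite /mmap1 !big_ord_recl big_ord0 mulr1 mulrA.
  by congr (P _ ^+ mon _ * P _ ^+ mon _ * P _ ^+ mon _); apply: val_inj.
set q := (mon i2)./2; have fq := formZ (mcoeff mon G) (form_quarticX (mon i0) (mon i1) q).
have u2 P : points p P -> P i2 ^+ 2 = quartic (P i0) (P i1).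
  by move=> [_ /eqP]; rewrite pE subr_eq0 => /eqP.
have hu P : points p P -> P i2 ^+ mon i2 = P i2 ^+ odd (mon i2) * quartic (P i0) (P i1) ^+ q.
  move=> hP; rewrite -{1}(odd_double_half (mon i2)) exprD -/q -mul2n exprM.
  by rewrite u2.
case: (boolP (odd (mon i2))) => par; rewrite ?par ?(negPf par) in hu.
  exists A, (fun l m => ratr (mcoeff mon G) * (l ^+ mon i0 * m ^+ mon i1 * quartic l m ^+ q) + B l m).
  split=> //.
    apply: formD fB; suff -> : d.-1 = (mon i0 + mon i1 + 4 * q).+1 by [].
    by rewrite -hd /q; have := odd_double_half (mon i2); rewrite par -mul2n; lia.
  by move=> P hP; rewrite big_cons e // e1 hu // expr1; ring.
exists (fun l m => ratr (mcoeff mon G) * (l ^+ mon i0 * m ^+ mon i1 * quartic l m ^+ q) + A l m), B.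
split=> //.
  apply: formD fA; suff -> : d = (mon i0 + mon i1 + 4 * q)%N by [].
  by rewrite -hd /q; have := odd_double_half (mon i2); rewrite (negPf par) -mul2n; lia.
by move=> P hP; rewrite big_cons e // e1 hu // expr0 mul1r; ring.
Qed.

(** A regular function on the chart [l != 0], in the affine coordinates [t = m / l] and
    [u / l^2]. *)
Definition laur (al be : {poly rat}) (P : 'I_3 -> algC) : algC :=
  (map_poly ratr al).[P i1 / P i0] + P i2 / P i0 ^+ 2 * (map_poly ratr be).[P i1 / P i0].

Lemma form_laur D (al be : {poly rat}) (P : 'I_3 -> algC) : (size al <= D.+1)%N -> (size be <= D.-1)%N ->
  P i0 != 0 ->
  \sum_(i < D.+1) ratr al`_i * P i0 ^+ (D - i) * P i1 ^+ i
  + P i2 * \sum_(i < D.-1) ratr be`_i * P i0 ^+ (D.-1.-1 - i) * P i1 ^+ i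
  = P i0 ^+ D * laur al be P.
Proof.
move=> sal sbe l0; rewrite (form_horner _ sal l0) (form_horner _ sbe l0) /laur exprSr mulfK //.
case: D sal sbe => [|D] sal sbe /=.
  by move: sbe; rewrite size_poly_leq0 => /eqP ->; rewrite rmorph0 horner0; ring.
by rewrite exprS; field; rewrite l0.
Qed.

Lemma laur_homog D (al be : {poly rat}) : (size al <= D.+1)%N -> (size be <= D.-1)%N ->
  exists2 G, whomog w112 D G & forall P : 'I_3 -> algC, P i0 != 0 ->
    peval G P = P i0 ^+ D * laur al be P.
Proof.
move=> sal sbe.
exists (\sum_(i < D.+1) al`_i *: (coordX i0 ^+ (D - i) * coordX i1 ^+ i)
  + coordX i2 * \sum_(i < D.-1) be`_i *: (coordX i0 ^+ (D.-1.-1 - i) * coordX i1 ^+ i)).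
  have hom (e i : nat) : whomog w112 (e + i) (coordX i0 ^+ e * coordX i1 ^+ i).
    have := whomogM (whomogX e (whomog_coord w112 i0)) (whomogX i (whomog_coord w112 i1)).
    by rewrite !mul1n.
  apply: whomogD.
    apply: rpred_sum => -[i /= iD] _; apply: whomogZ.
    by have := hom (D - i)%N i; rewrite subnK.
  case: (leqP D 1) => D1.
    case: D D1 {sal sbe} => [|[|]] // _; rewrite big_ord0 mulr0; exact: rpred0.
  have -> : D = (2 + D.-1.-1)%N by lia.
  apply: whomogM; first exact: (whomog_coord w112 i2).
  apply: rpred_sum => -[i /= iD] _; apply: whomogZ.
  by have := hom (D.-1.-1 - i)%N i; rewrite subnK //; lia.
move=> P l0; rewrite -form_laur // pevalD pevalM peval_coord.
have sumE n (g : 'I_n -> mpoly 3 rat) : peval (\sum_i g i) P = \sum_i peval (g i) P.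
  exact: (rmorph_sum (mmap ratr P)).
by rewrite !sumE; congr (_ + _ * _); apply: eq_bigr => i _; rewrite !pevalE mulrA.
Qed.

Lemma homog_laur d G : whomog w112 d G -> exists al be : {poly rat},
  [/\ (size al <= d.+1)%N, (size be <= d.-1)%N,
   forall P : 'I_3 -> algC, points p P -> P i0 != 0 -> peval G P = P i0 ^+ d * laur al be P &
   forall P : 'I_3 -> algC, points p P -> peval G P =
     \sum_(i < d.+1) ratr al`_i * P i0 ^+ (d - i) * P i1 ^+ i
     + P i2 * \sum_(i < d.-1) ratr be`_i * P i0 ^+ (d.-1.-1 - i) * P i1 ^+ i].
Proof.
move=> /peval_normal_form[A [B [[al sal eal] [be sbe ebe] e]]].
exists al, be; split=> // P hP; last by rewrite e // eal ebe.
by move=> l0; rewrite -form_laur // e // eal ebe.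
Qed.

Lemma poly_nat_roots (q : {poly rat}) :
  (forall N : nat, (map_poly ratr q).[N.+1%:R] = 0 :> algC) -> q = 0.
Proof.
move=> h; apply/eqP; apply: contraT => q0.
have := @max_poly_roots _ (map_poly ratr q : {poly algC}) [seq N.+1%:R | N <- iota 0 (size q)].
rewrite map_poly_eq0 size_map_poly size_map size_iota ltnn; apply=> //.
  by apply/allP => _ /mapP[N _ ->]; apply/eqP.
rewrite map_inj_uniq ?iota_uniq // => i j /eqP; rewrite eqr_nat => /eqP[]. exact.
Qed.

(** At the points [(1, N + 1, y)] and [(1, N + 1, - y)], sum and difference separate the two
    polynomials, and agreement at infinitely many [N] suffices. *)
Lemma eq_on_samples (al be al' be' : {poly rat}) :
  (forall P : 'I_3 -> algC, points p P -> P i0 = 1 -> P i1 != 0 ->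
     (map_poly ratr al).[P i1] + P i2 * (map_poly ratr be).[P i1]
     = (map_poly ratr al').[P i1] + P i2 * (map_poly ratr be').[P i1]) ->
  al = al' /\ be = be'.
Proof.
move=> h; have key N : (map_poly ratr al).[N.+1%:R] = (map_poly ratr al').[N.+1%:R] :> algC
    /\ (map_poly ratr be).[N.+1%:R] = (map_poly ratr be').[N.+1%:R] :> algC.
  pose y := sqrtC (quartic 1 N.+1%:R); have y0 : y != 0 by rewrite sqrtC_eq0.
  have N0 : N.+1%:R != 0 :> algC by rewrite pnatr_eq0.
  have pt u : u ^+ 2 = quartic 1 N.+1%:R -> points p (vec3 1 N.+1%:R u).
    move=> hu; split; first by exists i0; rewrite oner_neq0.
    by rewrite pE /vec3 !(tnth_nth 0) /= hu subrr.
  have h1 := h _ (pt y (sqrtCK _)) erefl N0.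
  have hN : (- y) ^+ 2 = quartic 1 N.+1%:R by rewrite sqrrN sqrtCK.
  have h2 := h _ (pt (- y) hN) erefl N0.
  move: h1 h2; rewrite /vec3 !(tnth_nth 0) /= => h1 h2.
  set s := (map_poly ratr al).[_] in h1 h2 *; set s' := (map_poly ratr al').[_] in h1 h2 *.
  set t := (map_poly ratr be).[_] in h1 h2 *; set t' := (map_poly ratr be').[_] in h1 h2 *.
  have n2 : (2 : algC) != 0 by rewrite pnatr_eq0.
  split; first by apply: (mulfI n2); transitivity (s + y * t + (s - y * t)); [ring|rewrite h1 -mulNr h2; ring].
  apply: (mulfI n2); apply: (mulfI y0).
  by transitivity (s + y * t - (s - y * t)); [ring|rewrite h1 -mulNr h2; ring].
split; apply/eqP; rewrite -subr_eq0; apply/eqP/poly_nat_roots => N.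
  by rewrite rmorphB !hornerE (key N).1 subrr.
by rewrite rmorphB !hornerE (key N).2 subrr.
Qed.

Lemma regular_on0 f : regular_on w112 p [set i0]%SET f -> exists al be : {poly rat},
  forall P : 'I_3 -> algC, points p P -> P i0 != 0 -> f P = laur al be P.
Proof.
move=> [k [G [hG e]]]; rewrite big_set1 muln1 in hG.
have [al [be [_ _ E _]]] := homog_laur hG; exists al, be => P hP l0.
rewrite e // => [|i]; last by rewrite inE => /eqP ->.
by rewrite big_set1 E // mulrC mulKf // expf_neq0.
Qed.

(** On [m != 0] a function is [t^-n (al + (u / l^2) be)]; the bounds [n] on the degree of [al] and
    [n - 2] on that of [be] express regularity where [l = 0]. The second formula covers the points
    with [l = 0]. *)
Lemma regular_on1 f : regular_on w112 p [set i1]%SET f -> exists (n : nat) (al be : {poly rat}),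
  [/\ (size al <= n.+1)%N, (size be <= n.-1)%N,
   forall P : 'I_3 -> algC, points p P -> P i0 != 0 -> P i1 != 0 ->
     f P = (P i0 / P i1) ^+ n * laur al be P &
   forall P : 'I_3 -> algC, points p P -> P i1 != 0 -> f P =
     (\sum_(i < n.+1) ratr al`_i * P i0 ^+ (n - i) * P i1 ^+ i
     + P i2 * \sum_(i < n.-1) ratr be`_i * P i0 ^+ (n.-1.-1 - i) * P i1 ^+ i) / P i1 ^+ n].
Proof.
move=> [k [G [hG e]]]; rewrite big_set1 muln1 in hG.
have E P : points p P -> P i1 != 0 -> f P = peval G P / P i1 ^+ k i1.
  by move=> hP m0; rewrite e // ?big_set1 // => i; rewrite inE => /eqP ->.
have [al [be [sal sbe E1 E2]]] := homog_laur hG; exists (k i1), al, be; split=> // P hP.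
  by move=> l0 m0; rewrite E // E1 // expr_div_n mulrAC.
by move=> m0; rewrite E // E2.
Qed.

(** Comparing the two charts gives [al' = t^n al] and [be' = t^n be], and the degree bounds leave a
    constant for [al] and nothing for [be]. *)
Lemma regular_functions_constant f : regular_on w112 p [set i0]%SET f ->
  regular_on w112 p [set i1]%SET f ->
  exists c : rat, forall P : 'I_3 -> algC, points p P -> f P = ratr c.
Proof.
move=> /regular_on0[al [be e0]] /regular_on1[n [al' [be' [sal sbe e1 e2]]]].
have [eal ebe] : 'X^n * al = al' /\ 'X^n * be = be'.
  apply: eq_on_samples => P hP l1 m0.
  have l0 : P i0 != 0 by rewrite l1 oner_neq0.
  have := e0 _ hP l0; rewrite (e1 _ hP l0 m0) /laur l1 !divr1 expr1n divr1.
  rewrite mul1r => /(congr1 (fun x => P i1 ^+ n * x)); rewrite exprVn mulrA mulfV ?expf_neq0 // mul1r => ->.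
  by rewrite !rmorphM /= !map_polyXn !(hornerM, hornerXn); ring.
have be0 : be = 0.
  apply/eqP; apply: contraTT sbe => be0; rewrite -ebe mulrC size_mulXn // -ltnNge.
  by rewrite -size_poly_gt0 in be0; lia.
have : (size al <= 1)%N.
  have [->|al0] := eqVneq al 0; first by rewrite size_poly0.
  by move: sal; rewrite -eal mulrC size_mulXn // -addn1 leq_add2l.
move=> /size1_polyC; set c := al`_0 => ealc; exists c => P hP.
case: (XY hP) => h0.
  by rewrite e0 // /laur be0 ealc map_polyC rmorph0 !hornerE ?mulr0 ?addr0.
rewrite e2 // -ebe -eal be0 ealc mulr0 big_ord_recr /= subnn expr0 mulr1.
rewrite [X in P i2 * X]big1 => [|i _]; last by rewrite coef0 rmorph0 !mul0r.
rewrite big1 => [|i _]; last by rewrite coefXnM ltn_ord rmorph0 !mul0r.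
by rewrite coefXnM ltnn subnn coefC eqxx mulr0 addr0 add0r mulfK // expf_neq0.
Qed.

(** This is [(u / l^2) t^-1]. The function [(u / l^2) t^-k] is regular on [l != 0] for [k <= 0] and
    on [m != 0] for [k >= 2], so only [k = 1] is missed. *)
Definition h1_class (P : 'I_3 -> algC) : algC := P i2 / (P i0 * P i1).

(** After multiplication by [t^(N + 1)] the class contributes in degree [N], the functions on
    [l != 0] in degrees above [N] and those on [m != 0] in degrees below [N] to the coefficient of
    [u / l^2]. *)
Lemma h1_class_nontrivial (c c' : rat) f1 f1' f2 f2' :
  regular_on w112 p [set i0]%SET f1 -> regular_on w112 p [set i0]%SET f1' ->
  regular_on w112 p [set i1]%SET f2 -> regular_on w112 p [set i1]%SET f2' ->
  (forall P : 'I_3 -> algC, points p P -> P i0 != 0 -> P i1 != 0 ->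
     ratr c * h1_class P + f1 P + f2 P = ratr c' * h1_class P + f1' P + f2' P) ->
  c = c'.
Proof.
move=> /regular_on0[al1 [be1 e1]] /regular_on0[al1' [be1' e1']].
move=> /regular_on1[n [al2 [be2 [_ sbe2 e2 _]]]] /regular_on1[n' [al2' [be2' [_ sbe2' e2' _]]]] h.
pose N := (n + n')%N.
have [_ /(congr1 (fun q : {poly rat} => q`_N))] :
    'X^(N.+1) * al1 + 'X^(n'.+1) * al2 = 'X^(N.+1) * al1' + 'X^(n.+1) * al2'
  /\ c *: 'X^N + 'X^(N.+1) * be1 + 'X^(n'.+1) * be2 = c' *: 'X^N + 'X^(N.+1) * be1' + 'X^(n.+1) * be2'.
  apply: eq_on_samples => P hP l1 m0.
  have l0 : P i0 != 0 by rewrite l1 oner_neq0.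
  have := h P hP l0 m0; rewrite e1 // e1' // e2 // e2' // /laur /h1_class l1 !divr1 expr1n divr1.
  move=> /(congr1 (fun x => P i1 ^+ N.+1 * x)); rewrite !mul1r.
  rewrite !rmorphD !rmorphM /= !map_polyZ !map_polyXn /= !(hornerD, hornerM, hornerZ, hornerXn) !exprS /N !exprD.
  set s1 := (map_poly ratr al1).[_]; set t1 := (map_poly ratr be1).[_].
  set s1' := (map_poly ratr al1').[_]; set t1' := (map_poly ratr be1').[_].
  set s2 := (map_poly ratr al2).[_]; set t2 := (map_poly ratr be2).[_].
  set s2' := (map_poly ratr al2').[_]; set t2' := (map_poly ratr be2').[_].
  move=> E; transitivity (P i1 * (P i1 ^+ n * P i1 ^+ n') * (ratr c * (P i2 / P i1) + (s1 + P i2 * t1) + (1 / P i1) ^+ n * (s2 + P i2 * t2))).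
    by rewrite expr_div_n expr1n; field; rewrite m0 expf_neq0.
  transitivity (P i1 * (P i1 ^+ n * P i1 ^+ n') * (ratr c' * (P i2 / P i1) + (s1' + P i2 * t1') + (1 / P i1) ^+ n' * (s2' + P i2 * t2'))).
    by rewrite !mul1r; exact: E.
  by rewrite expr_div_n expr1n; field; rewrite m0 expf_neq0.
rewrite !coefD !coefZ !coefXn eqxx !mulr1 !coefXnM ltnSn !addr0.
have z (be : {poly rat}) (k k' : nat) : N = (k + k')%N -> (size be <= k.-1)%N ->
    (if (N < k'.+1)%N then 0 else be`_(N - k'.+1)) = 0.
  by move=> -> sz; case: ifP => // /negbT h'; apply: nth_default; apply: leq_trans sz _; lia.
by rewrite (z be2 n n') // (z be2' n' n) ?addr0 // /N addnC.
Qed.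

Lemma take_poly_last (be : {poly rat}) k :
  take_poly k be = take_poly k.-1 be + (take_poly k be)`_k.-1 *: 'X^(k.-1).
Proof.
apply/polyP => i; rewrite coefD coefZ coefXn !coef_take_poly.
case: k => [|k] /=; first by rewrite mul0r addr0.
rewrite ltnSn ltnS leq_eqVlt; have [->|ne] /= := eqVneq i k; first by rewrite ltnn mulr1 add0r.
by rewrite mulr0 addr0.
Qed.

(** The function is [t^-k1 (al + (u / l^2) be)]. Terms of degree at least [k1] are regular on
    [l != 0], the lower ones on [m != 0], except the term of degree [k1 - 1] of [be], which gives
    the class. *)
Lemma regular_on01 f : regular_on w112 p [set i0; i1]%SET f ->
  exists (c : rat) f1 f2, [/\ regular_on w112 p [set i0]%SET f1, regular_on w112 p [set i1]%SET f2
    & forall P : 'I_3 -> algC, points p P -> P i0 != 0 -> P i1 != 0 ->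
        f P = ratr c * h1_class P + f1 P + f2 P].
Proof.
have i01 : i0 \notin [set i1]%SET by rewrite inE.
move=> [k [G []]]; rewrite big_setU1 //= big_set1 !muln1.
set k0 := k i0; set k1 := k i1 => hG e.
have [al [be [sal sbe E _]]] := homog_laur hG.
have [||G1 hG1 E1] := @laur_homog k0 (drop_poly k1 al) (drop_poly k1 be).
- by rewrite size_drop_poly leq_subLR addnS addnC.
- by rewrite size_drop_poly leq_subLR; apply: leq_trans sbe _; lia.
have [||G2 hG2 E2] := @laur_homog k1 (take_poly k1 al) (take_poly k1.-1 be).
- exact: leqW (size_take_poly _ _).
- exact: size_take_poly.
exists (take_poly k1 be)`_k1.-1, (fun P => peval G1 P / P i0 ^+ k0), (fun P => peval G2 P / P i1 ^+ k1); split.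
- by exists (fun _ => k0), G1; rewrite big_set1 muln1; split=> // P _ _; rewrite big_set1.
- by exists (fun _ => k1), G2; rewrite big_set1 muln1; split=> // P _ _; rewrite big_set1.
move=> P hP l0 m0; rewrite e // => [|i]; last by rewrite !inE => /orP[]/eqP ->.
rewrite big_setU1 //= big_set1 -/k0 -/k1 E // E1 // E2 // /h1_class /laur.
have {1}<- := poly_take_drop k1 al; have {1}<- := poly_take_drop k1 be.
have {1}-> := take_poly_last be k1; set c := _`_k1.-1.
(* For [k1 = 0] the index [k1.-1] is 0 rather than -1, and the coefficient read there is that of the
   empty truncation. *)
have c0 : k1 = 0%N -> c = 0 by move=> k10; rewrite /c coef_take_poly k10.
rewrite !rmorphD !rmorphM /= map_polyZ !map_polyXn !(hornerD, hornerM, hornerZ, hornerXn).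
set s1 := (map_poly ratr (drop_poly k1 al)).[_]; set t1 := (map_poly ratr (drop_poly k1 be)).[_].
set s2 := (map_poly ratr (take_poly k1 al)).[_]; set t2 := (map_poly ratr (take_poly k1.-1 be)).[_].
rewrite exprD !expr_div_n; case: {+}k1 c0 => [/(_ erefl) ->|n _] /=.
  by rewrite rmorph0; field; rewrite l0 expf_neq0.
by rewrite !exprS; field; rewrite l0 m0 !expf_neq0.
Qed.

Lemma smooth_quartic_genus1 : smooth_curve w112 p -> smooth_curve_of_genus w112 p 1.
Proof.
move=> smooth; split=> //; exists i0, i1; split; [exact: XY|exact: regular_functions_constant|].
exists (fun _ => h1_class); split=> [_|f /regular_on01[c [f1 [f2 [r1 r2 e]]]]].
  have i01 : i0 \notin [set i1]%SET by rewrite inE.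
  exists (fun _ => 1%N), (coordX i2); rewrite big_setU1 //= big_set1; split.
    exact: (whomog_coord w112 i2).
  by move=> P _ _; rewrite big_setU1 //= big_set1 !expr1 peval_coord.
exists [ffun=> c]; split.
  by exists f1, f2; split=> // P hP l0 m0; rewrite big_ord1 ffunE e.
move=> c' [f1' [f2' [r1' r2' e']]]; apply/ffunP => i; rewrite ffunE ord1.
apply: (h1_class_nontrivial r1 r1' r2 r2') => P hP l0 m0.
by rewrite -e // e' // big_ord1.
Qed.

End GenusOne.

Lemma curveU_genus1 : smooth_curve_of_genus w112 curveU 1.
Proof.
apply: (@smooth_quartic_genus1 curveU 1 1 1 1 0) smooth_curveU => P.
- by rewrite peval_curveU /quartic rmorph1 rmorph0; ring.
- exact: curveU_XY.
have N0 : 0 < P.+1%:R :> algC by rewrite ltr0Sn.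
by rewrite /quartic rmorph1 rmorph0 !expr1n !mul1r mul0r addr0 gt_eqF // !addr_gt0 // exprn_gt0.
Qed.

Lemma curveV_genus1 : smooth_curve_of_genus w112 curveV 1.
Proof.
apply: (@smooth_quartic_genus1 curveV 3 2 4 2 1) smooth_curveV => P.
- by rewrite peval_curveV /quartic rmorph1 !rmorph_nat; ring.
- exact: curveV_XY.
rewrite /quartic rmorph1 !rmorph_nat !expr1n !mul1r mulr1 -!natrX -!natrM -!natrD.
by rewrite pnatr_eq0.
Qed.

(** * Isomorphisms with the Weierstrass models *)

Section Vec3.
Variable T : Type.
Lemma vec3E (a b c : T) : (vec3 a b c i0 = a) * (vec3 a b c i1 = b) * (vec3 a b c i2 = c).
Proof. by []. Qed.
End Vec3.

Definition pmap (G : 'I_3 -> mpoly 3 rat) (P : 'I_3 -> algC) : 'I_3 -> algC :=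
  fun i => peval (G i) P.

Lemma pmap_vec3 g0 g1 g2 P :
  pmap (vec3 g0 g1 g2) P = vec3 (peval g0 P) (peval g1 P) (peval g2 P).
Proof. by apply/funext => i; case: (ord3P i) => ->. Qed.

Lemma wequiv_refl (F : fieldType) w (P : 'I_3 -> F) : wequiv w P P.
Proof. by exists 1; rewrite ?oner_neq0 // => i; rewrite expr1n mul1r. Qed.

(** The formulas [G1] vanish identically outside [b], so any point where they are nonzero lies in
    [b]; on [b] the formulas [G2] agree with them wherever they do not all vanish. Each family thus
    represents the glued map on its whole domain. *)
Lemma glue_regular_map w w' p p' (b : ('I_3 -> algC) -> bool) G1 G2 d1 d2 :
  (forall i, whomog w (w' i * d1) (G1 i)) -> (forall i, whomog w (w' i * d2) (G2 i)) ->
  (forall P, points p P -> b P -> points p' (pmap G1 P)) ->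
  (forall P, points p P -> ~~ b P -> points p' (pmap G2 P)) ->
  (forall P, points p P -> ~~ b P -> forall i, pmap G1 P i = 0) ->
  (forall P, points p P -> b P -> (exists i, pmap G2 P i != 0) ->
     wequiv w' (pmap G2 P) (pmap G1 P)) ->
  regular_map w w' p p' (fun P => if b P then pmap G1 P else pmap G2 P).
Proof.
move=> h1 h2 p1 p2 z1 e P hP; case: (boolP (b P)) => bP.
  have p1P := p1 _ hP bP; split=> //; exists d1, G1; split=> //; first by case: p1P.
  move=> Q hQ [i hi]; case: (boolP (b Q)) => bQ; first exact: wequiv_refl.
  by move/eqP: hi; case; exact: z1.
have p2P := p2 _ hP bP; split=> //; exists d2, G2; split=> //; first by case: p2P.
by move=> Q hQ hi; case: (boolP (b Q)) => bQ; [exact: e|exact: wequiv_refl].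
Qed.

Local Notation X0 := (coordX i0).
Local Notation X1 := (coordX i1).
Local Notation X2 := (coordX i2).

Lemma whomog_deg w d e p : whomog w d p -> d = e -> whomog w e p.
Proof. by move=> + <-. Qed.

(** [whomog_mono] infers the degree of a monomial bottom-up into an existential variable; only then
    is it compared with the expected degree by computation. *)
Ltac whomog_solve :=
  lazymatch goal with
  | |- is_true (whomog _ _ (_ + _)) => apply: whomogD; whomog_solve
  | |- is_true (whomog _ _ (- _)) => apply: whomogN; whomog_solve
  | |- is_true (whomog _ _ (_ *: _)) => apply: whomogZ; whomog_solve
  | |- is_true (whomog ?w ?d ?p) => apply: (whomog_deg (e := d)); [whomog_mono|by []]
  end
with whomog_mono :=
  lazymatch goal with
  | |- is_true (whomog _ _ (_ + _)) => apply: whomogD; [whomog_mono|whomog_solve]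
  | |- is_true (whomog _ _ (- _)) => apply: whomogN; whomog_mono
  | |- is_true (whomog _ _ (_ *: _)) => apply: whomogZ; whomog_mono
  | |- is_true (whomog _ _ (_ * _)) => apply: whomogM; whomog_mono
  | |- is_true (whomog _ _ (_ ^+ _)) => apply: whomogX; whomog_mono
  | |- is_true (whomog _ _ (coordX _)) => apply: whomog_coord
  | |- is_true (whomog _ _ 1) => apply: whomog1
  end.

(** The map [x = m / l], [y = u / l^2]. Multiplying by [u / l] and using the equation of the curve
    gives [phiU2], which is defined where [l = 0]. *)
Definition phiU1 := vec3 (X0 * X1) X2 (X0 ^+ 2).
Definition phiU2 := vec3 (X1 * X2) (X0 ^+ 3 + X0 ^+ 2 * X1 + X0 * X1 ^+ 2 + X1 ^+ 3) (X0 * X2).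
Definition phiU P := if P i0 != 0 then pmap phiU1 P else pmap phiU2 P.

Definition psiU1 := vec3 X2 X0 (X1 * X2).
(** On the cubic [z * psiUK = x^3]; rescaling [psiU1] by [x^2 / z] therefore gives [psiU2], which is
    defined at infinity. *)
Definition psiUK := X1 ^+ 2 - X2 ^+ 2 - X0 * X2 - X0 ^+ 2.
Definition psiU2 := vec3 (X0 ^+ 2) psiUK (X0 * X1 * psiUK).
Definition psiU P := if P i2 != 0 then pmap psiU1 P else pmap psiU2 P.

Lemma curveU_eq (P : 'I_3 -> algC) : points curveU P ->
  P i2 ^+ 2 = P i0 * (P i0 ^+ 3 + P i0 ^+ 2 * P i1 + P i0 * P i1 ^+ 2 + P i1 ^+ 3).
Proof. by move=> [_ /eqP]; rewrite peval_curveU subr_eq0 => /eqP. Qed.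

Lemma wcubicU_eq (P : 'I_3 -> algC) : points (wcubic EU) P ->
  P i0 ^+ 3 = P i1 ^+ 2 * P i2 - P i0 ^+ 2 * P i2 - P i0 * P i2 ^+ 2 - P i2 ^+ 3.
Proof.
move=> [_]; rewrite peval_wcubic /= !rmorph0 !rmorph1 => h.
by apply/eqP; rewrite -subr_eq0 -oppr_eq0 -[X in _ == X]h; apply/eqP; ring.
Qed.

Lemma phiU1E P : pmap phiU1 P = vec3 (P i0 * P i1) (P i2) (P i0 ^+ 2).
Proof. by rewrite pmap_vec3 !pevalE. Qed.
Lemma phiU2E P : pmap phiU2 P = vec3 (P i1 * P i2)
  (P i0 ^+ 3 + P i0 ^+ 2 * P i1 + P i0 * P i1 ^+ 2 + P i1 ^+ 3) (P i0 * P i2).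
Proof. by rewrite pmap_vec3 !pevalE. Qed.
Lemma psiU1E P : pmap psiU1 P = vec3 (P i2) (P i0) (P i1 * P i2).
Proof. by rewrite pmap_vec3 !pevalE. Qed.
Lemma psiU2E P : let K := P i1 ^+ 2 - P i2 ^+ 2 - P i0 * P i2 - P i0 ^+ 2 in
  pmap psiU2 P = vec3 (P i0 ^+ 2) K (P i0 * P i1 * K).
Proof. by rewrite pmap_vec3 !pevalE. Qed.

Lemma phiU_regular : regular_map w112 w111 curveU (wcubic EU) phiU.
Proof.
apply: (@glue_regular_map _ _ _ _ _ phiU1 phiU2 2 3).
- by move=> i; case: (ord3P i) => ->; rewrite /w111 /phiU1 !vec3E; whomog_solve.
- by move=> i; case: (ord3P i) => ->; rewrite /w111 /phiU2 !vec3E; whomog_solve.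
- move=> P /curveU_eq h l0; rewrite phiU1E; split; first by exists i2; rewrite vec3E expf_neq0.
  by rewrite peval_wcubic /= !rmorph0 !rmorph1 !vec3E; ring: h.
- move=> P hP; rewrite negbK => /eqP l0; have := curveU_eq hP; rewrite l0 mul0r => /eqP.
  rewrite expf_eq0 /= => /eqP u0.
  have [|m0] := curveU_XY hP; first by rewrite l0 eqxx.
  rewrite phiU2E l0 u0; split.
    by exists i1; rewrite vec3E !expr0n /= !mul0r !add0r expf_neq0.
  by rewrite peval_wcubic /= !rmorph0 !rmorph1 !vec3E; ring.
- move=> P hP; rewrite negbK => /eqP l0 i; have := curveU_eq hP; rewrite l0 mul0r => /eqP.
  by rewrite phiU1E expf_eq0 /= => /eqP u0; case: (ord3P i) => ->; rewrite vec3E ?l0 ?u0 ?mul0r ?expr0n.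
move=> P hP l0 [i +]; rewrite phiU1E phiU2E; have h := curveU_eq hP.
have [u0|u0] := eqVneq (P i2) 0.
  move: h; rewrite u0 !expr0n /= => /esym/eqP; rewrite mulf_eq0 (negPf l0) /= => /eqP h.
  by rewrite h !mulr0; case: (ord3P i) => ->; rewrite vec3E eqxx.
move=> _; exists (P i0 / P i2); first by rewrite mulf_neq0 ?invr_eq0.
move=> {}i; case: (ord3P i) => ->; rewrite !vec3E expr1.
- by field.
- by rewrite mulrAC -h; field.
by field.
Qed.

Lemma psiU_regular : regular_map w111 w112 (wcubic EU) curveU psiU.
Proof.
have z0x0 (P : 'I_3 -> algC) : points (wcubic EU) P -> P i2 = 0 -> P i0 = 0.
  move=> /wcubicU_eq h z0; have /eqP : P i0 ^+ 3 = 0 by rewrite h z0; ring.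
  by rewrite expf_eq0 => /eqP.
apply: (@glue_regular_map _ _ _ _ _ psiU1 psiU2 1 2).
- by move=> i; case: (ord3P i) => ->; rewrite /w112 /psiU1 !vec3E; whomog_solve.
- by move=> i; case: (ord3P i) => ->; rewrite /w112 /psiU2 /psiUK !vec3E; whomog_solve.
- move=> P /wcubicU_eq h z0; rewrite psiU1E; split; first by exists i0; rewrite vec3E.
  by rewrite peval_curveU !vec3E; ring: h.
- move=> P hP; rewrite negbK => /eqP z0; have x0 := z0x0 _ hP z0.
  case: (hP) => [[i hi] _]; have y0 : P i1 != 0.
    by move: hi; case: (ord3P i) => ->; rewrite ?x0 ?z0 ?eqxx.
  rewrite psiU2E x0 z0; split.
    by exists i1; rewrite vec3E !expr0n /= !mul0r !subr0 expf_neq0.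
  by rewrite peval_curveU !vec3E; ring.
- move=> P hP; rewrite negbK => /eqP z0 i; have x0 := z0x0 _ hP z0.
  by rewrite psiU1E; case: (ord3P i) => ->; rewrite vec3E ?z0 ?x0 ?mulr0.
move=> P hP z0 [i +]; rewrite psiU1E psiU2E; have h := wcubicU_eq hP.
set K := P i1 ^+ 2 - _ - _ - _; have hK : P i2 * K = P i0 ^+ 3 by rewrite h /K; ring.
have [x0|x0] := eqVneq (P i0) 0.
  move: hK; rewrite x0 !expr0n /= => /eqP; rewrite mulf_eq0 (negPf z0) /= => /eqP ->.
  by rewrite !mul0r; case: (ord3P i) => ->; rewrite vec3E eqxx.
move=> _; exists (P i2 / P i0 ^+ 2); first by rewrite mulf_neq0 ?invr_eq0 ?expf_neq0.
move=> {}i; case: (ord3P i) => ->; rewrite !vec3E ?expr1.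
- by field.
- by rewrite mulrAC hK; field.
transitivity ((P i2 / P i0 ^+ 2) * (P i0 * P i1) * (P i2 * K / P i0 ^+ 2)); last by field.
by rewrite hK; field.
Qed.

Lemma psiU_phiU (P : 'I_3 -> algC) : points curveU P -> wequiv w112 (psiU (phiU P)) P.
Proof.
move=> hP; have h := curveU_eq hP; rewrite /phiU; case: (boolP (P i0 == 0)) => /= [/eqP|] l0.
  have u0 : P i2 = 0 by move/eqP: h; rewrite l0 mul0r expf_eq0 => /eqP.
  have [|m0] := curveU_XY hP; first by rewrite l0 eqxx.
  rewrite phiU2E /psiU vec3E l0 mul0r eqxx /= psiU2E !vec3E u0.
  exists (P i1 ^- 5); first by rewrite invr_eq0 expf_neq0.
  by move=> i; case: (ord3P i) => ->; rewrite /w112 !vec3E ?l0 ?u0; field.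
rewrite phiU1E /psiU vec3E expf_neq0 //= psiU1E !vec3E.
exists (P i0)^-1; first by rewrite invr_eq0.
by move=> i; case: (ord3P i) => ->; rewrite /w112 !vec3E; field.
Qed.

Lemma phiU_psiU (P : 'I_3 -> algC) : points (wcubic EU) P -> wequiv w111 (phiU (psiU P)) P.
Proof.
move=> hP; have h := wcubicU_eq hP; rewrite /psiU; case: (boolP (P i2 == 0)) => /= [/eqP|] z0.
  have x0 : P i0 = 0.
    have /eqP : P i0 ^+ 3 = 0 by rewrite h z0; ring.
    by rewrite expf_eq0 => /eqP.
  case: (hP) => [[i hi] _]; have y0 : P i1 != 0.
    by move: hi; case: (ord3P i) => ->; rewrite ?x0 ?z0 ?eqxx.
  rewrite psiU2E /phiU vec3E x0 expr0n /= eqxx /= phiU2E !vec3E z0.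
  exists (P i1 ^- 5); first by rewrite invr_eq0 expf_neq0.
  by move=> {hi}i; case: (ord3P i) => ->; rewrite /w111 !vec3E ?x0 ?z0; field.
rewrite psiU1E /phiU vec3E z0 /= phiU1E !vec3E.
exists (P i2)^-1; first by rewrite invr_eq0.
by move=> i; case: (ord3P i) => ->; rewrite /w111 !vec3E; field.
Qed.

Lemma affine_phiU (P : 'I_3 -> algC) : points curveU P ->
  affine_point (phiU P) = if P i0 == 0 then None else Some (P i1 / P i0, P i2 / P i0 ^+ 2).
Proof.
move=> /curveU_eq h; rewrite /phiU; case: (boolP (P i0 == 0)) => /= [/eqP|] l0.
  by rewrite phiU2E /affine_point !vec3E l0 mul0r eqxx.
rewrite phiU1E /affine_point !vec3E expf_eq0 (negPf l0) /=.
by congr (Some (_, _)); field.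
Qed.

Lemma sigmaU_points (P : 'I_3 -> algC) : points curveU P -> points curveU (sigmaU P).
Proof.
move=> hP; have h := curveU_eq hP; split; last first.
  by rewrite peval_curveU /sigmaU !vec3E; ring: h.
have n2 : (2 : algC) != 0 by rewrite pnatr_eq0.
have [lm|] := eqVneq (P i0 + P i1) 0; last by exists i0.
exists i1; rewrite /sigmaU vec3E; apply/eqP => lm'; case: (curveU_XY hP) => /eqP; apply;
  apply: (mulfI n2); rewrite mulr0.
  by transitivity (P i0 + P i1 + (P i0 - P i1)); [ring|rewrite lm lm' addr0].
by transitivity (P i0 + P i1 - (P i0 - P i1)); [ring|rewrite lm lm' subr0].
Qed.

Lemma sigmaU_regular : regular_map w112 w112 curveU curveU sigmaU.
Proof.
move=> P hP; have hs := sigmaU_points hP; split=> //.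
pose G := vec3 (X0 + X1) (X0 - X1) ((-2) *: X2).
have GE Q : (fun i => peval (G i) Q) = sigmaU Q.
  by rewrite -/(pmap G Q) pmap_vec3 !pevalE rmorphN rmorph_nat.
exists 1%N, G; split.
- by move=> i; case: (ord3P i) => ->; rewrite /w112 /G !vec3E; whomog_solve.
- by case: hs => [[i hi] _]; exists i; rewrite (congr1 (fun f => f i) (GE P)).
by move=> Q _ _; rewrite GE; exact: wequiv_refl.
Qed.

Lemma sigmaUK (P : 'I_3 -> algC) : wequiv w112 (sigmaU (sigmaU P)) P.
Proof.
exists 2^-1; first by rewrite invr_eq0 pnatr_eq0.
by move=> i; case: (ord3P i) => ->; rewrite /w112 /sigmaU !vec3E; field.
Qed.

Lemma phiU_sigmaU (P : 'I_3 -> algC) : points curveU P ->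
  affine_point (phiU (sigmaU P)) = ec_add EU (affine_point (phiU P)) (Some (-1, 0)).
Proof.
move=> hP; rewrite affine_phiU; last exact: sigmaU_points.
rewrite affine_phiU // /sigmaU !vec3E; have h := curveU_eq hP.
set l := P i0 in h *; set m := P i1 in h *; set u := P i2 in h *.
case: (boolP (l == 0)) => [/eqP l0|l0].
  have u0 : u = 0 by move/eqP: h; rewrite l0 mul0r expf_eq0 => /eqP.
  have [|m0] := curveU_XY hP; first by rewrite -/l l0 eqxx.
  rewrite l0 add0r sub0r (negPf m0) u0 /= mulr0 mul0r.
  by rewrite mulNr divff.
rewrite /ec_add /= !rmorph0 !rmorph1.
case: (boolP (l + m == 0)) => [/eqP lm|lm].
  have e : m = - l by apply/eqP; rewrite -addr_eq0 addrC lm.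
  have u0 : u = 0.
    have /eqP : u ^+ 2 = 0 by rewrite h e; ring.
    by rewrite expf_eq0 => /eqP.
  by rewrite e u0 mulNr divff // mul0r eqxx /= !mul0r !addr0 eqxx.
have x1 : - l - m != 0 by rewrite -opprD oppr_eq0.
have -> : m / l != -1.
  rewrite -subr_eq0 (_ : m / l - -1 = (l + m) / l); last by field.
  by rewrite mulf_neq0 ?invr_eq0.
congr (Some (_, _)); field: h; by rewrite ?mulN1r l0 lm x1.
Qed.

Lemma curveV_eq (P : 'I_3 -> algC) : points curveV P ->
  P i2 ^+ 2 = 3 * P i0 ^+ 4 + 2 * P i0 ^+ 3 * P i1 + 4 * P i0 ^+ 2 * P i1 ^+ 2
              + 2 * P i0 * P i1 ^+ 3 + P i1 ^+ 4.
Proof. by move=> [_ /eqP]; rewrite peval_curveV subr_eq0 => /eqP. Qed.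

Lemma wcubicV_eq (P : 'I_3 -> algC) : points (wcubic EV) P ->
  P i0 ^+ 3 = P i2 * (P i1 ^+ 2 + 2 * P i0 * P i1 - 2 * P i1 * P i2 + 6 * P i0 ^+ 2 + 3 * P i0 * P i2).
Proof.
move=> [_]; rewrite peval_wcubic /= !(rmorphN, rmorph_nat, rmorph0) => h.
by apply/eqP; rewrite -subr_eq0 -oppr_eq0 -[X in _ == X]h; apply/eqP; ring.
Qed.

(* On the curve phiVs * (phiVs - 4 v) = l^3 (4 m - 3 l), which is how phiV2
   extends phiV1 where l = 0 and v = - m^2; similarly psiV2 extends psiV1 by
   y * (z * psiVK) = x * psiVM. *)
Definition phiVs := 2%:R *: X2 + 3%:R *: X0 ^+ 2 + 2%:R *: (X0 * X1) + 2%:R *: X1 ^+ 2.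
Definition phiV1 := vec3 (X0 * phiVs) (2%:R *: (X1 * phiVs)) (X0 ^+ 3).
Definition phiV2 := vec3 (X0 * (4%:R *: X1 - 3%:R *: X0)) (2%:R *: (X1 * (4%:R *: X1 - 3%:R *: X0)))
  (3%:R *: X0 ^+ 2 + 2%:R *: (X0 * X1) + 2%:R *: X1 ^+ 2 - 2%:R *: X2).
Definition phiVtest (P : 'I_3 -> algC) := (P i0 != 0) || (P i2 != - P i1 ^+ 2).
Definition phiV P := if phiVtest P then pmap phiV1 P else pmap phiV2 P.

Definition psiV1 := vec3 (2%:R *: X0) X1
  (X1 ^+ 2 + 2%:R *: (X0 * X1) + 6%:R *: X0 ^+ 2 - 4%:R *: (X1 * X2) + 6%:R *: (X0 * X2)).
Definition psiVK := X1 + 2%:R *: X0 - 2%:R *: X2.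
Definition psiVM := X0 ^+ 2 - 6%:R *: (X0 * X2) - 3%:R *: X2 ^+ 2.
Definition psiV2 := vec3 (2%:R *: (X2 * psiVK)) psiVM
  (psiVM ^+ 2 + 2%:R *: (X2 * psiVK * psiVM) + 6%:R *: (X2 * psiVK) ^+ 2
   + X2 ^+ 2 * psiVK * (36%:R *: X2 - 4%:R *: X0) + 6%:R *: (X2 ^+ 2 * psiVM)).
Definition psiVtest (P : 'I_3 -> algC) := (P i0 != 0) || (P i1 != 0).
Definition psiV P := if psiVtest P then pmap psiV1 P else pmap psiV2 P.

Lemma phiV1E P : let s := 2 * P i2 + 3 * P i0 ^+ 2 + 2 * (P i0 * P i1) + 2 * P i1 ^+ 2 in
  pmap phiV1 P = vec3 (P i0 * s) (2 * (P i1 * s)) (P i0 ^+ 3).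
Proof. by rewrite pmap_vec3 !pevalE !rmorph_nat. Qed.
Lemma phiV2E P : pmap phiV2 P = vec3 (P i0 * (4 * P i1 - 3 * P i0)) (2 * (P i1 * (4 * P i1 - 3 * P i0)))
  (3 * P i0 ^+ 2 + 2 * (P i0 * P i1) + 2 * P i1 ^+ 2 - 2 * P i2).
Proof. by rewrite pmap_vec3 !pevalE !rmorph_nat. Qed.
Lemma psiV1E P : pmap psiV1 P = vec3 (2 * P i0) (P i1)
  (P i1 ^+ 2 + 2 * (P i0 * P i1) + 6 * P i0 ^+ 2 - 4 * (P i1 * P i2) + 6 * (P i0 * P i2)).
Proof. by rewrite pmap_vec3 !pevalE !rmorph_nat. Qed.
Lemma psiV2E P : let K := P i1 + 2 * P i0 - 2 * P i2 in
  let M := P i0 ^+ 2 - 6 * (P i0 * P i2) - 3 * P i2 ^+ 2 in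
  pmap psiV2 P = vec3 (2 * (P i2 * K)) M
    (M ^+ 2 + 2 * (P i2 * K * M) + 6 * (P i2 * K) ^+ 2
     + P i2 ^+ 2 * K * (36 * P i2 - 4 * P i0) + 6 * (P i2 ^+ 2 * M)).
Proof. by rewrite pmap_vec3 !pevalE !rmorph_nat. Qed.

Lemma natC_neq0 n : n.+1%:R != 0 :> algC. Proof. by rewrite pnatr_eq0. Qed.

Lemma phiVtestN (P : 'I_3 -> algC) : points curveV P -> ~~ phiVtest P ->
  [/\ P i0 = 0, P i1 != 0 & P i2 = - P i1 ^+ 2].
Proof.
move=> hP; rewrite /phiVtest negb_or !negbK => /andP[/eqP l0 /eqP v0]; split=> //.
by have [|//] := curveV_XY hP; rewrite l0 eqxx.
Qed.

Lemma psiVtestN (P : 'I_3 -> algC) : points (wcubic EV) P -> ~~ psiVtest P ->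
  [/\ P i0 = 0, P i1 = 0 & P i2 != 0].
Proof.
move=> [[i hi] _]; rewrite /psiVtest negb_or !negbK => /andP[/eqP x0 /eqP y0]; split=> //.
by move: hi; case: (ord3P i) => ->; rewrite ?x0 ?y0 ?eqxx.
Qed.

Lemma phiV_regular : regular_map w112 w111 curveV (wcubic EV) phiV.
Proof.
have n8 := natC_neq0 7.
apply: (@glue_regular_map _ _ _ _ _ phiV1 phiV2 3 2).
- by move=> i; case: (ord3P i) => ->; rewrite /w111 /phiV1 /phiVs !vec3E; whomog_solve.
- by move=> i; case: (ord3P i) => ->; rewrite /w111 /phiV2 !vec3E; whomog_solve.
- move=> P hP; have h := curveV_eq hP; rewrite phiV1E /phiVtest => bP; split; last first.
    rewrite peval_wcubic /= !(rmorphN, rmorph_nat, rmorph0) !vec3E; ring: h.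
  case: (boolP (P i0 == 0)) bP => [/eqP l0 /= v0|l0 _]; last by exists i2; rewrite vec3E expf_neq0.
  have [|m0] := curveV_XY hP; first by rewrite l0 eqxx.
  exists i1; rewrite vec3E l0.
  rewrite (_ : _ + _ = 2 * (P i2 - - P i1 ^+ 2)); last by ring.
  by rewrite !mulf_neq0 ?subr_eq0 ?(natC_neq0 1).
- move=> P hP /(phiVtestN hP)[l0 m0 v0]; rewrite phiV2E l0 v0; split.
    exists i1; rewrite vec3E (_ : 2 * _ = 8 * P i1 ^+ 2); last by ring.
    by rewrite mulf_neq0 ?expf_neq0.
  by rewrite peval_wcubic /= !(rmorphN, rmorph_nat, rmorph0) !vec3E; ring.
- move=> P hP /(phiVtestN hP)[l0 m0 v0] i; rewrite phiV1E l0 v0.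
  by case: (ord3P i) => ->; rewrite vec3E; ring.
move=> P hP; have h := curveV_eq hP; rewrite /phiVtest phiV1E phiV2E.
set s' := 3 * P i0 ^+ 2 + _ + _ - _; set s := 2 * P i2 + _ + _ + _.
have ss : s * s' = P i0 ^+ 3 * (4 * P i1 - 3 * P i0) by rewrite /s /s'; ring: h.
case: (boolP (P i0 == 0)) => [/eqP l0 /= v0 _|l0 _ [i +]].
  have [|m0] := curveV_XY hP; first by rewrite l0 eqxx.
  have v1 : P i2 = P i1 ^+ 2.
    apply/eqP; rewrite -subr_eq0; have /eqP : (P i2 - P i1 ^+ 2) * (P i2 - - P i1 ^+ 2) = 0.
      by transitivity (P i2 ^+ 2 - P i1 ^+ 4); [ring|rewrite h l0; ring].
    by rewrite mulf_eq0 (subr_eq0 _ (- _)) (negPf v0) orbF.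
  exists (P i1) => // i; case: (ord3P i) => ->; rewrite /w111 !vec3E /s /s' l0 v1; ring.
have l3 : P i0 ^+ 3 != 0 by rewrite expf_neq0.
have [s0|s0] := eqVneq s' 0.
  move: ss; rewrite s0 mulr0 => /esym/eqP; rewrite mulf_eq0 (negPf l3) /= => /eqP ->.
  by rewrite !mulr0; case: (ord3P i) => ->; rewrite vec3E eqxx.
move=> _; exists (P i0 ^+ 3 / s'); first by rewrite mulf_neq0 ?invr_eq0.
move=> {}i; case: (ord3P i) => ->; rewrite /w111 !vec3E expr1.
- by rewrite mulrCA [P i0 ^+ 3 / s' * _]mulrAC -ss; field.
- transitivity (2 * P i1 * (P i0 ^+ 3 * (4 * P i1 - 3 * P i0)) / s'); last by field.
  by rewrite -ss; field.
by field.
Qed.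

Lemma psiV_regular : regular_map w111 w112 (wcubic EV) curveV psiV.
Proof.
apply: (@glue_regular_map _ _ _ _ _ psiV1 psiV2 1 2).
- by move=> i; case: (ord3P i) => ->; rewrite /w112 /psiV1 !vec3E; whomog_solve.
- by move=> i; case: (ord3P i) => ->; rewrite /w112 /psiV2 /psiVM /psiVK !vec3E; whomog_solve.
- move=> P hP; have h := wcubicV_eq hP; rewrite psiV1E => bP; split; last first.
    by rewrite peval_curveV !vec3E; ring: h.
  case/orP: bP => n0; last by exists i1; rewrite vec3E.
  by exists i0; rewrite vec3E mulf_neq0 ?(natC_neq0 1).
- move=> P hP /(psiVtestN hP)[x0 y0 z0]; rewrite psiV2E x0 y0; split.
    exists i1; rewrite vec3E (_ : _ - _ = - (3 * P i2 ^+ 2)); last by ring.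
    by rewrite oppr_eq0 mulf_neq0 ?expf_neq0 ?(natC_neq0 2).
  by rewrite peval_curveV !vec3E; ring.
- move=> P hP /(psiVtestN hP)[x0 y0 z0] i; rewrite psiV1E x0 y0.
  by case: (ord3P i) => ->; rewrite vec3E; ring.
move=> P hP; have h := wcubicV_eq hP; rewrite /psiVtest psiV1E psiV2E.
set K := P i1 + _ - _; set M := P i0 ^+ 2 - _ - _.
have yK : P i1 * (P i2 * K) = P i0 * M by rewrite /K /M; ring: h.
set V1 := P i1 ^+ 2 + _ + _ - _ + _; set V2 := M ^+ 2 + _ + _ + _ + _.
have vK : V1 * (P i2 * K) ^+ 2 = P i0 ^+ 2 * V2 by rewrite /V1 /V2 /K /M; ring: h.
have vM : V1 * M ^+ 2 = P i1 ^+ 2 * V2 by rewrite /V1 /V2 /K /M; ring: h.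
move=> b [i ne].
have K0M : P i2 * K = 0 -> M = 0 -> False.
  move=> K0 M0; have V0 : V2 = 0.
    transitivity (M ^+ 2 + 2 * (P i2 * K * M) + 6 * (P i2 * K) ^+ 2
      + P i2 * (P i2 * K) * (36 * P i2 - 4 * P i0) + 6 * (P i2 ^+ 2 * M)); first by rewrite /V2; ring.
    by rewrite K0 M0; ring.
  by move: ne; rewrite K0 M0 V0; case: (ord3P i) => ->; rewrite vec3E ?mulr0 eqxx.
have [K0|K0] := eqVneq (P i2 * K) 0; last first.
  have x0 : P i0 != 0.
    apply: contraTneq b => x0; rewrite x0 eqxx /= negbK; move/eqP: yK.
    by rewrite x0 mul0r mulf_eq0 (negPf K0) orbF.
  exists (P i0 / (P i2 * K)); first by rewrite mulf_neq0 ?invr_eq0.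
  have {ne}K2 := K0; move: K2; set k := P i2 * K in yK vK K0 *.
  move=> _ j; case: (ord3P j) => ->; rewrite /w112 !vec3E ?expr1.
  - by field.
  - by rewrite mulrAC -yK; field.
  by rewrite expr_div_n mulrAC -vK mulfK // expf_neq0.
have M0 : M != 0 by apply/eqP => M0; exact: K0M.
have x0 : P i0 = 0.
  by apply/eqP; move/eqP: yK; rewrite K0 mulr0 eq_sym mulf_eq0 (negPf M0) orbF.
have y0 : P i1 != 0 by move: b; rewrite x0 eqxx.
exists (P i1 / M); first by rewrite mulf_neq0 ?invr_eq0.
move=> j; case: (ord3P j) => ->; rewrite /w112 !vec3E ?expr1.
- by rewrite K0 x0 !mulr0.
- by field.
by rewrite expr_div_n mulrAC -vM mulfK // expf_neq0.
Qed.

Lemma psiV_phiV (P : 'I_3 -> algC) : points curveV P -> wequiv w112 (psiV (phiV P)) P.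
Proof.
move=> hP; have h := curveV_eq hP; have n2 := natC_neq0 1; rewrite /phiV.
case: (boolP (phiVtest P)) => [b|/(phiVtestN hP)[l0 m0 v0]]; last first.
  rewrite phiV2E l0 v0 /psiV /psiVtest !vec3E.
  have -> : 2 * (P i1 * (4 * P i1 - 3 * 0)) = 8 * P i1 ^+ 2 by ring.
  have -> : 8 * P i1 ^+ 2 != 0 by rewrite mulf_neq0 ?expf_neq0 ?(natC_neq0 7).
  rewrite orbT psiV1E !vec3E.
  exists (8 * P i1)^-1; first by rewrite invr_eq0 mulf_neq0 ?(natC_neq0 7).
  by move=> i; case: (ord3P i) => ->; rewrite /w112 !vec3E ?l0 ?v0; field.
rewrite phiV1E; set s := 2 * P i2 + _ + _ + _.
have ss : s * (s - 4 * P i2) = P i0 ^+ 3 * (4 * P i1 - 3 * P i0) by rewrite /s; ring: h.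
rewrite /psiV /psiVtest !vec3E; have [s0|s0] := eqVneq s 0.
  (* The remaining point with [s = 0] is [[1 : 3/4 : -45/16]]; it goes to the affine point [(0, 0)],
     where [psiV1] vanishes and [psiV2] takes over. *)
  have l0 : P i0 != 0.
    apply: contraTneq b => l0; rewrite /phiVtest l0 eqxx /= negbK -subr_eq0.
    by rewrite -(inj_eq (mulfI n2)) mulr0 -s0 /s l0; apply/eqP; ring.
  have m0 : P i1 = 3 * P i0 / 4.
    have /eqP : P i0 ^+ 3 * (4 * P i1 - 3 * P i0) = 0 by rewrite -ss s0 mul0r.
    rewrite mulf_eq0 expf_eq0 (negPf l0) /= subr_eq0 => /eqP e.
    by rewrite -e; field.
  have v0 : P i2 = - (45 * P i0 ^+ 2) / 16.
    apply: (mulfI n2); transitivity (s - (3 * P i0 ^+ 2 + 2 * (P i0 * P i1) + 2 * P i1 ^+ 2)).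
      by rewrite /s; ring.
    by rewrite s0 m0; field.
  rewrite s0 !mulr0 eqxx /= psiV2E !vec3E.
  exists (- (4 * P i0 ^+ 5)^-1); first by rewrite oppr_eq0 invr_eq0 mulf_neq0 ?expf_neq0 ?(natC_neq0 3).
  by move=> i; case: (ord3P i) => ->; rewrite /w112 !vec3E ?m0 ?v0; field.
have -> : (P i0 * s != 0) || (2 * (P i1 * s) != 0).
  have [n0|n0] := curveV_XY hP; first by rewrite mulf_neq0.
  by apply/orP; right; rewrite !mulf_neq0.
rewrite psiV1E !vec3E; exists (2 * s)^-1; first by rewrite invr_eq0 mulf_neq0.
move=> i; case: (ord3P i) => ->; rewrite /w112 !vec3E ?expr1.
- by field.
- by field.
set V1 := _ + 6 * (P i0 * s * _); have -> : V1 = (2 * s) ^+ 2 * P i2.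
  transitivity (s * (s * (4 * P i1 ^+ 2 + 4 * (P i0 * P i1) + 6 * P i0 ^+ 2)
    - 2 * (P i0 ^+ 3 * (4 * P i1 - 3 * P i0)))); first by rewrite /V1; ring.
  by rewrite -ss /s; ring.
by field.
Qed.

Lemma phiV_psiV (P : 'I_3 -> algC) : points (wcubic EV) P -> wequiv w111 (phiV (psiV P)) P.
Proof.
move=> hP; have h := wcubicV_eq hP; have n2 := natC_neq0 1; rewrite /psiV.
case: (boolP (psiVtest P)) => [b|/(psiVtestN hP)[x0 y0 z0]]; last first.
  rewrite psiV2E x0 y0 /phiV /phiVtest !vec3E.
  rewrite (_ : 2 * _ = - (4 * P i2 ^+ 2)); last by ring.
  rewrite oppr_eq0 mulf_neq0 ?expf_neq0 ?(natC_neq0 3) //= phiV1E !vec3E.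
  exists (- (64 * P i2 ^+ 5)^-1); first by rewrite oppr_eq0 invr_eq0 mulf_neq0 ?expf_neq0 ?(natC_neq0 63).
  by move=> i; case: (ord3P i) => ->; rewrite /w111 !vec3E ?x0 ?y0; field.
rewrite psiV1E; set V1 := P i1 ^+ 2 + _ + _ - _ + _.
set S := P i1 ^+ 2 + 2 * P i0 * P i1 - _ + _ + _ in h.
have yz : P i0 = 0 -> P i1 * (P i1 - 2 * P i2) = 0 -> P i1 = 2 * P i2 /\ P i2 != 0.
  move=> x0 /eqP; move: b; rewrite /psiVtest x0 eqxx mulf_eq0 /= => y0.
  rewrite (negPf y0) subr_eq0 => /eqP e; split=> //.
  by apply: contraNneq y0 => z0; rewrite e z0 mulr0.
rewrite /phiV; case: (boolP (phiVtest _)) => [|]; rewrite /phiVtest !vec3E.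
  move=> bt; have s0 : S != 0.
    apply/eqP => s0; have x0 : P i0 = 0.
      by apply/eqP; move/eqP: h; rewrite s0 mulr0 expf_eq0.
    have [|y0 _] := yz x0; first by rewrite -s0 /S x0; ring.
    by move: bt; rewrite x0 mulr0 eqxx /V1 x0 y0 /= => /eqP; apply; ring.
  rewrite phiV1E !vec3E.
  set s := 2 * V1 + _ + _ + _; have es : s = 4 * S by rewrite /s /V1 /S; ring.
  exists (8 * S)^-1; first by rewrite invr_eq0 mulf_neq0 ?(natC_neq0 7).
  move=> i; case: (ord3P i) => ->; rewrite /w111 !vec3E ?expr1 ?es; [by field|by field|].
  by rewrite exprMn h; field.
rewrite negb_or !negbK mulf_eq0 (negPf n2) /= => /andP[/eqP x0 /eqP v0].
have [|y0 z0] := yz x0.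
  apply: (mulfI n2); transitivity (V1 - - P i1 ^+ 2); last by rewrite v0 subrr mulr0.
  by rewrite /V1 x0; ring.
rewrite phiV2E !vec3E v0 x0 y0.
exists (16 * P i2)^-1; first by rewrite invr_eq0 mulf_neq0 ?(natC_neq0 15).
by move=> i; case: (ord3P i) => ->; rewrite /w111 !vec3E ?x0 ?y0; field.
Qed.

Lemma contains_sqamp_iota (R : realType) (k : R[i]) :
  let A := [set L : set (rat * rat) | projline L /\ contains_sqamp (@Vproj R L) k] in
  @iotaP rat @` A `<=` A.
Proof.
move=> A _ [L [[l [m [lm ->]]] c] <-]; have char2 : (2 : rat) != 0 by [].
split; first by apply: iota_projline => //; exists l, m.
rewrite iota_proj Vproj_proj; move: c; rewrite Vproj_proj.
exact/homothetic_contains_sqamp/homothetic_iota.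
Qed.

Lemma curveU_translation :
  affine_point (phiU (vec3 0 1 0)) = None /\
  let T := affine_point (phiU (vec3 1 (-1) 0)) in
  [/\ T <> None, ec_add EU T T = None
    & forall P, points curveU P ->
        affine_point (phiU (sigmaU P)) = ec_add EU (affine_point (phiU P)) T].
Proof.
have T0 : points curveU (vec3 0 1 0 : 'I_3 -> algC).
  by split; [exists i1; rewrite vec3E oner_neq0|rewrite peval_curveU !vec3E; ring].
have T1 : points curveU (vec3 1 (-1) 0 : 'I_3 -> algC).
  by split; [exists i0; rewrite vec3E oner_neq0|rewrite peval_curveU !vec3E; ring].
rewrite !affine_phiU // !vec3E eqxx oner_eq0 expr1n !divr1; split=> //; split=> //.
  by rewrite /= eqxx !rmorph0 !mul0r !addr0 eqxx.
exact: phiU_sigmaU.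
Qed.

Theorem theorem7p11 (R : realType) :
  let z8 : R[i] := zeta R 8 in
  let tau := @tau R in
  let V := @Vpair R in
  let f := fun L : set (rat * rat) => homothety_class (@Vproj R L) in
  (forall l m : rat, (l, m) != (0, 0) ->
     tau l m = ratr l * (Num.sqrt (2 - Num.sqrt 2))%:C * zeta R 16
             + ratr m * (Num.sqrt (2 + Num.sqrt 2))%:C * zeta R 16)
  /\
  (* (1) *)
  ((forall l m : rat, (l, m) != (0, 0) -> is_space (V l m)) /\
   (forall l m l' m' : rat, (l, m) != (0, 0) -> (l', m') != (0, 0) ->
      proj l m = proj l' m' -> V l m = V l' m') /\
   (forall l m : rat, (l, m) != (0, 0) -> @Vproj R (proj l m) = V l m))
  /\
  (* (2) *)
  (forall t : R[i], Qadjoin z8 t -> is_space (Qspan 1 t) ->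
     t / conjc t = z8 ->
     exists l m : rat, (l, m) != (0, 0) /\ t = tau l m)
  /\
  (* (3) *)
  (forall l m : rat, (l, m) != (0, 0) -> tau l m / conjc (tau l m) = z8)
  /\
  (* (4) *)
  (forall L, projline L -> homothetic (conjc @` @Vproj R L) (@Vproj R L))
  /\
  (* (5) *)
  (two_to_one (@projline rat) f /\
   (forall L : set (rat * rat), projline L ->
      [/\ projline (iotaP L), iotaP (iotaP L) = L & f (iotaP L) = f L]) /\
   (forall l m : rat, (l, m) != (0, 0) ->
      iotaP (proj l m) = proj (l + m) (l - m)))
  /\
  (* (6) *)
  ((iotaP (proj 0 1) = proj 1 (-1) :> set (rat * rat)) /\
   (iotaP (proj 1 0) = proj 1 1 :> set (rat * rat)) /\
   (forall L, L = proj 0 1 \/ L = proj (-1) 1 ->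
      of_type (@Vproj R L) [:: 4%N]) /\
   (let t := tau 0 1 in
    let s := [:: 1; t; t - 1; t - 2] in
    rational_tuple (V 0 1) s /\
    (forall k, (1 <= k <= 4)%N ->
       exists v w, [/\ v \in s, w \in s & angle_sqamp (V 0 1) (z8 ^+ k) v w]) /\
    (exists A B D E : R[i],
       rhombus A B D E (pi / 4) (3 * pi / 4) /\
       same_tuple [:: B - A; E - A; D - A; E - B] s)) /\
   (forall L, L = proj 1 0 \/ L = proj 1 1 ->
      of_type (@Vproj R L) [:: 3%N; 3%N]) /\
   (let t := tau 1 0 in
    let s1 := [:: t + 1; t - 2; t - 2^-1] in
    let s2 := [:: 1; t; t - 1] in
    rational_tuple (V 1 0) s1 /\ rational_tuple (V 1 0) s2 /\
    Qdisjoint s1 s2 /\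
    (forall s, size s = 3%N -> rational_tuple (V 1 0) s ->
       same_tuple s s1 \/ same_tuple s s2)) /\
   homothetic (V 1 0) (Qspan 1 (z8 ^+ 2 + z8 + 1)))
  /\
  (* (7) *)
  (forall l m : rat, (l, m) != (0, 0) -> ~ Sexc (proj l m) ->
     let a := (l ^+ 2 - 2 * l * m - m ^+ 2) / (l + m) in
     let b := - (2 * (l ^+ 3 + 2 * l ^+ 2 * m - l * m ^+ 2)
                 / (l ^+ 2 - 2 * l * m - m ^+ 2)) in
     let c := (- l ^+ 2 - 2 * l * m + m ^+ 2) / (2 * l) in
     let d := - 2 * (l + m) in
     let c' := - 2 * m in
     let d' := (l ^+ 2 + 2 * l * m - m ^+ 2) / (m - l) in
     let t := tau l m in
     two_angles (V l m) z8 (1, t) (t + ratr a, t + ratr b) /\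
     two_angles (V l m) (z8 ^+ 3)
       (t + ratr c, t + ratr d) (t + ratr c', t + ratr d'))
  /\
  (* (8) *)
  ((forall l m : rat, (l, m) != (0, 0) -> ~ Sexc (proj l m) ->
      (contains_sqamp (V l m) (z8 ^+ 2) <->
       exists u : rat,
         l * (l ^+ 3 + l ^+ 2 * m + l * m ^+ 2 + m ^+ 3) = u ^+ 2) /\
      (forall u : rat,
         l * (l ^+ 3 + l ^+ 2 * m + l * m ^+ 2 + m ^+ 3) = u ^+ 2 ->
         let ep := (l ^+ 2 - m ^+ 2 - u) / m in
         let em := (l ^+ 2 - m ^+ 2 + u) / m in
         let fp := (- 2 * l * m + u) / l in
         let fm := (- 2 * l * m - u) / l in
         let t := tau l m in
         two_angles (V l m) (z8 ^+ 2)
           (t + ratr ep, t + ratr fp) (t + ratr em, t + ratr fm))) /\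
   smooth_curve_of_genus w112 curveU 1 /\
   (exists P : 'I_3 -> rat, points curveU P) /\
   smooth_curve w111 (wcubic EU) /\
   MW_Z_Z2 EU (Some (0, 1)) /\
   (let A2 := [set L : set (rat * rat) |
                projline L /\ contains_sqamp (@Vproj R L) (z8 ^+ 2)] in
    @iotaP rat @` A2 `<=` A2) /\
   regular_map w112 w112 curveU curveU sigmaU /\
   (forall P, points curveU P ->
      wequiv w112 (sigmaU (sigmaU P)) P /\
      proj (sigmaU P i0) (sigmaU P i1) = iotaP (proj (P i0) (P i1))) /\
   (exists phi psi,
      isomorphism w112 w111 curveU (wcubic EU) phi psi /\
      affine_point (phi (vec3 0 1 0)) = None /\
      let T := affine_point (phi (vec3 1 (-1) 0)) in
      [/\ T <> None, ec_add EU T T = None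
        & forall P, points curveU P ->
            affine_point (phi (sigmaU P))
            = ec_add EU (affine_point (phi P)) T]))
  /\
  (* (9) *)
  ((forall l m : rat, (l, m) != (0, 0) -> ~ Sexc (proj l m) ->
      (contains_sqamp (V l m) (z8 ^+ 4) <->
       exists v : rat,
         3 * l ^+ 4 + 2 * l ^+ 3 * m + 4 * l ^+ 2 * m ^+ 2 + 2 * l * m ^+ 3
         + m ^+ 4 = v ^+ 2) /\
      (forall v : rat,
         3 * l ^+ 4 + 2 * l ^+ 3 * m + 4 * l ^+ 2 * m ^+ 2 + 2 * l * m ^+ 3
         + m ^+ 4 = v ^+ 2 ->
         let gp := (l ^+ 2 - 2 * l * m - m ^+ 2 - v) / (l + m) in
         let gm := (l ^+ 2 - 2 * l * m - m ^+ 2 + v) / (l + m) in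
         let hp := (l ^+ 2 - 2 * l * m - m ^+ 2 + v) / (l + m) in
         let hm := (l ^+ 2 - 2 * l * m - m ^+ 2 - v) / (l + m) in
         let a := (l ^+ 2 - 2 * l * m - m ^+ 2) / (l + m) in
         let b := - (2 * (l ^+ 3 + 2 * l ^+ 2 * m - l * m ^+ 2)
                     / (l ^+ 2 - 2 * l * m - m ^+ 2)) in
         let t := tau l m in
         angles_are (V l m) (z8 ^+ 4)
           [:: (t + ratr gp, t + ratr hp); (t + ratr gm, t + ratr hm)] /\
         gp * gm = a * b)) /\
   smooth_curve_of_genus w112 curveV 1 /\
   (exists P : 'I_3 -> rat, points curveV P) /\
   smooth_curve w111 (wcubic EV) /\
   (exists phi psi, isomorphism w112 w111 curveV (wcubic EV) phi psi) /\
   MW_Z_Z2 EV (Some (0, 2)))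
  /\
  (* (10) *)
  (forall l m : rat, (l, m) != (0, 0) -> ~ Sexc (proj l m) ->
     ~ (contains_sqamp (V l m) (z8 ^+ 2) /\ contains_sqamp (V l m) (z8 ^+ 4))).

Proof.
have char2 : (2 : rat) != 0 by [].
move=> z8 tau V f; split; first by move=> l m _; exact: tau_half_angle.
split; first by split; [exact: Vpair_space|split=> *; [exact: Vpair_proj|exact: Vproj_proj]].
split; first exact: tau_of_squared_angle.
split; first exact: tau_div_conj.
split.
  by move=> L [l [m [lm ->]]]; rewrite Vproj_proj; exact: homothetic_conj.
split.
  split; first exact: two_to_one_homothety.
  split=> [L hL|l m _]; last exact: iota_proj.
  by split; [exact: iota_projline|exact: iotaK|exact: homothety_class_iota].
split.
  split; first by rewrite iota_proj add0r sub0r.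
  split; first by rewrite iota_proj; congr (proj _ _).
  split; first exact: of_type_quadruple.
  split.
    move=> t s; have -> : s = vec_seq R 0 1 quadruple by rewrite vec_seq_quadruple.
    split; first exact: rational_quadruple.
    split; first exact: quadruple_sqamp.
    by rewrite vec_seq_quadruple; exact: rhombus_quadruple.
  split; first exact: of_type_triples.
  split; last exact: homothetic_V10.
  move=> t s1 s2; have -> : s1 = vec_seq R 1 0 lines1 by rewrite vec_seq_lines1.
  have -> : s2 = vec_seq R 1 0 lines2 by rewrite vec_seq_lines2.
  split; first exact: rational_triple1.
  split; first exact: rational_triple2.
  by split; [exact: triples_disjoint|exact: rational_triples].
split.
  move=> l m lm nS; have [l0 m0 lm0 ln0] := not_Sexc lm nS.
  by split; [exact: two_angles1|exact: two_angles3].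
split.
  split.
    move=> l m lm nS; have [l0 m0 lm0 ln0] := not_Sexc lm nS.
    by split; [exact: contains_sqamp2|exact: two_angles2].
  split; first exact: curveU_genus1.
  split.
    exists (vec3 0 1 0); split; first by exists i1.
    by rewrite peval_curveU !vec3E; ring.
  split; first exact: smooth_wcubicU.
  split; first exact: MW_EU.
  split; first exact: contains_sqamp_iota.
  split; first exact: sigmaU_regular.
  split; first by move=> P _; split; [exact: sigmaUK|rewrite iota_proj].
  exists phiU, psiU; split; last exact: curveU_translation.
  by split; [exact: phiU_regular|exact: psiU_regular|exact: psiU_phiU|exact: phiU_psiU].
split; last exact: not_sqamp2_sqamp4.
split.
  move=> l m lm nS; have [l0 m0 lm0 ln0] := not_Sexc lm nS.
  split; first exact: contains_sqamp4.
  move=> v hv gp gm hp hm a b t; split; first exact: angles_are4.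
  have r0 := form_r_neq0 (or_introl l0 : l != 0 \/ m != 0).
  transitivity (((l ^+ 2 - 2 * l * m - m ^+ 2) ^+ 2 - v ^+ 2) / (l + m) ^+ 2).
    by rewrite /gp /gm; field.
  by rewrite -hv /a /b; field; rewrite ln0 r0.
split; first exact: curveV_genus1.
split.
  exists (vec3 0 1 1); split; first by exists i1.
  by rewrite peval_curveV !vec3E; ring.
split; first exact: smooth_wcubicV.
split; last exact: MW_EV.
exists phiV, psiV.
by split; [exact: phiV_regular|exact: psiV_regular|exact: psiV_phiV|exact: phiV_psiV].
Qed.
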